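(* Let $\Omega$ be a domain in $\mathbb{R}^2$, let $s\ge 1$ be an integer, and let $\phi\colon S^1\to\Omega$ be a Lipschitz immersion. Then $[\phi]\colon H^s\Lambda^1(\Omega)\to\mathbb{R}$ is a bounded linear operator.
   Context: A Lipschitz immersion is a curve $\phi=(\phi_1,\phi_2)\colon S^1\to\Omega$ whose components are Lipschitz functions and whose tangent vector $\phi'$, wherever it is defined (which is almost everywhere), is nonzero. Fix a scale parameter $\sigma>0$. $H^s\Lambda^1(\Omega)$ (also written $H^s_\sigma\Lambda^1(\Omega)$) is the Hilbert space of 1-forms $\alpha=\alpha_1\,dx_1+\alpha_2\,dx_2$ on $\Omega$ with coefficients in the Sobolev space $H^s(\Omega)$, with inner product $$(\alpha,\beta)_{H^s_\sigma}=\int_\Omega\sum_{i=1,2}\ \sum_{0\le|k|\le s}\sigma^{2|k|}\binom{s}{k}(D^k\alpha_i)(D^k\beta_i)\,dx_1\,dx_2,$$ where $k=(k_1,k_2)$ runs over multi-indices and $\binom{s}{k}=\frac{s!}{k_1!\,k_2!\,(s-|k|)!}$. The functional $[\phi]$ is $[\phi](\alpha)=\int_{S^1}\phi^*\alpha=\int_{S^1}\big(\alpha_1(\phi(t))\phi_1'(t)+\alpha_2(\phi(t))\phi_2'(t)\big)\,dt$, where for Sobolev coefficients the restriction of $\alpha_i$ to the curve is understood in the sense of traces (i.e. as the continuous extension from forms that are smooth). *)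

(* Defs.v *)
From HB Require Import structures.
From mathcomp Require Import all_boot all_order all_algebra.
From mathcomp Require Import all_classical all_reals all_analysis.
Set Implicit Arguments.
Unset Strict Implicit.
Unset Printing Implicit Defensive.
Import Order.TTheory GRing.Theory Num.Theory.
Import numFieldNormedType.Exports.
Local Open Scope classical_set_scope.
Local Open Scope ring_scope.

Notation leb := (@lebesgue_measure _).
Notation leb2 := (@lebesgue_measure _ \x @lebesgue_measure _)%E.

Section Definitions.
Context {R : realType}.
Implicit Types (Omega : set (R * R)) (f u v psi : R * R -> R) (k : nat * nat).

Definition domain Omega : Prop :=
  [/\ open Omega, connected Omega & Omega !=set0].

(* The two coordinates are indexed by 'I_2, so the index 0 : 'I_2 is the
   coordinate x_1 and 1 : 'I_2 is the coordinate x_2. *)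
Definition basis_vec (i : 'I_2) : R * R := if i == 0 then (1, 0) else (0, 1).

Definition partial (i : 'I_2) f : R * R -> R :=
  fun x => 'D_(basis_vec i) f x.

(* Classical derivative D^k; only meaningful where the iterated partial
   derivatives exist, 'D_v f x being a default value elsewhere. *)
Definition multi_deriv k f : R * R -> R :=
  iter k.1 (partial 0) (iter k.2 (partial 1) f).

(* Class C^n on an open set; the values of f off Omega play no role. *)
Fixpoint Cn_on (n : nat) Omega f : Prop :=
  (forall x, Omega x -> {for x, continuous f}) /\
  if n is m.+1 then
    forall i : 'I_2, (forall x, Omega x -> derivable f x (basis_vec i)) /\
                     Cn_on m Omega (partial i f)
  else True.

Definition smooth_on Omega f : Prop := forall n, Cn_on n Omega f.

Definition test_function Omega psi : Prop :=
  smooth_on setT psi /\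
  exists K : set (R * R),
    [/\ compact K, K `<=` Omega & forall x, ~ K x -> psi x = 0].

Definition L2_on Omega u : Prop := u \_ Omega \in Lfun leb2 2%:E.

Definition weak_deriv_of Omega k u v : Prop :=
  forall psi, test_function Omega psi ->
    \int[leb2]_(x in Omega) (u x * multi_deriv k psi x) =
    (-1) ^+ (k.1 + k.2) * \int[leb2]_(x in Omega) (v x * psi x).

(* Elements of H^s(Omega) are represented by functions, not by classes modulo
   equality almost everywhere. *)
Definition Hs Omega (s : nat) u : Prop :=
  L2_on Omega u /\
  forall k, (k.1 + k.2 <= s)%N ->
    exists v, L2_on Omega v /\ weak_deriv_of Omega k u v.

(* A chosen representative of the weak derivative D^k u, which is unique
   almost everywhere in Omega. *)
Definition weak_deriv Omega k u : R * R -> R :=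
  xget (fun=> 0) [set v | L2_on Omega v /\ weak_deriv_of Omega k u v].

(* alpha i is the coefficient of dx_(i+1). *)
Definition form1 : Type := 'I_2 -> R * R -> R.

Definition form_lin (a b : R) (alpha beta : form1) : form1 :=
  fun i x => a * alpha i x + b * beta i x.

Definition Hs_form Omega s (alpha : form1) : Prop :=
  forall i, Hs Omega s (alpha i).

Definition smooth_form Omega (alpha : form1) : Prop :=
  forall i, smooth_on Omega (alpha i).

Definition multinom2 (s : nat) k : R :=
  s`!%:R / (k.1`! * k.2`! * (s - (k.1 + k.2))`!)%:R.

Definition Hs_inner (sigma : R) Omega (s : nat) (alpha beta : form1) : R :=
  \int[leb2]_(x in Omega)
    \sum_(i < 2) \sum_(k1 < s.+1) \sum_(k2 < s.+1 | (k1 + k2 <= s)%N)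
      let k := (nat_of_ord k1, nat_of_ord k2) in
      sigma ^+ (2 * (k.1 + k.2)) * multinom2 s k *
      (weak_deriv Omega k (alpha i) x * weak_deriv Omega k (beta i) x).

Definition Hs_norm sigma Omega s (alpha : form1) : R :=
  Num.sqrt (Hs_inner sigma Omega s alpha alpha).

(* S^1 is R / (2 pi Z): a curve is a 2 pi - periodic map on the line. *)
Definition lipschitz_immersion Omega (phi : R -> R * R) : Prop :=
  [/\ forall t, phi (t + 2 * pi) = phi t,
      forall t, Omega (phi t),
      lipschitz (fun t => (phi t).1),
      lipschitz (fun t => (phi t).2) &
      forall t, derivable (fun t => (phi t).1) t 1 ->
                derivable (fun t => (phi t).2) t 1 ->
        (derive1 (fun t => (phi t).1) t, derive1 (fun t => (phi t).2) t) <> (0, 0)].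

(* phi' exists almost everywhere and the default value of the derivative at
   the exceptional points does not affect the integral. *)
Definition pullback_integral (phi : R -> R * R) (alpha : form1) : R :=
  \int[leb]_(t in `[0, 2 * pi])
    (alpha 0 (phi t) * derive1 (fun t => (phi t).1) t +
     alpha 1 (phi t) * derive1 (fun t => (phi t).2) t).

(* The filter "beta --> alpha in H^s, beta smooth". *)
Definition smooth_nbhs sigma Omega s (alpha : form1) : set_system form1 :=
  filter_from [set e : R | 0 < e]
    (fun e => [set beta | [/\ smooth_form Omega beta, Hs_form Omega s beta &
                           Hs_norm sigma Omega s (form_lin 1 (-1) beta alpha) < e]]).

(* [phi] on H^s: the extension by continuity of the pullback integral from the
   smooth forms. *)
Definition curve_functional sigma Omega s (phi : R -> R * R) (alpha : form1)
    : R :=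
  lim (pullback_integral phi @ smooth_nbhs sigma Omega s alpha).

End Definitions.

(* Main.v *)
(* The curve is closed, so for a mollifier [th] with primitive [Th] the smooth
   function w(x) = \int th(x1 - phi1) Th(x2 - phi2) phi1' dt also equals
   - \int Th(x1 - phi1) th(x2 - phi2) phi2' dt: it is a mollified winding
   function, and its gradient is the mollified current (- mu2, mu1) carried by
   the curve.  The two formulas bound |w| by a function of x1 alone and by a
   function of x2 alone, whence \int w^2 <= (L T)^2 uniformly in the
   mollification.  Integrating by parts against a cutoff of w therefore bounds
   \int alpha_1 mu1 + alpha_2 mu2 by the H^1 norm of alpha, and the mollification
   parameter tends to 0.  The extension to H^s rests on the Meyers-Serrin theorem
   and on the almost everywhere uniqueness of weak derivatives, both obtained by
   mollification. *)
Require Import Defs.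
From HB Require Import structures.
From mathcomp Require Import all_boot all_order all_algebra.
From mathcomp Require Import all_classical all_reals all_analysis.
From mathcomp Require Import finmap measurable_realfun ring lra.
Import Order.TTheory GRing.Theory Num.Theory.
Import numFieldNormedType.Exports.
Local Open Scope classical_set_scope.
Local Open Scope ring_scope.

Set Implicit Arguments.
Unset Strict Implicit.
Unset Printing Implicit Defensive.

(** * Bounded smooth functions and mollifiers on the line *)

(** A Lipschitz curve may cross or retrace itself and need not be locally a graph, so no charts
    flatten it and reduce the estimate to the trace theorem on a half-plane. Passing to a potential
    w of the rotated mollified current avoids all local geometry: the current is in general
    unbounded in L2 as the mollification shrinks, whereas w, one derivative smoother, stays bounded.
    The passage from one-variable bounds to L2 is Gagliardo's: w^2 <= A(x1) B(x2), where A and B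
    both have integral L T because the kernel has mass one and the parameter interval has length T.
    After the integration by parts only alpha, d_2 alpha_1 and d_1 alpha_2 remain, so first
    derivatives in L2 suffice. The cutoff is fixed by the curve before the mollification parameter
    is chosen, hence every constant survives the limit. For the extension to H^s a single global
    convolution would not do, since Omega is an arbitrary open set with no regularity at its
    boundary: each piece of a partition of unity is mollified at its own radius. *)

Section SmoothBounded.
Context {R : realType}.
Implicit Types (f g : R -> R) (n : nat).

Fixpoint Cb n g : Prop :=
  [/\ exists M, forall x, `|g x| <= M, forall x : R, derivable g x 1 &
      if n is m.+1 then Cb m (derive1 g) else True].

(** Global bounds on all derivatives, rather than mere smoothness, supply the dominating functions
    for differentiation under the integral sign. Primitives of mollifiers, which are not compactly
    supported, belong to this class as well. *)
Definition Cboo g := forall n, Cb n g.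

Lemma is_derive_derive1 f (f' : R -> R) :
  (forall x : R, is_derive x 1 f (f' x)) -> (derive1 f) = f'.
Proof. by move=> h; apply/funext => x; rewrite derive1E derive_val. Qed.

Lemma CbW n g : Cb n.+1 g -> Cb n g.
Proof.
elim: n g => [|n IH] g [bg dg Cg]; first by split; [exact: bg|exact: dg|].
by split; [exact: bg|exact: dg|exact: IH].
Qed.

Lemma Cboo_bounded g : Cboo g -> exists2 M : R, 0 <= M & forall x, `|g x| <= M.
Proof.
move=> /(_ 0%N)[[M gM] _ _]; exists M => //.
exact: le_trans (normr_ge0 (g 0)) (gM 0).
Qed.

Lemma Cboo_derivable g : Cboo g -> forall x : R, derivable g x 1.
Proof. by move=> /(_ 0%N)[]. Qed.

Lemma Cboo_is_derive g : Cboo g -> forall x : R, is_derive x 1 g ((derive1 g) x).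
Proof.
by move=> Cg x; rewrite derive1E; apply: derivableP; exact: Cboo_derivable.
Qed.

Lemma Cboo_derive1 g : Cboo g -> Cboo (derive1 g).
Proof. by move=> Cg n; have [] := Cg n.+1. Qed.

Lemma Cboo_derive1n g n : Cboo g -> Cboo (iter n (@derive1 R R) g).
Proof. by move=> Cg; elim: n => //= n; exact: Cboo_derive1. Qed.

Lemma Cboo_continuous g : Cboo g -> continuous g.
Proof.
by move=> Cg x; apply/differentiable_continuous/derivable1_diffP/Cboo_derivable.
Qed.

Lemma Cboo_measurable g : Cboo g -> measurable_fun setT g.
Proof. by move=> /Cboo_continuous; exact: continuous_measurable_fun. Qed.

Lemma Cboo_intro f f' : (exists M, forall x, `|f x| <= M) ->
  (forall x : R, is_derive x 1 f (f' x)) -> Cboo f' -> Cboo f.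
Proof.
move=> bf df Cf'; case => [|n]; split=> //; last by rewrite (is_derive_derive1 df).
Qed.

Lemma Cboo_lipschitz g : Cboo g ->
  exists2 M : R, 0 <= M & forall x y, `|g x - g y| <= M * `|x - y|.
Proof.
move=> Cg; have [M M0 gM] := Cboo_bounded (Cboo_derive1 Cg).
exists M => // x y.
wlog xy : x y / y <= x.
  move=> H; have [/H//|/ltW/H] := leP y x.
  by rewrite distrC (distrC y).
have [c _ ->] := @MVT_segment R g ((derive1 g)) y x xy
  (fun z _ => Cboo_is_derive Cg z) (continuous_subspaceT (Cboo_continuous Cg)).
by rewrite normrM ler_wpM2r.
Qed.

Lemma Cb_add n f g : Cb n f -> Cb n g -> Cb n (f + g).
Proof.
elim: n f g => [|n IH] f g [[M fM] df Cf] [[N gN] dg Cg];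
  (split; [by exists (M + N) => x; rewrite (le_trans (ler_normD _ _))// lerD
          |by move=> x; exact: derivableD|]); first exact: I.
rewrite (_ : (derive1 (f + g)) = (derive1 f) + (derive1 g)); first exact: IH.
by apply/funext => x; rewrite derive1E deriveD// -!derive1E.
Qed.

Lemma Cb_mul n f g : Cb n f -> Cb n g -> Cb n (f * g).
Proof.
elim: n f g => [|n IH] f g [[M fM] df Cf] [[N gN] dg Cg];
  (split; [by exists (M * N) => x; rewrite normrM ler_pM
          |by move=> x; exact: derivableM|]); first exact: I.
rewrite (_ : (derive1 (f * g)) = f * (derive1 g) + g * (derive1 f)); last first.
  by apply/funext => x; rewrite derive1E deriveM// -!derive1E.
by apply: Cb_add; apply: IH => //; apply: CbW; split => //;
  [exists M|exists N].
Qed.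

Lemma Cboo_mul f g : Cboo f -> Cboo g -> Cboo (f * g).
Proof. by move=> Cf Cg n; exact: Cb_mul. Qed.

Lemma Cboo_cst (c : R) : Cboo (cst c).
Proof.
move=> n; elim: n c => [|n IH] c; split=> //=; try by exists `|c|.
rewrite (_ : derive1 _ = cst 0)//.
by apply/funext => x; rewrite derive1E derive_cst.
Qed.

Lemma Cboo_scale c f : Cboo f -> Cboo (fun x => c * f x).
Proof. by move=> Cf; exact: (Cboo_mul (Cboo_cst c) Cf). Qed.

Lemma is_derive_affine f (a b : R) (x : R) : derivable f (a + b * x) 1 ->
  is_derive x 1 (fun x => f (a + b * x)) (derive1 f (a + b * x) * b).
Proof.
move=> df; apply: (@is_derive1_comp _ f (fun x => a + b * x)).
  by rewrite derive1E; exact/derivableP.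
apply: is_derive_eq.
by rewrite add0r mul1r; exact: mulr1.
Qed.

Lemma Cb_affine n f (a b : R) : Cb n f -> Cb n (fun x => f (a + b * x)).
Proof.
elim: n f => [|n IH] f [[M fM] df Cf].
  split=> //; first by exists M => x.
  by move=> x; have [] := is_derive_affine (df (a + b * x)).
split=> //; first by exists M => x.
  by move=> x; have [] := is_derive_affine (df (a + b * x)).
rewrite (is_derive_derive1 (fun x => is_derive_affine (df (a + b * x)))).
rewrite (_ : (fun x => _) = (fun x => derive1 f (a + b * x)) * cst b)//.
by apply: Cb_mul; [exact: IH|exact: Cboo_cst].
Qed.

Lemma Cboo_affine f a b : Cboo f -> Cboo (fun x => f (a + b * x)).
Proof. by move=> Cf n; exact: Cb_affine. Qed.

(** The functions x^-k exp(-1/x), extended by 0, are considered for all k at once because their span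
    is stable under differentiation; smoothness of exp(-1/x) then follows by induction. *)
Definition flat k (x : R) : R :=
  if 0 < x then x^-1 ^+ k * expR (- x^-1) else 0.

Lemma flat_ge0 k x : 0 <= flat k x.
Proof. by rewrite /flat; case: ifPn => // x0; rewrite mulr_ge0 ?exprn_ge0 ?expR_ge0 ?invr_ge0// ltW. Qed.

Lemma flat_bounded k : exists M, forall x, `|flat k x| <= M.
Proof.
exists (k.+1%:R ^+ k) => x; rewrite ger0_norm ?flat_ge0// /flat.
case: ifPn => [x0|_]; last by rewrite exprn_ge0.
set y := x^-1; have y0 : 0 < y by rewrite invr_gt0.
rewrite expRN ler_pdivrMr ?expR_gt0//.
have k0 : (0 : R) < k.+1%:R by [].
(* Scaling by [k.+1] instead of k avoids a division by zero at k = 0; the price is one extra factor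
   [expR (y / k.+1%:R)], which is at least 1. *)
have H : (y / k.+1%:R) ^+ k <= expR y.
  have -> : expR y = expR (y / k.+1%:R) ^+ k.+1.
    by rewrite -expRM_natl mulrC divfK.
  have e1 : 1 <= expR (y / k.+1%:R) by rewrite (le_trans _ (expR_ge1Dx _))// lerDl divr_ge0// ltW.
  apply: (@le_trans _ _ (expR (y / k.+1%:R) ^+ k)); last first.
    by rewrite exprS ler_peMl// exprn_ge0// expR_ge0.
  rewrite lerXn2r ?nnegrE ?expR_ge0 ?divr_ge0// ?ltW//.
  by rewrite (lt_le_trans _ (expR_ge1Dx _))// ltrDr.
move: H; rewrite expr_div_n ler_pdivrMr ?exprn_gt0//.
by rewrite mulrC.
Qed.

Lemma flat_is_derive k (x : R) :
  is_derive x 1 (flat k) (flat k.+2 x - k%:R * flat k.+1 x).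
Proof.
have [x0|x0|->] := ltgtP x 0.
- rewrite /flat !ltNge !(ltW x0)/= mulr0 subr0.
  apply: (@near_eq_is_derive _ _ _ (cst 0)).
  near=> z; rewrite ifF// ltNge; apply/negbF/ltW.
  by near: z; exact: lt_nbhsl.
- have xn0 : x != 0 by rewrite gt_eqF.
  have D1 : is_derive x 1 (fun z : R => z^-1) (- x ^- 2).
    by apply: is_derive_eq; first exact: (is_deriveV xn0); exact: mulr1.
  have D2 : is_derive x 1 (fun z : R => expR (- z^-1)) (expR (- x^-1) * x ^- 2).
    apply: (@is_derive1_comp _ expR (fun z : R => - z^-1)).
    by apply: is_derive_eq; rewrite opprK.
  have D3 : is_derive x 1 (fun z : R => z^-1 ^+ k)
      (- (k%:R * x^-1 ^+ k.-1 * x ^- 2)).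
    have DX := is_deriveX k D1.
    rewrite (_ : (fun z => _) = (fun z : R => z^-1) ^+ k); last by apply/funext => z; rewrite fctE.
    apply: (is_derive_eq DX).
    by rewrite  /GRing.scale/= mulrN mulr_natl.
  have D := is_deriveM D3 D2.
  have N : \near x, (fun z : R => z^-1 ^+ k * expR (- z^-1)) x = flat k x.
    by near=> z; rewrite /flat ifT//; near: z; exact: lt_nbhsr.
  have := near_eq_is_derive N D.
  move=> D'; apply: (is_derive_eq D'); rewrite /flat x0 /GRing.scale/= -(exprVn x).
  case: k {D3 D N D'} => [|k]; first by rewrite !exprS; ring.
  by rewrite -pred_Sn !exprS -natr1; ring.
(* At 0 the difference quotient equals [h * flat k.+2 h], and [flat k.+2] is bounded. *)
- rewrite /flat ltxx mulr0 subr0.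
  have [M Mb] := flat_bounded k.+2.
  apply: DeriveDef; last rewrite /derive.
  all: have H : h^-1 *: (flat k (h *: 1 + 0) - flat k 0) @[h --> (0:R)^'] --> (0:R).
  1,3: apply/cvgrPdist_le => e e0; near=> h;
    have h0 : h != 0 by near: h; exact: nbhs_dnbhs_neq.
  1,2: rewrite sub0r normrN addr0 [h *: 1]mulr1 {2}/flat ltxx subr0.
  1,2: have -> : h^-1 *: flat k h = h * flat k.+2 h by
    rewrite /flat; case: ifPn => _; rewrite ?scaler0 ?mulr0// /GRing.scale/= !exprS !mulrA;
    congr (_ * _); rewrite divff// mul1r.
  1,2: rewrite normrM (@le_trans _ _ (`|h| * (`|M| + 1)))//.
  1,3: by rewrite ler_wpM2l// (le_trans (Mb _))// (le_trans (ler_norm M))// lerDl.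
  1,2: rewrite -ler_pdivlMr ?ltr_wpDl//.
  1,2: near: h; apply: dnbhs0_le; rewrite divr_gt0// ltr_wpDl//.
  + by apply/cvg_ex; exists 0.
  + exact/cvg_lim.
Unshelve. all: by end_near. Qed.

Lemma flat_Cboo k : Cboo (flat k).
Proof.
move=> n; elim: n k => [|n IH] k.
  by split=> //; [exact: flat_bounded|move=> x; have [] := flat_is_derive k x].
split; [exact: flat_bounded|by move=> x; have [] := flat_is_derive k x|].
rewrite (is_derive_derive1 (flat_is_derive k)).
rewrite (_ : (fun x => _) = flat k.+2 + (cst (- k%:R)) * flat k.+1); last first.
  by apply/funext => x /=; rewrite /cst /GRing.add/= /GRing.mul/= mulNr.
by apply: Cb_add => //; apply: Cb_mul => //; exact: Cboo_cst.
Qed.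

End SmoothBounded.

Section Mollifier.
Context {R : realType}.

(** [Th] is a smoothed Heaviside function, from which the winding function is built. Evenness of
    [th] makes convolution with it self-adjoint. *)
Record mollifier (e : R) (th Th : R -> R) : Prop := Mollifier {
  moll_Cboo : Cboo th;
  moll_prim_Cboo : Cboo Th;
  moll_ge0 : forall x, 0 <= th x;
  moll_even : forall x, th (- x) = th x;
  moll_supp : forall x, e <= `|x| -> th x = 0;
  moll_primE : derive1 Th = th;
  moll_prim_ge0 : forall x, 0 <= Th x;
  moll_prim_le1 : forall x, Th x <= 1;
  moll_integrable : leb.-integrable setT (EFin \o th);
  moll_integral : (\int[leb]_x (th x)%:E = 1)%E }.

Lemma integrable_bounded_supp (f : R -> R) (a M : R) : measurable_fun setT f ->
  (forall x, `|f x| <= M) -> (forall x, a <= `|x| -> f x = 0) ->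
  leb.-integrable setT (EFin \o f).
Proof.
move=> mf fM f0.
have E : f = f \_ `[-a, a].
  apply/funext => x; rewrite patchE; case: ifPn => //.
  rewrite notin_setE/= in_itv/= => /negP; rewrite -ler_norml -ltNge => /ltW.
  exact: f0.
rewrite E -restrict_EFin; apply/integrable_restrict => //=.
rewrite setTI.
apply: measurable_bounded_integrable => //.
- by rewrite /= lebesgue_measure_itv/=; case: ifP => //; rewrite -EFinD ltry.
- exact: measurable_funTS.
exists M; split; first exact: num_real.
by move=> N MN x _ /=; rewrite (le_trans (fM x))// ltW.
Qed.

Lemma mollifier_exists (e : R) : 0 < e -> exists th Th, mollifier e th Th.
Proof.
move=> e0.
pose b : R -> R := (fun x => flat 0 (e + 1 * x)) * (fun x => flat 0 (e + (-1) * x)).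
have Cb_b : Cboo b by apply: Cboo_mul; apply: Cboo_affine; exact: flat_Cboo.
have bE x : b x = flat 0 (e + x) * flat 0 (e - x).
  by rewrite -[in e + x](mul1r x) -mulN1r.
have b_ge0 x : 0 <= b x by rewrite mulr_ge0 ?flat_ge0.
have b_even x : b (- x) = b x.
  by rewrite !bE opprK mulrC.
have b_supp x : e <= `|x| -> b x = 0.
  rewrite ler_normr => /orP[ex|ex]; rewrite bE /flat.
    by rewrite [X in _ * X]ifF ?mulr0//; apply/negbTE; rewrite -leNgt subr_le0.
  by rewrite ifF ?mul0r//; apply/negbTE; rewrite -leNgt -lerBrDl sub0r lerNr.
have mb : measurable_fun setT b by exact: Cboo_measurable.
have [M M0 bM] := Cboo_bounded Cb_b.
have ib : leb.-integrable setT (EFin \o b) by exact: integrable_bounded_supp mb bM b_supp.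
pose c := \int[leb]_x b x.
have cE : (\int[leb]_x (b x)%:E = c%:E)%E.
  by rewrite /c /Rintegral fineK//; exact: integrable_fin_num ib.
have c0 : 0 < c.
  (* On [-e/2, e/2] both e + x and e - x are at least e/2, so [m] bounds [b] from below there and
     the integral of [b] is positive. *)
  pose m := expR (- (e / 2)^-1) ^+ 2.
  have e2 : 0 < e / 2 by rewrite divr_gt0.
  have mlt : 0 < m by rewrite exprn_gt0// expR_gt0.
  rewrite -lte_fin -cE.
  pose I : set R := `[- (e / 2), e / 2]%classic.
  have mI : measurable I by exact: measurable_itv.
  have H1 : (0 < \int[leb]_(x in I) m%:E)%E.
    rewrite /I.
    rewrite integral_cst//= lebesgue_measure_itv/= lte_fin ifT; last by lra.
    by rewrite -EFinD -EFinM lte_fin mulr_gt0// opprK addr_gt0.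
  have H2 : (\int[leb]_(x in I) m%:E
      <= \int[leb]_(x in I) (b x)%:E)%E.
    apply: ge0_le_integral => //=.
    - by move=> x _; rewrite lee_fin ltW.
    - by apply/measurable_EFinP; exact: measurable_funTS.
    move=> x; rewrite /I/= in_itv/= => /andP[x1 x2]; rewrite lee_fin /m expr2 bE.
    have fl y : e / 2 <= y -> expR (- (e / 2)^-1) <= flat 0 y.
      move=> ey; rewrite /flat (lt_le_trans e2 ey) expr0 mul1r ler_expR lerN2.
      by rewrite lef_pV2// posrE// (lt_le_trans e2 ey).
    by apply: ler_pM; rewrite ?expR_ge0//; apply: fl; lra.
  apply: (lt_le_trans H1); apply: (le_trans H2).
  apply: ge0_subset_integral => //=; first exact/measurable_EFinP.
  by move=> x _; rewrite lee_fin.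
pose th x := c^-1 * b x.
have Cth : Cboo th by exact: Cboo_scale.
have th_ge0 x : 0 <= th x by rewrite mulr_ge0// invr_ge0 ltW.
have ith : leb.-integrable setT (EFin \o th).
  have -> : EFin \o th = (fun x => (c^-1)%:E * (b x)%:E)%E by apply/funext => x.
  exact: integrableZl.
have int_th : (\int[leb]_x (th x)%:E = 1)%E.
  rewrite (_ : (fun x => _) = (fun x => (c^-1)%:E * (b x)%:E)%E)// integralZl//.
  by rewrite cE -EFinM mulVf// gt_eqF.
pose Th x := \int[leb]_(t in `]-oo, x]) th t.
have Th_ge0 x : 0 <= Th x by exact: Rintegral_ge0.
have Th_le1 x : Th x <= 1.
  rewrite -lee_fin /Th /Rintegral fineK; last first.
    by apply: integrable_fin_num => //; apply: integrableS ith.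
  rewrite -int_th; apply: ge0_subset_integral => //=; first by case/integrableP: ith.
  by move=> y _; rewrite lee_fin.
have dTh x : derivable Th x 1 /\ derive1 Th x = th x.
  apply: (@continuous_FTC1 R th -oo%O x (x + 1)) => //.
  - by rewrite ltrDl.
  - by apply: integrableS ith.
  - by rewrite ltNyr.
  - exact: Cboo_continuous.
have ThE : derive1 Th = th by apply/funext => x; have [] := dTh x.
exists th, Th; split => //.
- apply: (@Cboo_intro _ Th th) => //.
    by exists 1 => x; rewrite ger0_norm.
  by move=> x; have [d1 <-] := dTh x; rewrite derive1E; exact: derivableP.
- by move=> x; rewrite /th b_even.
- by move=> x /b_supp; rewrite /th => ->; rewrite mulr0.
Qed.

End Mollifier.

(** * Square-integrable functions *)

Section SquareIntegrable.
Context {R : realType} d {T : measurableType d} (mu : {measure set T -> \bar R}).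
Implicit Types (f g : T -> R).

Definition sqint f : Prop :=
  measurable_fun setT f /\ mu.-integrable setT (EFin \o (fun x => f x ^+ 2)).

Lemma sqintP f : (f \in Lfun mu 2%:E) <-> sqint f.
Proof.
split=> [lf|[mf intf]].
  split; last exact: Lfun2_integrable_sqr.
  by move: lf => /andP[/[!classical_sets.inE]/= + _].
apply/andP; split; rewrite classical_sets.inE//=.
rewrite /finite_norm unlock/=.
apply: poweR_lty; case/integrableP: intf => _; apply: le_lt_trans.
apply: ge0_le_integral => //.
- apply/measurable_EFinP.
  apply: (@measurableT_comp _ _ _ _ _ _ (fun x : R => x `^ 2)%R) => //.
  exact: measurableT_comp.
- apply/measurable_EFinP; apply: measurableT_comp => //; exact: measurable_funX.
- by move=> x _ /=; rewrite lee_fin normrX powR_mulrn.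
Qed.

Lemma integrable_fctM f g : sqint f -> sqint g ->
  mu.-integrable setT (EFin \o (fun x => f x * g x)).
Proof.
move=> [mf if2] [mg ig2].
apply: (@le_integrable _ _ _ mu _ measurableT _
  (EFin \o (fun x => f x ^+ 2 + g x ^+ 2))).
- by apply/measurable_EFinP; exact: measurable_funM.
- move=> x _; rewrite lee_fin [leRHS]ger0_norm ?addr_ge0 ?sqr_ge0// ler_norml.
  have := sqr_ge0 (f x + g x); have := sqr_ge0 (f x - g x); nra.
- exact: (integrableD measurableT if2 ig2).
Qed.

Lemma sqintD f g : sqint f -> sqint g -> sqint (fun x => f x + g x).
Proof.
move=> sf sg; have := integrable_fctM sf sg; case: sf sg => mf if2 [mg ig2] ifg.
split; first exact: measurable_funD.
have := integrableD measurableT (integrableD measurableT if2 ig2)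
  (integrableZl measurableT 2 ifg).
by apply: eq_integrable => // x _ /=; rewrite -EFinM -!EFinD; congr EFin; ring.
Qed.

Lemma sqintM f g (M : R) : sqint f -> measurable_fun setT g ->
  (forall x, `|g x| <= M) -> sqint (fun x => g x * f x).
Proof.
move=> [mf if2] mg gM; split; first exact: measurable_funM.
apply: (@le_integrable _ _ _ mu _ measurableT _ (EFin \o (fun x => M ^+ 2 * f x ^+ 2))).
- by apply/measurable_EFinP; apply: measurable_funX; exact: measurable_funM.
- move=> x _; rewrite lee_fin [leLHS]ger0_norm ?sqr_ge0//.
  rewrite [leRHS]ger0_norm; last by apply: mulr_ge0; exact: sqr_ge0.
  rewrite exprMn ler_wpM2r ?sqr_ge0// -(real_normK (num_real (g x))).
  by rewrite lerXn2r// nnegrE (le_trans _ (gM x)).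
- exact: (integrableZl measurableT (M ^+ 2) if2).
Qed.

Lemma sqint_dominated f g : sqint f -> measurable_fun setT g ->
  (forall x, `|g x| <= `|f x|) -> sqint g.
Proof.
move=> [mf if2] mg gf; split => //; apply: (le_integrable _ _ _ if2) => //.
  by apply/measurable_EFinP; exact: measurable_funX.
by move=> x _; rewrite lee_fin !normrX lerXn2r// nnegrE.
Qed.

Lemma sqintZ f c : sqint f -> sqint (fun x => c * f x).
Proof. by move=> sf; apply: (@sqintM _ (cst c) `|c|). Qed.

Lemma sqintB f g : sqint f -> sqint g -> sqint (fun x => f x - g x).
Proof.
move=> sf sg; rewrite (_ : (fun x => _) = (fun x => f x + (-1) * g x)).
  by apply: sqintD => //; exact: sqintZ.
by apply/funext => x; rewrite mulN1r.
Qed.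

Lemma sqint0 : sqint (cst 0).
Proof.
split => //; rewrite (_ : EFin \o _ = cst 0%E); first exact: integrable0.
by apply/funext => x /=; rewrite expr0n.
Qed.

Lemma sqint_sum (I : Type) (s : seq I) (F : I -> T -> R) :
  (forall i, sqint (F i)) -> sqint (fun x => \sum_(i <- s) F i x).
Proof.
move=> sF; elim: s => [|i s IH].
  by under eq_fun do rewrite big_nil; exact: sqint0.
by under eq_fun do rewrite big_cons; exact: sqintD.
Qed.

(** The L2 norm is kept squared, so that estimates are comparisons of integrals; (a + b)^2 <= 2 a^2
    + 2 b^2 replaces the Minkowski inequality. *)
Definition nrm2 f : R := \int[mu]_x (f x ^+ 2).

Lemma nrm2_ge0 f : 0 <= nrm2 f.
Proof. by apply: Rintegral_ge0 => x _; exact: sqr_ge0. Qed.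

Lemma nrm2E f : sqint f -> (\int[mu]_x (f x ^+ 2)%:E = (nrm2 f)%:E)%E.
Proof. by case=> _ if2; rewrite /nrm2 /Rintegral fineK//; exact: integrable_fin_num if2. Qed.

Lemma sqint_le f (c : R) : measurable_fun setT f ->
  (\int[mu]_x (f x ^+ 2)%:E <= c%:E)%E -> sqint f /\ nrm2 f <= c.
Proof.
move=> mf fc; have sf : sqint f.
  split=> //; apply/integrableP; split.
    by apply/measurable_EFinP; exact: measurable_funX.
  under eq_integral do rewrite /= ger0_norm ?sqr_ge0//.
  by rewrite (le_lt_trans fc)// ltry.
by split => //; rewrite -lee_fin -nrm2E.
Qed.

Lemma nrm2D f g : sqint f -> sqint g ->
  nrm2 (fun x => f x + g x) <= 2 * nrm2 f + 2 * nrm2 g.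
Proof.
move=> sf sg; have [_ i1] := sf; have [_ i2] := sg.
have [_ i3] := sqintD sf sg.
rewrite /nrm2 -!RintegralZl// -RintegralD//; last 2 first.
- exact: (integrableZl measurableT 2 i1).
- exact: (integrableZl measurableT 2 i2).
apply: le_Rintegral => //.
  exact: (integrableD measurableT (integrableZl measurableT 2 i1)
    (integrableZl measurableT 2 i2)).
by move=> x _; have := sqr_ge0 (f x - g x); nra.
Qed.

Lemma nrm2Z f c : sqint f -> nrm2 (fun x => c * f x) = c ^+ 2 * nrm2 f.
Proof.
move=> [_ i1]; rewrite /nrm2 -RintegralZl//.
by apply: eq_Rintegral => x _; rewrite exprMn.
Qed.

(** The quadratic form sending (a, b) to the integral of (a f + b g)^2 is nonnegative; at (-I,
    [nrm2 f]) it equals [nrm2 f] times the difference of the two sides. *)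
Lemma cauchy_schwarz_sqr f g : sqint f -> sqint g ->
  (\int[mu]_x (f x * g x)) ^+ 2 <= nrm2 f * nrm2 g.
Proof.
move=> sf sg; set I := \int[mu]_x (f x * g x).
have [_ i1] := sf; have [_ i2] := sg; have i3 := integrable_fctM sf sg.
have H a b : 0 <= a ^+ 2 * nrm2 f + b ^+ 2 * nrm2 g + 2 * a * b * I.
  rewrite /nrm2 /I -!RintegralZl// -RintegralD//; last 2 first.
  - exact: (integrableZl measurableT _ i1).
  - exact: (integrableZl measurableT _ i2).
  rewrite -RintegralD//; last 2 first.
  - exact: (integrableD measurableT (integrableZl measurableT _ i1)
      (integrableZl measurableT _ i2)).
  - exact: (integrableZl measurableT _ i3).
  apply: Rintegral_ge0 => x _.
  by have := sqr_ge0 (a * f x + b * g x); nra.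
have A0 := nrm2_ge0 f; have B0 := nrm2_ge0 g.
have [f0|f0] := eqVneq (nrm2 f) 0.
  have [->|I0] := eqVneq I 0; first by rewrite f0 expr0n mul0r.
  (* Degenerate case: the form is now affine in its first argument, with slope 2 I, and this value
     makes it negative. *)
  have := H (- (nrm2 g + 1) / I) 1; rewrite f0 mulr0 add0r expr1n mul1r mulr1.
  by rewrite -mulrA divfK//; lra.
have := H (- I) (nrm2 f).
have f1 : 0 < nrm2 f by rewrite lt_def f0.
rewrite (_ : _ + _ = nrm2 f * (nrm2 f * nrm2 g - I ^+ 2)); last by ring.
by rewrite pmulr_rge0// subr_ge0.
Qed.

Lemma cauchy_schwarz f g : sqint f -> sqint g ->
  `|\int[mu]_x (f x * g x)| <= Num.sqrt (nrm2 f) * Num.sqrt (nrm2 g).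
Proof.
move=> sf sg; rewrite -sqrtrM ?nrm2_ge0// -sqrtr_sqr ler_sqrt ?cauchy_schwarz_sqr//.
by rewrite mulr_ge0 ?nrm2_ge0.
Qed.

Lemma le_nrm2 f g : sqint f -> sqint g -> (forall x, `|f x| <= `|g x|) ->
  nrm2 f <= nrm2 g.
Proof.
move=> [_ i1] [_ i2] fg; apply: le_Rintegral => // x _.
by rewrite -(real_normK (num_real (f x))) -(real_normK (num_real (g x))) lerXn2r// nnegrE.
Qed.

Lemma nrm2_eq0_ae f : sqint f -> nrm2 f = 0 -> {ae mu, forall x, f x = 0}.
Proof.
move=> sf f0; have := nrm2E sf; rewrite f0 => E; have [mf _] := sf.
have : (\int[mu]_(x in setT) `|(f x ^+ 2)%:E| = 0)%E.
  rewrite -[RHS]E; apply: eq_integral => x _; by rewrite gee0_abs// lee_fin sqr_ge0.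
have mf2 : measurable_fun setT (fun x => (f x ^+ 2)%:E).
  by apply/measurable_EFinP; exact: measurable_funX.
move=> /(ae_eq_integral_abs mu measurableT mf2).
apply: filterS => x /(_ I)/= []; by move/eqP; rewrite sqrf_eq0 => /eqP.
Qed.

End SquareIntegrable.

(** * Smooth functions on the plane *)

Section Cn.
Context {R : realType}.
Implicit Types (f g : R * R -> R) (O U : set (R * R)) (x : R * R) (n : nat).

Lemma is_derive0P f x (d : R) : is_derive x (basis_vec 0) f d <->
  is_derive x.1 1 (fun t : R => f (t, x.2)) d.
Proof.
have E : (fun h : R => h^-1 *: (f (h *: basis_vec 0 + x) - f x)) =
  (fun h : R => h^-1 *: ((fun t : R => f (t, x.2)) (h *: 1 + x.1) -
     (fun t : R => f (t, x.2)) x.1)).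
  apply/funext => h; case: x => a b /=; congr (_ *: (f _ - _)).
  by rewrite (_ : _ + _ = (h *: 1 + a, h *: 0 + b))// scaler0 add0r.
by split=> -[]; rewrite /derivable /derive ?E => ? <-; constructor;
  rewrite /derivable /derive ?E.
Qed.

Lemma is_derive1P f x (d : R) : is_derive x (basis_vec 1) f d <->
  is_derive x.2 1 (fun t : R => f (x.1, t)) d.
Proof.
have E : (fun h : R => h^-1 *: (f (h *: basis_vec 1 + x) - f x)) =
  (fun h : R => h^-1 *: ((fun t : R => f (x.1, t)) (h *: 1 + x.2) -
     (fun t : R => f (x.1, t)) x.2)).
  apply/funext => h; case: x => a b /=; congr (_ *: (f _ - _)).
  by rewrite (_ : _ + _ = (h *: 0 + a, h *: 1 + b))// scaler0 add0r.
by split=> -[]; rewrite /derivable /derive ?E => ? <-; constructor;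
  rewrite /derivable /derive ?E.
Qed.

Lemma Cn_onS n U O f : U `<=` O -> Cn_on n O f -> Cn_on n U f.
Proof.
move=> UO; elim: n f => [|n IH] f [cf df]; split => //; try by move=> x /UO; exact: cf.
by move=> i; have [d1 d2] := df i; split; [move=> x /UO; exact: d1|exact: IH].
Qed.

Lemma Cn_onW n O f : Cn_on n.+1 O f -> Cn_on n O f.
Proof.
elim: n f => [|n IH] f; first by case.
by move=> [cf df]; split => // i; have [d1 d2] := df i; split => //; exact: IH.
Qed.

Lemma partial_near i f g x : (\near x, f x = g x) -> partial i f x = partial i g x.
Proof. by move=> fg; rewrite /partial; exact: near_eq_derive. Qed.

Lemma near_continuous f g x : (\near x, g x = f x) ->
  {for x, continuous g} -> {for x, continuous f}.
Proof.
move=> N; rewrite /prop_for /continuous_at (nbhs_singleton N); apply: cvg_trans.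
exact: near_eq_cvg.
Qed.

(** Continuity and partial derivatives at a point depend only on the germ there, so regularity is a
    local property. This is what makes a locally finite sum of smooth functions smooth. *)
Lemma Cn_on_local n O f :
  (forall x, O x -> exists U, [/\ open U, U x &
     exists2 g, (forall y, U y -> f y = g y) & Cn_on n U g]) ->
  Cn_on n O f.
Proof.
have N U x (g h : R * R -> R) : open U -> U x -> (forall y, U y -> g y = h y) ->
    \near x, h x = g x.
  by move=> oU Ux gh; near=> y; apply/esym/gh; near: y; exact: open_nbhs_nbhs.
elim: n f => [|n IH] f H; split => //.
- move=> x /H[U [oU Ux [g fg [cg _]]]]; exact: near_continuous (N _ _ _ _ oU Ux fg) (cg _ Ux).
- move=> x /H[U [oU Ux [g fg [cg _]]]]; exact: near_continuous (N _ _ _ _ oU Ux fg) (cg _ Ux).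
- move=> i; split.
    move=> x /H[U [oU Ux [g fg [cg dg]]]]; have [dg1 _] := dg i.
    apply: (@near_eq_derivable _ _ _ g); last exact: dg1.
    by near=> y; apply/esym/fg; near: y; exact: open_nbhs_nbhs.
  apply: IH => x /H[U [oU Ux [g fg [cg dg]]]]; have [_ dg1] := dg i.
  exists U; split => //; exists (partial i g) => // y Uy.
  apply: partial_near; near=> z; apply/fg; near: z; exact: open_nbhs_nbhs.
Unshelve. all: by end_near. Qed.

Lemma eq_Cn_on n O f g : open O -> (forall x, O x -> f x = g x) ->
  Cn_on n O f -> Cn_on n O g.
Proof.
move=> oO fg Cf; apply: Cn_on_local => x Ox; exists O; split => //.
by exists f => // y Oy; rewrite fg.
Qed.

Lemma Cn_on_cst n O (c : R) : Cn_on n O (cst c).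
Proof.
elim: n c => [|n IH] c; split => //; try by move=> x _; exact: cvg_cst.
move=> i; split; first by move=> x _; exact: derivable_cst.
rewrite (_ : partial i _ = cst 0)//; apply/funext => x.
by rewrite /partial derive_cst.
Qed.

Lemma Cn_onD n O f g : open O -> Cn_on n O f -> Cn_on n O g -> Cn_on n O (f + g).
Proof.
move=> oO; elim: n f g => [|n IH] f g [cf df] [cg dg]; split => //;
  try by move=> x Ox; apply: cvgD; [exact: cf|exact: cg].
move=> i; have [df1 df2] := df i; have [dg1 dg2] := dg i; split.
  by move=> x Ox; apply: derivableD; [exact: df1|exact: dg1].
apply: (@eq_Cn_on _ _ (partial i f + partial i g)) => //; last exact: IH.
by move=> x Ox; rewrite /partial deriveD//; [exact: df1|exact: dg1].
Qed.

Lemma Cn_onM n O f g : open O -> Cn_on n O f -> Cn_on n O g -> Cn_on n O (f * g).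
Proof.
move=> oO; elim: n f g => [|n IH] f g Cf Cg.
  by case: Cf => cf _; case: Cg => cg _; split => // x Ox;
    apply: cvgM; [exact: cf|exact: cg].
have Cf' := Cn_onW Cf; have Cg' := Cn_onW Cg.
case: Cf => cf df; case: Cg => cg dg; split => //;
  first by move=> x Ox; apply: cvgM; [exact: cf|exact: cg].
move=> i; have [df1 df2] := df i; have [dg1 dg2] := dg i; split.
  by move=> x Ox; apply: derivableM; [exact: df1|exact: dg1].
apply: (@eq_Cn_on _ _ (f * partial i g + g * partial i f)) => //.
  by move=> x Ox; rewrite /partial deriveM//; [exact: df1|exact: dg1].
by apply: Cn_onD => //; exact: IH.
Qed.

Lemma smooth_onD O f g : open O -> smooth_on O f -> smooth_on O g ->
  smooth_on O (f + g).
Proof. by move=> oO Cf Cg n; exact: Cn_onD. Qed.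

Lemma smooth_onM O f g : open O -> smooth_on O f -> smooth_on O g ->
  smooth_on O (f * g).
Proof. by move=> oO Cf Cg n; exact: Cn_onM. Qed.

Lemma smooth_on_cst O (c : R) : smooth_on O (cst c).
Proof. by move=> n; exact: Cn_on_cst. Qed.

Lemma smooth_onZ O (c : R) f : open O -> smooth_on O f ->
  smooth_on O (fun x => c * f x).
Proof. by move=> oO Cf; exact: smooth_onM oO (@smooth_on_cst O c) Cf. Qed.

Lemma smooth_onB O f g : open O -> smooth_on O f -> smooth_on O g ->
  smooth_on O (fun x => f x - g x).
Proof.
move=> oO Cf Cg; rewrite (_ : (fun x => _) = f + (fun x => -1 * g x)).
  by apply: smooth_onD => //; exact: smooth_onZ.
by apply/funext => x; rewrite fctE mulN1r.
Qed.

Lemma smooth_on_continuous O f : smooth_on O f -> forall x, O x -> {for x, continuous f}.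
Proof. by move=> /(_ 0%N)[]. Qed.

Lemma smooth_on_derivable O f i x : smooth_on O f -> O x ->
  derivable f x (basis_vec i).
Proof. by move=> /(_ 1%N)[_ /(_ i)[+ _]] => /(_ x). Qed.

Lemma smooth_on_partial O f i : smooth_on O f -> smooth_on O (partial i f).
Proof. by move=> Cf n; have [_ /(_ i)[]] := Cf n.+1. Qed.

Lemma smooth_on_iter O f i n : smooth_on O f -> smooth_on O (iter n (partial i) f).
Proof. by move=> Cf; elim: n => //= n; exact: smooth_on_partial. Qed.

Lemma smooth_on_multi O f k : smooth_on O f -> smooth_on O (multi_deriv k f).
Proof. by move=> Cf; do 2 apply: smooth_on_iter. Qed.

End Cn.

(** * Differentiation of kernel integrals with respect to the base point *)

Section ParamIntegral.
Context {R : realType} d {Y : measurableType d} (mu : {measure set Y -> \bar R}).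
Variables (D : set Y) (p1 p2 m : Y -> R).
Hypotheses (mD : measurable D) (mp1 : measurable_fun D p1)
  (mp2 : measurable_fun D p2) (im : mu.-integrable D (EFin \o m)).
Implicit Types (g h : R -> R) (x : R * R).

(** One formula for three objects: a convolution (p1, p2 the coordinates, m the function), the
    mollified current and winding function of a curve (p1, p2 the curve, m a component of its
    derivative), and a single translated product (a Dirac mass). *)
Definition pint g h (x : R * R) : R :=
  \int[mu]_(y in D) (g (x.1 - p1 y) * h (x.2 - p2 y) * m y).

Let mm : measurable_fun D m.
Proof. by case/integrableP : im => /measurable_EFinP. Qed.

Lemma measurable_kernel g h x : Cboo g -> Cboo h ->
  measurable_fun D (fun y => g (x.1 - p1 y) * h (x.2 - p2 y) * m y).
Proof.
move=> Cg Ch; apply: measurable_funM => //; apply: measurable_funM.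
  apply: (measurableT_comp (Cboo_measurable Cg)).
  exact: measurable_funB.
apply: (measurableT_comp (Cboo_measurable Ch)).
exact: measurable_funB.
Qed.

Lemma integrable_kernel g h x : Cboo g -> Cboo h ->
  mu.-integrable D (EFin \o (fun y => g (x.1 - p1 y) * h (x.2 - p2 y) * m y)).
Proof.
move=> Cg Ch; have [M M0 gM] := Cboo_bounded Cg; have [N N0 hN] := Cboo_bounded Ch.
apply: (@le_integrable _ _ _ mu D mD _ (EFin \o (fun y => M * N * m y))).
- by apply/measurable_EFinP; exact: measurable_kernel.
- move=> y Dy /=; rewrite lee_fin !normrM ler_wpM2r//.
  by rewrite (ger0_norm M0) (ger0_norm N0) ler_pM.
- exact: (integrableZl mD (M * N) im).
Qed.

Lemma is_derive_pint0 g h x : Cboo g -> Cboo h ->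
  is_derive x (basis_vec 0) (pint g h) (pint (derive1 g) h x).
Proof.
move=> Cg Ch; apply/is_derive0P => /=.
have [M M0 gM] := Cboo_bounded (Cboo_derive1 Cg); have [N N0 hN] := Cboo_bounded Ch.
pose f (t : R) y := g (t - p1 y) * h (x.2 - p2 y) * m y.
pose G y := M * N * `|m y|.
have der (t : R) y : is_derive t 1 (f ^~ y) (derive1 g (t - p1 y) * h (x.2 - p2 y) * m y).
  have D0 : is_derive t 1 (fun s : R => g (- p1 y + 1 * s)) (derive1 g (- p1 y + 1 * t) * 1).
    exact/is_derive_affine/Cboo_derivable.
  pose c := h (x.2 - p2 y) * m y.
  rewrite (_ : f ^~ y = c \*: (fun s : R => g (- p1 y + 1 * s))); last first.
    by apply/funext => s; rewrite /f /= /GRing.scale/= mul1r (addrC (- _)) -mulrA mulrC.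
  apply: is_derive_eq; rewrite /GRing.scale/= mulr1 mul1r addrC /c -mulrA.
  by rewrite mulrC.
(* [I1] to [I6] are the hypotheses of differentiation under the integral. The radius 1 is arbitrary,
   since [G] dominates the derivative for every t. *)
have I1 : `]x.1 - 1, x.1 + 1[%classic x.1 by rewrite /= in_itv/=; lra.
have I2 t : `]x.1 - 1, x.1 + 1[%classic t -> mu.-integrable D (EFin \o f t).
  by move=> _; exact: (@integrable_kernel g h (t, x.2)).
have I3 (t : R) y : `]x.1 - 1, x.1 + 1[%classic t -> D y -> derivable (f ^~ y) t 1.
  by move=> _ _; have [] := der t y.
have I4 y : 0 <= G y by rewrite !mulr_ge0.
have I5 : mu.-integrable D (EFin \o G).
  have /= := integrableZl mD (M * N) (integrable_norm im).
  by apply: eq_integrable.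
have pE t y : partial1of2 f t y = derive1 g (t - p1 y) * h (x.2 - p2 y) * m y.
  by rewrite /partial1of2 derive1E; have [_ ->] := der t y.
have I6 t y : `]x.1 - 1, x.1 + 1[%classic t -> D y -> `|partial1of2 f t y| <= G y.
  by move=> _ _; rewrite pE !normrM ler_wpM2r// ler_pM.
have E := differentiation_under_integral mD I1 I2 I3 I4 I5 I6.
have F := derivable_under_integral mD I1 I2 I3 I4 I5 I6.
constructor; first exact: F.
move: E; rewrite derive1E /pint /f => ->.
by under eq_Rintegral do rewrite pE.
Qed.

End ParamIntegral.

Section ParamIntegralSmooth.
Context {R : realType} d {Y : measurableType d} (mu : {measure set Y -> \bar R}).
Variables (D : set Y) (p1 p2 m : Y -> R).
Hypotheses (mD : measurable D) (mp1 : measurable_fun D p1)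
  (mp2 : measurable_fun D p2) (im : mu.-integrable D (EFin \o m)).
Implicit Types (g h : R -> R) (x : R * R).
Local Notation F := (pint mu D p1 p2 m).

Lemma is_derive_pint1 g h x : Cboo g -> Cboo h ->
  is_derive x (basis_vec 1) (F g h) (F g (derive1 h) x).
Proof.
move=> Cg Ch; apply/is_derive1P.
have := is_derive_pint0 mD mp2 mp1 im (x.2, x.1) Ch Cg.
(* Exchanging the coordinates together with the two factors reduces the claim to the first
   variable. *)
move=> /is_derive0P/= H; have E u v : F u v = (fun z => pint mu D p2 p1 m v u (z.2, z.1)).
  by apply/funext => z; apply: eq_Rintegral => y _ /=; rewrite (mulrC (u _)).
by rewrite !E.
Qed.

Lemma partial_pint0 g h : Cboo g -> Cboo h ->
  partial 0 (F g h) = F (derive1 g) h.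
Proof.
move=> Cg Ch; apply/funext => x.
by rewrite /partial; have [_ ->] := is_derive_pint0 mD mp1 mp2 im x Cg Ch.
Qed.

Lemma partial_pint1 g h : Cboo g -> Cboo h ->
  partial 1 (F g h) = F g (derive1 h).
Proof.
by move=> Cg Ch; apply/funext => x; rewrite /partial; have [_ ->] := is_derive_pint1 x Cg Ch.
Qed.

Lemma multi_deriv_pint k g h : Cboo g -> Cboo h ->
  multi_deriv k (F g h) = F (iter k.1 (@derive1 R R) g) (iter k.2 (@derive1 R R) h).
Proof.
case: k => a b Cg Ch; rewrite /multi_deriv/=.
have -> : iter b (partial 1) (F g h) = F g (iter b (@derive1 R R) h).
  elim: b => //= b ->; rewrite partial_pint1//; exact: Cboo_derive1n.
elim: a => //= a ->; rewrite partial_pint0//; exact: Cboo_derive1n.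
Qed.

Lemma pint_continuous g h : Cboo g -> Cboo h -> continuous (F g h).
Proof.
move=> Cg Ch x; apply/cvgrPdist_le => e e0.
have [M M0 gM] := Cboo_bounded Cg; have [N N0 hN] := Cboo_bounded Ch.
have [M' M'0 gM'] := Cboo_lipschitz Cg; have [N' N'0 hN'] := Cboo_lipschitz Ch.
pose I := \int[mu]_(y in D) `|m y|.
have I0 : 0 <= I by exact: Rintegral_ge0.
(* A Lipschitz constant of [F g h] for the product metric, increased by 1 to make it positive. *)
pose L := (M' * N + M * N') * I + 1.
have L0 : 0 < L by rewrite ltr_wpDl// mulr_ge0// addr_ge0// mulr_ge0.
have N1 : \forall z \near x, ball x (e / L) z.
  by apply: nbhsx_ballx; rewrite divr_gt0.
apply: filterS N1 => z [/= /ltW z1 /ltW z2].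
have e1 : 0 <= e / L by rewrite divr_ge0// ltW.
rewrite /pint -RintegralB//; try exact: integrable_kernel.
have iB := integrableB mD (integrable_kernel mD mp1 mp2 im x Cg Ch)
  (integrable_kernel mD mp1 mp2 im z Cg Ch).
rewrite (le_trans (le_normr_Rintegral mD iB))//.
apply: (@le_trans _ _ (\int[mu]_(y in D) ((e / L) * (M' * N + M * N') * `|m y|))).
  apply: le_Rintegral => //.
  - exact: (integrable_norm iB).
  - exact: (integrableZl mD _ (integrable_norm im)).
  move=> y Dy /=; rewrite -mulrBl normrM ler_wpM2r//.
  set a := x.1 - p1 y; set b := x.2 - p2 y; set a' := z.1 - p1 y; set b' := z.2 - p2 y.
  have -> : g a * h b - g a' * h b' = (g a - g a') * h b + g a' * (h b - h b') by ring.
  rewrite (le_trans (ler_normD _ _))// !normrM mulrDr.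
  have A1 : `|g a - g a'| <= e / L * M'.
    rewrite (le_trans (gM' _ _))// mulrC ler_wpM2r// (le_trans _ z1)//.
    by rewrite /a /a' opprB addrA subrK.
  have A2 : `|h b - h b'| <= e / L * N'.
    rewrite (le_trans (hN' _ _))// mulrC ler_wpM2r// (le_trans _ z2)//.
    by rewrite /b /b' opprB addrA subrK.
  apply: lerD; first by rewrite [leRHS]mulrA ler_pM.
  by rewrite [leRHS]mulrCA ler_pM.
rewrite RintegralZl//; last exact: integrable_norm.
have eL : e / L * L = e by rewrite divfK// gt_eqF.
apply: (@le_trans _ _ (e / L * L)); last by rewrite eL.
have c1 : (M' * N + M * N') * I <= L by rewrite /L lerDl.
have := ler_wpM2l e1 c1; rewrite mulrA.
exact.
Qed.

Lemma pint_smooth g h : Cboo g -> Cboo h -> smooth_on setT (F g h).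
Proof.
move=> Cg Ch n; elim: n g h Cg Ch => [|n IH] g h Cg Ch; split => //;
  try by move=> x _; exact: pint_continuous.
move=> i; have [->|->] : i = 0 \/ i = 1.
- by case: i => -[|[|//]] p; [left|right]; exact/val_inj.
- split; first by move=> x _; have [] := is_derive_pint0 mD mp1 mp2 im x Cg Ch.
  by rewrite partial_pint0//; apply: IH => //; exact: Cboo_derive1.
- split; first by move=> x _; have [] := is_derive_pint1 x Cg Ch.
  by rewrite partial_pint1//; apply: IH => //; exact: Cboo_derive1.
Qed.

End ParamIntegralSmooth.

(** * Continuity of translations in L2 *)

(** If the ball of radius r about a point lies in U, then all centers and all radii within r/2 are
    good as well; the covering form of compactness turns this into one radius for all of K. *)
Lemma compact_margin {R : realType} (T : pseudoMetricType R) (K U : set T) :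
  compact K -> open U -> K `<=` U ->
  exists2 e : R, 0 < e & forall x y, K x -> ball x e y -> U y.
Proof.
move=> /compact_near_coveringP cK oU KU.
have := cK R (0^'+) (fun e x => ball x e `<=` U) _.
have H x : K x -> \forall x' \near x & i \near 0^'+, ball x' i `<=` U.
  move=> /KU Ux; have /nbhs_ballP[r /= r0 rU] := open_nbhs_nbhs (conj oU Ux).
  have r2 : 0 < r / 2 by rewrite divr_gt0.
  exists (ball x (r / 2), [set e | e < r / 2]) => /=.
    split; first exact: nbhsx_ballx.
    exact: nbhs_right_lt.
  move=> [x' e]/= [xx' er] y x'y; apply: rU; rewrite (splitr r).
  by apply: (ball_triangle xx'); apply: le_ball x'y; exact: ltW.
move=> /(_ _ H) N.
near (0:R)^'+ => e.
have e0 : 0 < e by near: e; exact: nbhs_right_gt.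
exists e => // x y Kx xy.
have : K `<=` (fun x => ball x e `<=` U) by near: e.
by move=> /(_ x Kx); apply.
Unshelve. all: by end_near. Qed.

Section Translation.
Context {R : realType}.
Local Open Scope ereal_scope.

Lemma measurable_shift (a : R) : measurable_fun setT (fun x : R => x + a)%R.
Proof. exact: measurable_funD. Qed.

Lemma lebesgue_measure_shift (a : R) (A : set R) : measurable A ->
  leb ((fun x : R => x + a)%R @^-1` A) = leb A.
Proof.
move=> mA.
pose ma := isMeasurableFun.Build _ _ _ _ (fun x : measurableTypeR R => (x + a)%R : measurableTypeR R)
  (measurable_shift a).
pose mf : {mfun _ >-> _} := HB.pack (fun x : measurableTypeR R => (x + a)%R : measurableTypeR R) ma.
suff -> : leb A = pushforward leb mf A by [].
apply: lebesgue_measure_unique => // _ [[u v] _ <-] /=.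
rewrite /pushforward (_ : _ @^-1` _ = `](u - a)%R, (v - a)%R]%classic).
  rewrite !lebesgue_measure_itv/= !lte_fin ltrD2r; case: ifP => // _.
  by rewrite -!EFinB; congr EFin; lra.
by apply/seteqP; split => x /=; rewrite !in_itv/= ltrBlDr lerBrDr.
Qed.

Lemma integral_shift (a : R) (f : R -> \bar R) : measurable_fun setT f ->
  (forall x, 0 <= f x) -> \int[leb]_x f (x + a)%R = \int[leb]_x f x.
Proof.
move=> mf f0.
have := @ge0_integral_pushforward _ _ (measurableTypeR R) (measurableTypeR R) R
  (fun x => (x + a)%R) (measurable_shift a) leb setT f measurableT mf.
rewrite preimage_setT => <-; last by move=> y _; exact: f0.
apply: eq_measure_integral; first exact: measurable_shift.
by move=> ? A mA _; rewrite /= /pushforward; exact: lebesgue_measure_shift.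
Qed.

Lemma measurable_shift2 (a b : R) :
  measurable_fun setT (fun x : R * R => (x.1 + a, x.2 + b)%R).
Proof.
by apply/measurable_fun_pairP; split; apply: measurable_funD => //.
Qed.

Lemma integral2_shift (a b : R) (f : R * R -> \bar R) : measurable_fun setT f ->
  (forall x, 0 <= f x) ->
  \int[leb2]_x f (x.1 + a, x.2 + b)%R = \int[leb2]_x f x.
Proof.
move=> mf f0.
have mg : measurable_fun setT (fun x : R * R => f (x.1 + a, x.2 + b)%R).
  by apply: (measurableT_comp mf); exact: measurable_shift2.
rewrite (@fubini_tonelli1 _ _ _ _ _ leb leb (fun x : R * R => f (x.1 + a, x.2 + b)%R))//.
rewrite (@fubini_tonelli1 _ _ _ _ _ leb leb f)// /fubini_F/=.
rewrite -[RHS](integral_shift a)//.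
- apply: eq_integral => x _.
  rewrite -(integral_shift b (f := fun y => f ((x + a)%R, y)))//.
  exact: measurableT_comp.
- exact: measurable_fun_fubini_tonelli_F.
- by move=> x; exact: integral_ge0.
Qed.

End Translation.

Section ShiftContinuity.
Context {R : realType}.
Implicit Types (f g : R * R -> R).

(** By regularity, A lies between a compact K and an open U with little measure to spare. Once the
    shift is smaller than the margin of K in U, the indicator can change between x and x + a only if
    one of the two points lies in U minus K. *)
Lemma indic_shift1 (A : set R) (e : R) : measurable A -> (leb A < +oo)%E -> 0 < e ->
  exists2 d : R, 0 < d & forall a, `|a| <= d ->
    (\int[leb]_x ((\1_A (x + a) - \1_A x : R) ^+ 2)%:E <= e%:E)%E.
Proof.
move=> mA finA e0; have e4 : 0 < e / 4 by rewrite divr_gt0.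
have [U [oU AU UA]] := lebesgue_regularity_outer mA finA e4.
have [K [cK KA AK]] := lebesgue_regularity_inner mA finA e4.
have [d d0 dU] := compact_margin cK oU (subset_trans KA AU).
have mU := open_measurable oU; have mK := compact_measurable cK.
have mUA : measurable (U `\` A) by exact: measurableD.
have mAK : measurable (A `\` K) by exact: measurableD.
exists (d / 2); first by rewrite divr_gt0.
move=> a ad; have {}ad : `|a| < d by rewrite (le_lt_trans ad)// gtr_pMr// invf_lt1// ltr1n.
pose h (x : R) : \bar R := ((\1_(U `\` A) x)%:E + (\1_(A `\` K) x)%:E)%E.
have mh : measurable_fun setT h.
  by apply: emeasurable_funD; apply/measurable_EFinP; exact: measurable_indic.
have h0 x : (0 <= h x)%E by rewrite /h -EFinD lee_fin addr_ge0.
have inth : (\int[leb]_x h x <= (e / 2)%:E)%E.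
  rewrite /h ge0_integralD//; try by move=> x _; rewrite lee_fin.
  - rewrite !integral_indic// !setIT (splitr (e / 2)) EFinD.
    by rewrite (_ : e / 2 / 2 = e / 4); [rewrite leeD// ltW|field].
  - by apply/measurable_EFinP; exact: measurable_indic.
  - by apply/measurable_EFinP; exact: measurable_indic.
apply: (@le_trans _ _ (\int[leb]_x (h (x + a)%R + h x))%E); last first.
  rewrite ge0_integralD//.
  - by rewrite integral_shift// (splitr e) EFinD leeD.
  - by apply: (measurableT_comp mh); exact: measurable_shift.
apply: ge0_le_integral => //.
- by move=> x _; rewrite lee_fin sqr_ge0.
- apply/measurable_EFinP; apply: measurable_funX; apply: measurable_funB.
    by apply: (@measurableT_comp _ _ _ _ _ _ (\1_A : R -> R)) => //; exact: measurable_shift.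
  exact: measurable_indic.
- apply: emeasurable_funD => //.
  by apply: (measurableT_comp mh); exact: measurable_shift.
move=> x _; rewrite /h -!EFinD lee_fin !indicE.
have K1 : K x -> U (x + a) by move=> Kx; apply: (dU x); rewrite // /ball/= opprD addNKr normrN.
have K2 : K (x + a) -> U x by move=> Kx; apply: (dU (x + a)); rewrite // /ball/= addrAC subrr add0r.
have B (P : bool) : 0 <= P%:R :> R by [].
have [xA|xA] := boolP (x \in A); have [yA|yA] := boolP (x + a \in A) => /=.
- by rewrite subrr expr0n /= !addr_ge0.
- rewrite sub0r sqrrN expr1n; set p1 := x + a \in U `\` A; set p2 := x + a \in A `\` K.
  set p3 := x \in U `\` A; set p4 := x \in A `\` K.
  have B1 := B p1; have B2 := B p2; have B3 := B p3; have B4 := B p4.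
  have [xK|xK] := pselect (K x).
    have -> : p1 by apply/mem_set; split; [exact: K1|move/mem_set; rewrite (negbTE yA)].
    by rewrite /=; lra.
  have -> : p4 by apply/mem_set; split => //; exact: set_mem.
  by rewrite /=; lra.
- rewrite subr0 expr1n; set p1 := x + a \in U `\` A; set p2 := x + a \in A `\` K.
  set p3 := x \in U `\` A; set p4 := x \in A `\` K.
  have B1 := B p1; have B2 := B p2; have B3 := B p3; have B4 := B p4.
  have [xK|xK] := pselect (K (x + a)).
    have -> : p3 by apply/mem_set; split; [exact: K2|move/mem_set; rewrite (negbTE xA)].
    by rewrite /=; lra.
  have -> : p2 by apply/mem_set; split => //; exact: set_mem.
  by rewrite /=; lra.
- by rewrite subrr expr0n /= !addr_ge0.
Qed.

Lemma integral2_prod (u v : R -> \bar R) :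
  measurable_fun setT u -> measurable_fun setT v ->
  (forall x, 0 <= u x)%E -> (forall x, 0 <= v x)%E ->
  (\int[leb2]_x (u x.1 * v x.2) = \int[leb]_x u x * \int[leb]_x v x)%E.
Proof.
move=> mu mv u0 v0.
rewrite (@fubini_tonelli1 _ _ _ _ _ leb leb (fun x : R * R => u x.1 * v x.2)%E)//; last 2 first.
- by apply: emeasurable_funM; [apply: (measurableT_comp mu)|apply: (measurableT_comp mv)].
- by move=> x; rewrite mule_ge0.
rewrite /fubini_F /=.
under eq_integral do rewrite ge0_integralZl//.
by rewrite ge0_integralZr//; exact: integral_ge0.
Qed.

(** Mean-square continuity of translations at 0; through Jensen's inequality it controls the L2
    error of a mollification. *)
Definition shift_continuous f : Prop := forall e : R, 0 < e ->
  exists2 d : R, 0 < d & forall a b : R, `|a| <= d -> `|b| <= d ->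
    nrm2 leb2 (fun x => f (x.1 + a, x.2 + b) - f x) <= e.

Lemma sqint_shift f a b : sqint leb2 f ->
  sqint leb2 (fun x : R * R => f (x.1 + a, x.2 + b)) /\
  nrm2 leb2 (fun x : R * R => f (x.1 + a, x.2 + b)) = nrm2 leb2 f.
Proof.
move=> sf; have [mf _] := sf.
have mg : measurable_fun setT (fun x : R * R => f (x.1 + a, x.2 + b)).
  by apply: (measurableT_comp mf); exact: measurable_shift2.
have E : (\int[leb2]_x (f (x.1 + a, x.2 + b) ^+ 2)%:E = (nrm2 leb2 f)%:E)%E.
  rewrite -nrm2E// -(integral2_shift a b (f := fun x => (f x ^+ 2)%:E))//.
    by apply/measurable_EFinP; exact: measurable_funX.
  by move=> x; rewrite lee_fin sqr_ge0.
have [s1 _] := @sqint_le _ _ _ leb2 _ (nrm2 leb2 f) mg (eq_ind _ (fun z => z <= _)%E (lexx _) _ (esym E)).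
by split => //; move: E; rewrite nrm2E// => -[].
Qed.

Lemma shift_continuousD f g : sqint leb2 f -> sqint leb2 g ->
  shift_continuous f -> shift_continuous g -> shift_continuous (fun x => f x + g x).
Proof.
move=> sf sg cf cg e e0; have e4 : 0 < e / 4 by rewrite divr_gt0.
have [d1 d10 H1] := cf _ e4; have [d2 d20 H2] := cg _ e4.
exists (Num.min d1 d2); first by rewrite lt_min d10.
move=> a b; rewrite !le_min => /andP[a1 a2] /andP[b1 b2].
have [sfs _] := sqint_shift a b sf; have [sgs _] := sqint_shift a b sg.
have := nrm2D (sqintB sfs sf) (sqintB sgs sg).
have := H1 _ _ a1 b1; have := H2 _ _ a2 b2.
set A := nrm2 _ _; set B := nrm2 _ _ => hA hB.
rewrite (_ : (fun x => _ + _) = (fun x => f (x.1 + a, x.2 + b) + g (x.1 + a, x.2 + b) - (f x + g x))).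
  by move=> H; rewrite (le_trans H)//; lra.
by apply/funext => x; ring.
Qed.

Lemma shift_continuousZ f c : sqint leb2 f ->
  shift_continuous f -> shift_continuous (fun x => c * f x).
Proof.
move=> sf cf e e0; have c1 : 0 < c ^+ 2 + 1 by rewrite ltr_wpDl// sqr_ge0.
have [d1 d10 H1] := cf _ (divr_gt0 e0 c1).
exists d1 => // a b a1 b1.
have [sfs _] := sqint_shift a b sf.
under [X in nrm2 _ X]eq_fun do rewrite -mulrBr.
rewrite nrm2Z; last exact: sqintB.
apply: (@le_trans _ _ ((c ^+ 2 + 1) * nrm2 leb2 (fun x => f (x.1 + a, x.2 + b) - f x))).
  by rewrite ler_wpM2r ?nrm2_ge0// lerDl.
by rewrite mulrC -ler_pdivlMr// H1.
Qed.

Lemma shift_continuous_sum (I : Type) (s : seq I) (F : I -> R * R -> R) :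
  (forall i, sqint leb2 (F i)) -> (forall i, shift_continuous (F i)) ->
  shift_continuous (fun x => \sum_(i <- s) F i x).
Proof.
move=> sF cF; elim: s => [|i s IH].
  under eq_fun do rewrite big_nil.
  move=> e e0; exists 1 => // a b _ _; rewrite subrr /nrm2 expr0n/= Rintegral_cst//.
  by rewrite mul0r ltW.
under eq_fun do rewrite big_cons.
by apply: shift_continuousD => //; exact: sqint_sum.
Qed.

Lemma shift_continuous_lim f : sqint leb2 f ->
  (forall e : R, 0 < e -> exists g, [/\ sqint leb2 g, shift_continuous g &
     nrm2 leb2 (fun x => f x - g x) <= e]) ->
  shift_continuous f.
Proof.
(* The error splits into three terms by two uses of [nrm2D], with weights 4, 4 and 2; twelfths leave
   room. *)
move=> sf H e e0; have e9 : 0 < e / 12 by rewrite divr_gt0.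
have [g [sg cg fg]] := H _ e9; have [d d0 hd] := cg _ e9.
exists d => // a b ad bd.
have [sfs _] := sqint_shift a b sf; have [sgs _] := sqint_shift a b sg.
have [_ E] := sqint_shift a b (sqintB sf sg).
have h1 := hd _ _ ad bd.
have := nrm2D (sqintD (sqintB sfs sgs) (sqintZ (-1) (sqintB sf sg))) (sqintB sgs sg).
have := nrm2D (sqintB sfs sgs) (sqintZ (-1) (sqintB sf sg)).
rewrite nrm2Z; last exact: sqintB.
rewrite E => H2 H3.
rewrite (_ : (fun x => _ - f x) = (fun x =>
   f (x.1 + a, x.2 + b) - g (x.1 + a, x.2 + b) + -1 * (f x - g x) +
         (g (x.1 + a, x.2 + b) - g x))); last by apply/funext => x; ring.
apply: (le_trans H3); move: H2; set u := nrm2 _ _; nra.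
Qed.

End ShiftContinuity.

Section ShiftContinuity2.
Context {R : realType}.
Implicit Types (f g : R * R -> R).

Lemma sqint_indic (A : set (R * R)) : measurable A ->
  ((@lebesgue_measure R \x @lebesgue_measure R)%E A < +oo)%E ->
  sqint leb2 (\1_A : R * R -> R) /\
  ((nrm2 leb2 (\1_A : R * R -> R))%:E = (@lebesgue_measure R \x @lebesgue_measure R)%E A)%E.
Proof.
move=> mA fA.
have E : (\int[leb2]_x ((\1_A x : R) ^+ 2)%:E = (@lebesgue_measure R \x @lebesgue_measure R)%E A)%E.
  under eq_integral => x _.
    rewrite (_ : (\1_A x : R) ^+ 2 = \1_A x); last first.
      by rewrite indicE; case: (x \in A); rewrite ?expr1n ?expr0n.
    over.
  by rewrite integral_indic// setIT.
have mI : measurable_fun setT (\1_A : R * R -> R) by exact: measurable_indic.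
have H : (\int[leb2]_x ((\1_A x : R) ^+ 2)%:E <=
    (fine ((@lebesgue_measure R \x @lebesgue_measure R)%E A))%:E)%E.
  by rewrite E fineK// ge0_fin_numE.
have [s _] := @sqint_le _ _ _ leb2 _ _ mI H.
by rewrite -nrm2E.
Qed.

Lemma leb2_rect (A B : set R) : measurable A -> measurable B ->
  (leb A < +oo)%E -> (leb B < +oo)%E ->
  ((@lebesgue_measure R \x @lebesgue_measure R)%E (A `*` B) < +oo)%E.
Proof.
by move=> mA mB fA fB; rewrite product_measure1E// lte_mul_pinfty// ge0_fin_numE.
Qed.

Lemma shift_continuous_rect (A B : set R) : measurable A -> measurable B ->
  (leb A < +oo)%E -> (leb B < +oo)%E -> shift_continuous (\1_(A `*` B) : R * R -> R).
Proof.
move=> mA mB fA fB e e0.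
pose L := fine (leb A) + fine (leb B) + 1.
have A0 : 0 <= fine (leb A) by exact: fine_ge0.
have B0 : 0 <= fine (leb B) by exact: fine_ge0.
have L0 : 0 < L by rewrite /L; lra.
have eL : 0 < e / (4 * L) by rewrite divr_gt0// mulr_gt0.
have [d1 d10 H1] := indic_shift1 mA fA eL.
have [d2 d20 H2] := indic_shift1 mB fB eL.
exists (Num.min d1 d2); first by rewrite lt_min d10.
move=> a b; rewrite !le_min => /andP[a1 _] /andP[_ b2].
have {}H1 := H1 _ a1; have {}H2 := H2 _ b2.
have mI (C : set R) : measurable C -> measurable_fun setT (\1_C : R -> R).
  by move=> mC; exact: measurable_indic.
have mIs (C : set R) c : measurable C -> measurable_fun setT (fun x : R => \1_C (x + c) : R).
  by move=> mC; apply: (measurableT_comp (mI _ mC)); exact: measurable_shift.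
have intI (C : set R) c : measurable C -> (\int[leb]_x ((\1_C (x + c) : R) ^+ 2)%:E = leb C)%E.
  move=> mC; rewrite (integral_shift c (f := fun x => ((\1_C x : R) ^+ 2)%:E)).
  - under eq_integral => x _.
      rewrite (_ : (\1_C x : R) ^+ 2 = \1_C x); last first.
        by rewrite indicE; case: (x \in C); rewrite ?expr1n ?expr0n.
      over.
    by rewrite integral_indic// setIT.
  - by apply/measurable_EFinP; apply: measurable_funX; exact: mI.
  - by move=> x; rewrite lee_fin sqr_ge0.
(* [F] and [G] are the squares of the two terms in p q - r t = (p - r) q + r (q - t); in each the
   coordinates separate. The shift by 0 in [G] lets [m2] and [intI] serve for both. *)
pose F (x : R * R) : \bar R := (((\1_A (x.1 + a) - \1_A x.1 : R) ^+ 2)%:E * ((\1_B (x.2 + b) : R) ^+ 2)%:E)%E.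
pose G (x : R * R) : \bar R := (((\1_A (x.1 + 0) : R) ^+ 2)%:E * ((\1_B (x.2 + b) - \1_B x.2 : R) ^+ 2)%:E)%E.
have m1 c (C : set R) : measurable C -> measurable_fun setT (fun x : R => ((\1_C (x + c) - \1_C x : R) ^+ 2)%:E).
  by move=> mC; apply/measurable_EFinP; apply: measurable_funX; apply: measurable_funB; [exact: mIs|exact: mI].
have m2 c (C : set R) : measurable C -> measurable_fun setT (fun x : R => ((\1_C (x + c) : R) ^+ 2)%:E).
  by move=> mC; apply/measurable_EFinP; apply: measurable_funX; exact: mIs.
have p2 (r : R) : (0 <= (r ^+ 2)%:E)%E by rewrite lee_fin sqr_ge0.
have IF : (\int[leb2]_x F x <= (e / 4)%:E)%E.
  rewrite /F (integral2_prod (u := fun t => ((\1_A (t + a) - \1_A t : R) ^+ 2)%:E)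
    (v := fun t => ((\1_B (t + b) : R) ^+ 2)%:E))//; try exact: m1; try exact: m2.
  rewrite intI//; apply: le_trans (_ : (e / (4 * L))%:E * (fine (leb B))%:E <= _)%E.
    by rewrite fineK ?ge0_fin_numE//; apply: lee_wpmul2r.
  rewrite -EFinM lee_fin; have -> : e / 4 = e / (4 * L) * L by field; rewrite gt_eqF.
  by rewrite ler_wpM2l ?ltW// /L; lra.
have IG : (\int[leb2]_x G x <= (e / 4)%:E)%E.
  rewrite /G (integral2_prod (u := fun t => ((\1_A (t + 0) : R) ^+ 2)%:E)
    (v := fun t => ((\1_B (t + b) - \1_B t : R) ^+ 2)%:E))//; try exact: m1; try exact: m2.
  rewrite intI//; apply: le_trans (_ : (fine (leb A))%:E * (e / (4 * L))%:E <= _)%E.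
    by rewrite fineK ?ge0_fin_numE//; apply: lee_wpmul2l.
  rewrite -EFinM lee_fin; have -> : e / 4 = L * (e / (4 * L)) by field; rewrite gt_eqF.
  by rewrite ler_wpM2r ?ltW// /L; lra.
have mF : measurable_fun setT F.
  apply: emeasurable_funM; first exact: (measurableT_comp (m1 a A mA)).
  exact: (measurableT_comp (m2 b B mB)).
have mG : measurable_fun setT G.
  apply: emeasurable_funM; first exact: (measurableT_comp (m2 0 A mA)).
  exact: (measurableT_comp (m1 b B mB)).
have F0 x : (0 <= F x)%E by rewrite mule_ge0.
have G0 x : (0 <= G x)%E by rewrite mule_ge0.
have mAB : measurable (A `*` B) by exact: measurableX.
have [sAB _] := sqint_indic mAB (leb2_rect mA mB fA fB).
have [sABs _] := sqint_shift a b sAB.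
have [mS _] := sqintB sABs sAB.
suff HH : (\int[leb2]_x ((\1_(A `*` B) (x.1 + a, x.2 + b) - \1_(A `*` B) x : R) ^+ 2)%:E <= e%:E)%E.
  by have [] := @sqint_le _ _ _ leb2 _ _ mS HH.
apply: (@le_trans _ _ (\int[leb2]_x (2%:E * (F x + G x)))%E); last first.
  rewrite ge0_integralZl//; last 2 first.
  - exact: emeasurable_funD.
  - by move=> x _; rewrite adde_ge0.
  rewrite ge0_integralD//.
  apply: (@le_trans _ _ (2%:E * ((e / 4)%:E + (e / 4)%:E))%E).
    by apply: lee_wpmul2l => //; exact: leeD.
  by rewrite -EFinD -EFinM lee_fin; lra.
apply: ge0_le_integral => //.
- by apply/measurable_EFinP; apply: measurable_funX.
- by apply: measurable_funeM; exact: emeasurable_funD.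
move=> [x y] _; rewrite -[leRHS]/((2 * ((\1_A (x + a) - \1_A x) ^+ 2 * \1_B (y + b) ^+ 2 +
  \1_A (x + 0) ^+ 2 * (\1_B (y + b) - \1_B y) ^+ 2) : R)%:E) lee_fin/= addr0.
have I2 t u : \1_(A `*` B) (t, u) = \1_A t * \1_B u :> R.
  by rewrite !indicE in_setX; case: (t \in A); case: (u \in B); rewrite /= ?mulr1 ?mulr0.
rewrite !I2; set p := (\1_A (x + a)); set q := (\1_B (y + b)); set r := \1_A x; set t := \1_B y.
have -> : p * q - r * t = (p - r) * q + r * (q - t) by ring.
by have := sqr_ge0 ((p - r) * q - r * (q - t)); nra.
Qed.

End ShiftContinuity2.

Section ShiftContinuity3.
Context {R : realType}.
Implicit Types (f g : R * R -> R).

Local Notation lam2 := (@lebesgue_measure R \x @lebesgue_measure R)%E.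

Definition box (N : R) : set (R * R) := `[- N, N]%classic `*` `[- N, N]%classic.

Lemma measurable_box N : measurable (box N).
Proof. by apply: measurableX => //; exact: measurable_itv. Qed.

Lemma leb_itv_lty (N : R) : (leb `[(- N)%R, N]%classic < +oo)%E.
Proof. by rewrite /= lebesgue_measure_itv/=; case: ifP => //; rewrite -EFinD ltry. Qed.

Lemma leb2_sub_box (S : set (R * R)) N : measurable S -> S `<=` box N ->
  (lam2 S < +oo)%E.
Proof.
move=> mS SB; apply: (@le_lt_trans _ _ (lam2 (box N))).
  by apply: le_measure; rewrite ?classical_sets.inE//; exact: measurable_box.
by apply: leb2_rect; rewrite ?leb_itv_lty//; exact: measurable_itv.
Qed.

(** The measurable S with this property contain the rectangles and are stable under complements and
    disjoint countable unions, so Dynkin's theorem applies. Intersecting with a box keeps all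
    measures finite. *)
Lemma shift_continuous_indic (N : R) (S : set (R * R)) : measurable S ->
  shift_continuous (\1_(S `&` box N) : R * R -> R).
Proof.
have mB := measurable_box N.
have fin S' : measurable S' -> (lam2 (S' `&` box N) < +oo)%E.
  by move=> mS'; apply: (@leb2_sub_box _ N); [exact: measurableI|exact: subIsetr].
have sI S' : measurable S' -> sqint leb2 (\1_(S' `&` box N) : R * R -> R).
  by move=> mS'; have [] := sqint_indic (measurableI _ _ mS' mB) (fin _ mS').
pose G : set (set (R * R)) := [set A `*` B | A in measurable & B in measurable].
have GE : @measurable _ (R * R)%type = <<s G >> by rewrite measurable_prod_measurableType.
move=> mS; have : <<s G >> S by rewrite -GE.
apply: (@dynkin_induction _ (R * R)%type G
   (fun S => shift_continuous (\1_(S `&` box N) : R * R -> R))) => //.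
- move=> _ _ [A mA [B mB1 <-]] [C mC [D mD <-]].
  by exists (A `&` C); [exact: measurableI|exists (B `&` D); [exact: measurableI|rewrite setXI]].
- rewrite setTI; apply: shift_continuous_rect; rewrite ?leb_itv_lty//; exact: measurable_itv.
- move=> _ [A mA [B mB1 <-]]; rewrite /box -setXI.
  have fI (C : set R) : measurable C -> (leb (C `&` `[(- N)%R, N]%classic) < +oo)%E.
    move=> mC; apply: le_lt_trans (leb_itv_lty N).
    by apply: le_measure; rewrite ?classical_sets.inE//; apply: measurableI => //; exact: measurable_itv.
  by apply: shift_continuous_rect; rewrite ?fI//; apply: measurableI => //; exact: measurable_itv.
- move=> A mA cA.
  rewrite (_ : \1_(_) = (fun x => \1_(setT `&` box N) x + (-1) * \1_(A `&` box N) x :> R)).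
    apply: shift_continuousD; try exact: sI; try exact: (sqintZ _ (sI _ mA)).
      rewrite setTI; apply: shift_continuous_rect; rewrite ?leb_itv_lty//; exact: measurable_itv.
    exact: (shift_continuousZ (-1) (sI _ mA) cA).
  apply/funext => x; rewrite !indicE !in_setI in_setT in_setC.
  by case: (x \in A); case: (x \in box N); rewrite /=; ring.
- move=> F mF tF cF.
  have mU : measurable (\bigcup_k F k) by exact: bigcup_measurable.
  apply: shift_continuous_lim; first exact: sI.
  move=> e e0.
  (* The tail of the union. By disjointness its indicator is the difference between that of the
     union and the n-th partial sum, and its measure tends to 0 by continuity from above. *)
  pose D n := (\bigcup_k F k `\` \bigcup_(k < n) F k) `&` box N.
  have mUn n : measurable (\bigcup_(k < n) F k) by exact: bigcup_measurable.
  have mD n : measurable (D n) by apply: measurableI => //; exact: measurableD.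
  have D0 : \bigcap_n D n = set0.
    apply/seteqP; split => // x Dx; have [[[k _ Fkx] _] _] := Dx 0%N I.
    have [[_ nk] _] := Dx k.+1 I; apply: nk; exists k => //=.
  have lD : lam2 (D n) @[n --> \oo] --> 0%E.
    rewrite -(measure0 lam2) -D0; apply: (@nonincreasing_cvg_mu _ _ _ lam2 D) => //.
    - exact/fin/measurableD.
    - by rewrite D0.
    - move=> n m nm; apply/subsetPset => x [[Ux nx] Bx]; split => //; split => // -[k /= kn Fx].
      by apply: nx; exists k => //=; exact: leq_trans kn nm.
  have [n _ Hn] : \forall n \near \oo, (lam2 (D n) <= e%:E)%E.
    move/fine_cvgP : lD => [lf] /cvgrPdist_le/(_ _ e0) lD.
    near=> n; have : lam2 (D n) \is a fin_num by near: n.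
    move=> /fineK <-; rewrite lee_fin.
    have : `|0 - fine (lam2 (D n))| <= e by near: n.
    by rewrite sub0r normrN; apply: le_trans; rewrite ler_norm.
  exists (fun x => \sum_(k < n) (\1_(F k `&` box N) x : R)); split.
  + by apply: sqint_sum => k; exact: sI.
  + by apply: shift_continuous_sum => k; [exact: sI|exact: cF].
  have -> : (fun x => \1_(\bigcup_k F k `&` box N) x - \sum_(k < n) \1_(F k `&` box N) x) = (\1_(D n) : R * R -> R).
    apply/funext => x; rewrite /D !indicE; move: (box N) => BB.
    have inI A : (x \in A `&` BB) = (x \in A) && (x \in BB) by rewrite in_setI.
    under eq_bigr do rewrite indicE inI.
    rewrite !inI; have [xB|xB] := boolP (x \in BB); last first.
      by rewrite !andbF/= big1 ?subr0// => i _; rewrite andbF.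
    rewrite !andbT; under eq_bigr do rewrite andbT.
    have [xU|xU] := boolP (x \in \bigcup_k F k); last first.
      rewrite big1 ?subr0; last first.
        move=> i _; case: (boolP (x \in F i)) => // /set_mem Fx.
        by case/negP: xU; apply/mem_set; exists i.
      by rewrite memNset//; move=> [Ux _]; case/negP: xU; exact/mem_set.
    have [k _ Fkx] := set_mem xU.
    have dk j : j != k -> (x \in F j) = false.
      move=> jk; apply/negbTE/negP => /set_mem Fjx.
      have := @tF j k I I; case/eqP: jk; apply: tF => //; by exists x.
    have [kn|kn] := ltnP k n.
      rewrite (bigD1 (Ordinal kn))//= mem_set//= big1 ?addr0 ?subrr.
        by rewrite memNset// => -[_]; apply; exists k.
      by move=> i ik; rewrite dk.
    rewrite big1 ?subr0; last first.
      by move=> i _; rewrite dk// neq_ltn (leq_trans (ltn_ord i) kn).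
    rewrite mem_set//; split; first by exists k.
    by move=> [j /= jn] /mem_set; rewrite dk// neq_ltn (leq_trans jn kn).
  have [_ E] := sqint_indic (mD n) (fin _ (measurableD mU (mUn n))).
  by rewrite -lee_fin E; apply: Hn => /=.
Unshelve. all: by end_near. Qed.

End ShiftContinuity3.

Section ShiftContinuity4.
Context {R : realType}.
Implicit Types (f g : R * R -> R).

Import HBNNSimple.

Lemma dominated_nrm2_cvg0 d (T : measurableType d) (mu : {measure set T -> \bar R})
    (f : T -> R) (h : nat -> T -> R) : sqint mu f ->
  (forall n, measurable_fun setT (h n)) ->
  (forall n x, `|h n x| <= `|f x|) ->
  (forall x, h n x @[n --> \oo] --> (0 : R)) ->
  forall e : R, 0 < e -> exists n, sqint mu (h n) /\ nrm2 mu (h n) <= e.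
Proof.
move=> [mf if2] mh hf hcvg e e0.
have m2 n : measurable_fun setT (fun x => (h n x ^+ 2)%:E).
  by apply/measurable_EFinP; exact: measurable_funX.
have D : (\int[mu]_x (h n x ^+ 2)%:E @[n --> \oo] --> 0%E)%E.
  rewrite -[X in _ --> X](integral0 mu setT); apply: (@dominated_cvg _ T R mu setT measurableT (fun n x => (h n x ^+ 2)%:E)
    (cst 0%E) (EFin \o (fun x => f x ^+ 2))) => //.
  - move=> x _; apply: cvg_EFin; first by near=> n.
    rewrite (_ : fine \o _ = (fun n => h n x ^+ 2))//.
    rewrite -[X in _ --> X](expr0n R 2).
    by under eq_fun do rewrite expr2; rewrite expr2; apply: cvgM; exact: hcvg.
  - move=> n x _ /=; rewrite lee_fin ger0_norm ?sqr_ge0//.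
    by rewrite -(real_normK (num_real (h n x))) -(real_normK (num_real (f x))) lerXn2r// nnegrE.
move/fine_cvgP : D => [lf] /cvgrPdist_le/(_ _ e0) D.
near \oo => n; exists n.
apply: sqint_le => //.
have : (\int[mu]_x (h n x ^+ 2)%:E \is a fin_num)%E by near: n.
move=> /fineK <-; rewrite lee_fin.
have : `|0 - fine (\int[mu]_x (h n x ^+ 2)%:E)%E| <= e by near: n.
by rewrite sub0r normrN; apply: le_trans; rewrite ler_norm.
Unshelve. all: by end_near. Qed.

Lemma sqint_shift_continuous_ge0 f : (forall x, 0 <= f x) -> sqint leb2 f ->
  shift_continuous f.
Proof.
move=> f0 sf; have [mf _] := sf.
have mEf : measurable_fun setT (EFin \o f) by exact/measurable_EFinP.
pose g := nnsfun_approx measurableT mEf.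
(* The truncation is needed because a level set of a simple function, such as that of the value 0,
   may have infinite measure. *)
pose h n x := g n x * \1_(box n%:R) x : R.
have mbox (n : nat) : measurable (box (n%:R : R)) := measurable_box n%:R.
have gf n x : g n x <= f x.
  rewrite -lee_fin; have := @le_approx _ _ _ setT (EFin \o f) n x.
  rewrite /g nnsfun_approxE => /(_ _ I)/=; apply.
  by move=> y _ /=; rewrite lee_fin.
have mh n : measurable_fun setT (h n).
  by apply: measurable_funM => //; exact: measurable_indic.
have h0 n x : 0 <= h n x by rewrite mulr_ge0.
have hf n x : h n x <= f x.
  by apply: le_trans (gf n x); rewrite ler_piMr// indicE; case: (x \in _).
have sh n : sqint leb2 (h n).
  by apply: (@sqint_dominated _ _ _ leb2 _ _ sf (mh n)) => x; rewrite !ger0_norm.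
have ch n : shift_continuous (h n).
  pose s := fset_set (range (g n)).
  have -> : h n = (fun x : R * R => \sum_(i < #|` s|) s`_i * (\1_(g n @^-1` [set s`_i] `&` box n%:R) x : R)).
    apply/funext => x; rewrite /h (fimfunEord (g n) x) mulr_suml.
    by apply: eq_bigr => i _; rewrite -mulrA indicI.
  have mp i : measurable (g n @^-1` [set s`_i]) by exact: measurable_sfunP.
  have si (i : 'I_(#|` s|)) : sqint leb2 (\1_(g n @^-1` [set s`_i] `&` box n%:R) : R * R -> R).
    have mI : measurable (g n @^-1` [set s`_i] `&` box n%:R) by apply: measurableI.
    have [] // := sqint_indic mI.
    exact: (leb2_sub_box mI (@subIsetr _ _ _)).
  apply: shift_continuous_sum => i; first exact: sqintZ.
  apply: shift_continuousZ => //; exact: shift_continuous_indic.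
apply: shift_continuous_lim => // e e0.
have m1 n : measurable_fun setT (fun x => f x - h n x) by exact: measurable_funB.
have m2 n x : `|f x - h n x| <= `|f x|.
  by rewrite ger0_norm ?subr_ge0// ger0_norm// lerBlDl lerDr.
have m3 x : f x - h n x @[n --> \oo] --> (0 : R).
  rewrite -(subrr (f x)); apply: cvgB; first exact: cvg_cst.
  have C : (g n x)%:E @[n --> \oo] --> (f x)%:E.
    by apply: (@cvg_nnsfun_approx _ _ _ setT measurableT (EFin \o f)) => // y _; rewrite lee_fin.
  have C' : g n x @[n --> \oo] --> f x by move/fine_cvgP : C => [].
  apply: cvg_trans C'; apply: near_eq_cvg; near=> n.
  rewrite /h indicE mem_set ?mulr1//.
  have [B1 B2] : `|x.1| <= n%:R /\ `|x.2| <= n%:R.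
    by split; near: n; exact: nbhs_infty_ger.
  by split => /=; rewrite in_itv/= -ler_norml.
have [n [_ fh]] := @dominated_nrm2_cvg0 _ _ leb2 f (fun n x => f x - h n x) sf m1 m2 m3 e e0.
by exists (h n).
Unshelve. all: by end_near. Qed.

Lemma sqint_shift_continuous f : sqint leb2 f -> shift_continuous f.
Proof.
move=> sf; have [mf _] := sf.
pose p x := Num.max (f x) 0; pose q x := Num.max (- f x) 0.
have p0 x : 0 <= p x by rewrite /p le_max lexx orbT.
have q0 x : 0 <= q x by rewrite /q le_max lexx orbT.
have sp : sqint leb2 p.
  apply: (@sqint_dominated _ _ _ leb2 _ _ sf); first exact: measurable_maxr.
  by move=> x; rewrite ger0_norm// /p ge_max ler_norm normr_ge0.
have sq : sqint leb2 q.
  apply: (@sqint_dominated _ _ _ leb2 _ _ sf); first by apply: measurable_maxr => //; exact: measurableT_comp.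
  by move=> x; rewrite ger0_norm// /q ge_max -normrN ler_norm normr_ge0.
rewrite (_ : f = fun x => p x + -1 * q x).
  apply: shift_continuousD => //; first exact: sqintZ.
    exact: sqint_shift_continuous_ge0.
  by apply: shift_continuousZ => //; exact: sqint_shift_continuous_ge0.
apply/funext => x; rewrite /p /q; have [x0|x0] := leP (f x) 0.
  by rewrite max_l; lra.
by rewrite max_r; lra.
Qed.

End ShiftContinuity4.

(** * Mollification on the plane *)

Section Measurable2.
Context {R : realType}.

(** Balls of the product metric are rectangles, hence measurable for the product sigma-algebra, and
    U is the union of the countably many balls inside it with rational center and radius 1/(k+1). *)
Lemma open_measurable2 (U : set (R * R)) : open U -> measurable U.
Proof.
move=> oU.
pose B (p : rat * rat * nat) : set (R * R) := ball (ratr p.1.1 : R, ratr p.1.2 : R) (p.2.+1%:R^-1 : R).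
pose F (n : nat) : set (R * R) :=
  if (choice.unpickle n : option (rat * rat * nat)) is Some p then (if `[< B p `<=` U >] then B p else set0) else set0.
have mF n : measurable (F n).
  rewrite /F; case: (choice.unpickle n) => // p; case: ifPn => // _.
  rewrite (_ : B p = ball (ratr p.1.1 : R) (p.2.+1%:R^-1 : R) `*` ball (ratr p.1.2 : R) (p.2.+1%:R^-1 : R))//.
  by apply: measurableX; exact: measurable_ball.
rewrite (_ : U = \bigcup_n F n); first exact: bigcup_measurable.
apply/seteqP; split => x.
  move=> Ux; have /nbhs_ballP[r /= r0 rU] := open_nbhs_nbhs (conj oU Ux).
  have r2 : 0 < r / 2 by rewrite divr_gt0.
  pose k := Num.bound (r / 2)^-1.
  have kr : k.+1%:R^-1 < r / 2.
    rewrite invf_plt ?posrE//; apply: (lt_le_trans (archi_boundP _)).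
      by rewrite invr_ge0 ltW.
    by rewrite ler_nat.
  have k0 : 0 < k.+1%:R^-1 :> R by rewrite invr_gt0.
  have H (t : R) : t - k.+1%:R^-1 < t + k.+1%:R^-1.
    by rewrite ltrD2l (lt_trans _ k0)// oppr_lt0.
  have [a] := rat_in_itvoo (H x.1).
  rewrite in_itv/= => /andP[a1 a2].
  have [b] := rat_in_itvoo (H x.2).
  rewrite in_itv/= => /andP[b1 b2].
  have xB : B (a, b, k) x.
    split; rewrite /ball/= ltr_norml; apply/andP; split.
    - by rewrite ltrBrDr addrC ltrBlDr addrC -ltrBlDl.
    - by rewrite ltrBlDr addrC.
    - by rewrite ltrBrDr addrC ltrBlDr addrC -ltrBlDl.
    - by rewrite ltrBlDr addrC.
  have FB : F (choice.pickle (a, b, k)) = if `[< B (a, b, k) `<=` U >] then B (a, b, k) else set0.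
    by rewrite /F choice.pickleK.
  move: (choice.pickle _) FB => n FB; exists n; first exact: I.
  rewrite FB.
  rewrite asboolT// => y By; apply: rU; rewrite (splitr r).
  by apply: (@ball_triangle _ _ (ratr a : R, ratr b : R)); apply: (le_ball (ltW kr)) => //; exact: ball_sym.
move=> [n _]; rewrite /F; case: (choice.unpickle n) => // p; case: ifPn => // /asboolP; exact.
Qed.

Lemma closed_measurable2 (U : set (R * R)) : closed U -> measurable U.
Proof. by move=> /closed_openC/open_measurable2/measurableC; rewrite setCK. Qed.

Lemma continuous_measurable2 (f : R * R -> R) : continuous f -> measurable_fun setT f.
Proof.
move=> /continuousP cf; apply: (measurability _ (RGenOpens.measurableE R)).
move=> _ [_ [a [b ->] <-]]; rewrite setTI; apply: open_measurable2.
exact/cf/interval_open.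
Qed.

End Measurable2.

Section SigmaFinite2.
Context {R : realType}.
Local Notation lam2 := (@lebesgue_measure R \x @lebesgue_measure R)%E.

Lemma leb2_sigma_finite : sigma_finite setT lam2.
Proof.
exists (fun n => box n%:R); last first.
  move=> n; split; first exact: measurable_box.
  by apply: (@leb2_sub_box _ _ n%:R) => //; exact: measurable_box.
apply/esym/seteqP; split => // x _.
near \oo => n; exists n => //.
have [B1 B2] : `|x.1| <= n%:R /\ `|x.2| <= n%:R.
  by split; near: n; exact: nbhs_infty_ger.
by split => /=; rewrite in_itv/= -ler_norml.
Unshelve. all: by end_near. Qed.

(* The library attaches a sigma-finite structure to products of probabilities only. *)
Definition leb2sf : {sigma_finite_measure set (measurableTypeR R * measurableTypeR R)%type -> \bar R} :=
  HB.pack lam2 (Measure_isSigmaFinite.Build _ _ _ lam2 leb2_sigma_finite).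

End SigmaFinite2.

Lemma measurable_integral_F d1 d2 (T1 : measurableType d1) (T2 : measurableType d2)
    (R : realType) (m2 : {sigma_finite_measure set T2 -> \bar R}) (f : T1 -> T2 -> \bar R) :
  measurable_fun setT (fun xy : T1 * T2 => f xy.1 xy.2) -> (forall x y, 0 <= f x y)%E ->
  measurable_fun setT (fun x => \int[m2]_y f x y)%E.
Proof.
by move=> mf f0; apply: (measurable_fun_fubini_tonelli_F (fun xy : T1 * T2 => f xy.1 xy.2)).
Qed.

Lemma measurable_integral_G d1 d2 (T1 : measurableType d1) (T2 : measurableType d2)
    (R : realType) (m1 : {sigma_finite_measure set T1 -> \bar R}) (f : T1 -> T2 -> \bar R) :
  measurable_fun setT (fun xy : T1 * T2 => f xy.1 xy.2) -> (forall x y, 0 <= f x y)%E ->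
  measurable_fun setT (fun y => \int[m1]_x f x y)%E.
Proof.
by move=> mf f0; apply: (measurable_fun_fubini_tonelli_G (fun xy : T1 * T2 => f xy.1 xy.2)).
Qed.

Section Mollification.
Context {R : realType}.
Implicit Types (g : R * R -> R).
Variables (e : R) (th Th : R -> R).
Hypothesis mth : mollifier e th Th.

Local Notation lam2 := (@lebesgue_measure R \x @lebesgue_measure R)%E.

(** The convolution of g with the kernel th(x1) th(x2); as an instance of [pint] it inherits
    smoothness and the derivative formulas. *)
Definition mollify g : R * R -> R := pint lam2 setT fst snd g th th.

Let K (x y : R * R) : R := th (x.1 - y.1) * th (x.2 - y.2).

Lemma measurable_moll : measurable_fun setT th.
Proof. exact: Cboo_measurable (moll_Cboo mth). Qed.

Let K_ge0 x y : 0 <= K x y.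
Proof. by rewrite mulr_ge0 ?(moll_ge0 mth). Qed.

Let K_bounded : exists2 M : R, 0 <= M & forall x y, K x y <= M.
Proof.
have [M M0 tM] := Cboo_bounded (moll_Cboo mth); exists (M * M); first by rewrite mulr_ge0.
by move=> x y; rewrite ler_pM ?(moll_ge0 mth)//; apply: (le_trans (ler_norm _)).
Qed.

Let mK x : measurable_fun setT (K x).
Proof.
apply: measurable_funM; apply: (measurableT_comp measurable_moll);
  exact: measurable_funB.
Qed.

Lemma integral_moll_shift (a : R) : (\int[leb]_t (th (a - t))%:E = 1)%E.
Proof.
have mt : measurable_fun setT (fun t : R => (th t)%:E) by apply/measurable_EFinP; exact: measurable_moll.
rewrite -(moll_integral mth) -[RHS](integral_shift (- a) mt); last first.
  by move=> t; rewrite lee_fin (moll_ge0 mth).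
by apply: eq_integral => t _; rewrite -(moll_even mth) opprB.
Qed.

Let int_K x : (\int[lam2]_y (K x y)%:E = 1)%E.
Proof.
rewrite /K; under eq_integral do rewrite EFinM.
have mt (a : R) : measurable_fun setT (fun t : R => (th (a - t))%:E).
  by apply/measurable_EFinP; apply: (measurableT_comp measurable_moll); exact: measurable_funB.
rewrite (integral2_prod (mt x.1) (mt x.2)); last 2 first.
- by move=> t; rewrite lee_fin (moll_ge0 mth).
- by move=> t; rewrite lee_fin (moll_ge0 mth).
by rewrite !integral_moll_shift mule1.
Qed.

Let iK x : lam2.-integrable setT (EFin \o K x).
Proof.
apply/integrableP; split; first by apply/measurable_EFinP; exact: mK.
under eq_integral do rewrite /= ger0_norm//.
by rewrite int_K ltry.
Qed.

Let iKM x h : lam2.-integrable setT (EFin \o h) ->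
  lam2.-integrable setT (EFin \o (fun y => K x y * h y)).
Proof.
move=> ih; have [M M0 KM] := K_bounded.
have mh : measurable_fun setT h by case/integrableP: ih => /measurable_EFinP.
apply: (@le_integrable _ _ _ lam2 _ measurableT _ (EFin \o (fun y => M * h y))).
- by apply/measurable_EFinP; apply: measurable_funM => //; exact: mK.
- by move=> y _; rewrite lee_fin normrM [leRHS]normrM ler_wpM2r// (ger0_norm M0) ger0_norm.
- exact: (integrableZl measurableT M ih).
Qed.

(** Jensen's inequality for the probability density K(x, .): with m the mean of g - g(x), expanding
    the nonnegative integral of K (g - g(x) - m)^2 gives the claim. *)
Lemma conv_jensen g x : sqint lam2 g -> lam2.-integrable setT (EFin \o g) ->
  (((mollify g x - g x) ^+ 2)%:E <= \int[lam2]_y (K x y * (g y - g x) ^+ 2)%:E)%E.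
Proof.
move=> [mg ig2] ig; set c := g x; set m := mollify g x - c.
have E1 : \int[lam2]_y K x y = 1 by rewrite /Rintegral int_K.
have I1 := iKM x ig; have I2 := iKM x ig2.
have I0 := iK x.
have J : lam2.-integrable setT (EFin \o (fun y => K x y * (g y - c) ^+ 2)).
  have := integrableD measurableT (integrableD measurableT I2
    (integrableZl measurableT (- 2 * c) I1)) (integrableZl measurableT (c ^+ 2) I0).
  apply: eq_integrable => // y _ /=; rewrite -!EFinM -!EFinD; congr EFin; ring.
have P0 : 0 <= \int[lam2]_y (K x y * (g y - c - m) ^+ 2).
  by apply: Rintegral_ge0 => y _; rewrite mulr_ge0// sqr_ge0.
have E2 : \int[lam2]_y (K x y * (g y - c - m) ^+ 2) =
   \int[lam2]_y (K x y * (g y - c) ^+ 2) + (- 2 * m) * \int[lam2]_y (K x y * g y)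
   + (2 * m * c + m ^+ 2) * \int[lam2]_y (K x y).
  rewrite -!RintegralZl// -!RintegralD//; last 3 first.
  - exact: (integrableD measurableT J (integrableZl measurableT _ I1)).
  - exact: (integrableZl measurableT _ I0).
  - exact: (integrableZl measurableT _ I1).
  by apply: eq_Rintegral => y _; ring.
have E3 : \int[lam2]_y (K x y * g y) = m + c by rewrite /m subrK.
move: P0; rewrite E2 E1 E3 => P0.
have -> : (\int[lam2]_y (K x y * (g y - c) ^+ 2)%:E = (\int[lam2]_y (K x y * (g y - c) ^+ 2))%:E)%E.
  by rewrite /Rintegral fineK//; exact: integrable_fin_num J.
by rewrite lee_fin; nra.
Qed.

(** Integrating [conv_jensen] over x bounds the error by an average, against a kernel of mass one
    living on shifts smaller than e, of the translation errors of g. *)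
Lemma nrm2_conv g (c : R) : 0 <= c -> sqint lam2 g -> lam2.-integrable setT (EFin \o g) ->
  (forall a b, `|a| <= e -> `|b| <= e ->
     nrm2 lam2 (fun x => g (x.1 + a, x.2 + b) - g x) <= c) ->
  sqint lam2 (fun x => mollify g x - g x) /\ nrm2 lam2 (fun x => mollify g x - g x) <= c.
Proof.
move=> c0 sg ig H; have [mg _] := sg.
have Cth := moll_Cboo mth.
have mconv : measurable_fun setT (mollify g).
  by apply: continuous_measurable2; exact: pint_continuous.
have mcg : measurable_fun setT (fun x => mollify g x - g x) by exact: measurable_funB.
apply: (@sqint_le _ _ _ lam2) => //.
pose F (x y : R * R) : \bar R := (K x y * (g y - g x) ^+ 2)%:E.
have mshift : measurable_fun setT
    (fun xz : (R * R) * (R * R) => (xz.2.1 + xz.1.1, xz.2.2 + xz.1.2)).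
  apply/measurable_fun_pairP; split; apply: measurable_funD.
  - exact: (measurableT_comp measurable_fst measurable_snd).
  - exact: (measurableT_comp measurable_fst measurable_fst).
  - exact: (measurableT_comp measurable_snd measurable_snd).
  - exact: (measurableT_comp measurable_snd measurable_fst).
have mF : measurable_fun setT (fun xy : (R * R) * (R * R) => F xy.1 xy.2).
  apply/measurable_EFinP; apply: measurable_funM.
    apply: measurable_funM; apply: (measurableT_comp measurable_moll); apply: measurable_funB.
    - exact: (measurableT_comp measurable_fst measurable_fst).
    - exact: (measurableT_comp measurable_fst measurable_snd).
    - exact: (measurableT_comp measurable_snd measurable_fst).
    - exact: (measurableT_comp measurable_snd measurable_snd).
  apply: measurable_funX; apply: measurable_funB.
    exact: (measurableT_comp mg measurable_snd).
  exact: (measurableT_comp mg measurable_fst).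
have F0 x y : (0 <= F x y)%E by rewrite lee_fin mulr_ge0// sqr_ge0.
apply: (@le_trans _ _ (\int[lam2]_x \int[lam2]_y F x y)%E).
  apply: ge0_le_integral => //.
  - by move=> x _; rewrite lee_fin sqr_ge0.
  - by apply/measurable_EFinP; exact: measurable_funX.
  - exact: (@measurable_integral_F _ _ _ _ R leb2sf F mF F0).
  - by move=> x _; exact: conv_jensen.
(* After the substitution y = x + z the kernel no longer depends on x, so Tonelli isolates the
   translation error for each fixed z. *)
pose G (x z : R * R) : \bar R := ((th z.1 * th z.2) * (g (z.1 + x.1, z.2 + x.2) - g x) ^+ 2)%:E.
have FG x : (\int[lam2]_y F x y = \int[lam2]_z G x z)%E.
  rewrite -(integral2_shift x.1 x.2 (f := F x)) => //; last first.
    have pm : measurable_fun setT (pair x : R * R -> (R * R) * (R * R)) by exact: measurable_pair1.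
    exact: (measurableT_comp mF pm).
  apply: eq_integral => z _; rewrite /F /G /K /=; congr (_ * _)%:E.
  by rewrite !opprD !(addrCA _ (- _)) !subrr !addr0 !(moll_even mth).
under eq_integral do rewrite FG.
have mG : measurable_fun setT (fun xz : (R * R) * (R * R) => G xz.1 xz.2).
  apply/measurable_EFinP; apply: measurable_funM.
    apply: measurable_funM; apply: (measurableT_comp measurable_moll).
    - exact: (measurableT_comp measurable_fst measurable_snd).
    - exact: (measurableT_comp measurable_snd measurable_snd).
  apply: measurable_funX; apply: measurable_funB.
    exact: (measurableT_comp mg mshift).
  exact: (measurableT_comp mg measurable_fst).
have G0 x z : (0 <= G x z)%E.
  by rewrite lee_fin mulr_ge0 ?sqr_ge0// mulr_ge0 ?(moll_ge0 mth).
rewrite (@fubini_tonelli _ _ _ _ _ leb2sf leb2sf (fun xz => G xz.1 xz.2))//=.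
apply: (@le_trans _ _ (\int[lam2]_z (c%:E * (th z.1 * th z.2)%:E))%E).
  apply: ge0_le_integral => //.
  - by move=> z _; exact: integral_ge0.
  - exact: (@measurable_integral_G _ _ _ _ R leb2sf G mG G0).
  - apply/measurable_EFinP; apply: measurable_funM => //; apply: measurable_funM;
      exact: (measurableT_comp measurable_moll).
  move=> z _; have mgz : measurable_fun setT (fun x => g (z.1 + x.1, z.2 + x.2) - g x).
    apply: measurable_funB => //.
    under eq_fun do rewrite (addrC z.1) (addrC z.2).
    by apply: (measurableT_comp mg); exact: measurable_shift2.
  have E : (\int[lam2]_x G x z = (th z.1 * th z.2)%:E * \int[lam2]_x ((g (z.1 + x.1, z.2 + x.2) - g x) ^+ 2)%:E)%E.
    rewrite -ge0_integralZl//.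
    + by apply/measurable_EFinP; exact: measurable_funX.
    + by move=> x _; rewrite lee_fin sqr_ge0.
    + by rewrite lee_fin mulr_ge0 ?(moll_ge0 mth).
  rewrite E muleC.
  have [z1|z1] := leP e `|z.1|; first by rewrite (moll_supp mth z1) mul0r !mule0.
  have [z2|z2] := leP e `|z.2|; first by rewrite (moll_supp mth z2) mulr0 !mule0.
  apply: lee_wpmul2r; first by rewrite lee_fin mulr_ge0 ?(moll_ge0 mth).
  under eq_integral do rewrite (addrC z.1) (addrC z.2).
  have [sgs _] := sqint_shift z.1 z.2 sg.
  by rewrite (nrm2E (sqintB sgs sg)) lee_fin H// ltW.
rewrite ge0_integralZl//.
- have := int_K 0; rewrite /K/=; under eq_integral do rewrite !sub0r !(moll_even mth).
  by move=> ->; rewrite mule1.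
- by apply/measurable_EFinP; apply: measurable_funM => //; exact: (measurableT_comp measurable_moll).
- by move=> z _; rewrite lee_fin mulr_ge0 ?(moll_ge0 mth).
Qed.

End Mollification.

(** * Lipschitz functions of one variable *)

(** Radon-Nikodym for the restriction of [mu] to I, which is a finite measure; hence the formula is
    limited to subsets of I. *)
Lemma dominated_density d (T : measurableType d) (R : realType)
    (mu : {measure set T -> \bar R}) (la : {sigma_finite_measure set T -> \bar R})
    (I : set T) : measurable I -> (la I < +oo)%E ->
  (forall A, measurable A -> (mu A <= la A)%E) ->
  exists p : T -> R, la.-integrable setT (EFin \o p) /\
    forall A, measurable A -> A `<=` I -> (mu A = \int[la]_(x in A) (p x)%:E)%E.
Proof.
move=> mI laI mula.
have fI : (mu I < +oo)%E by exact: le_lt_trans (mula _ mI) laI.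
pose nu : {finite_measure set T -> \bar R} := mfrestr mI fI.
have dom : nu `<< la.
  apply/null_content_dominatesP => A mA A0.
  apply/eqP; rewrite -measure_le0 -[leRHS]A0.
  apply: le_trans (mula _ mA); rewrite /nu/= /mfrestr /mrestr.
  exact: measureIl.
pose F := Radon_Nikodym_SigmaFinite.f nu la.
have Ffin := Radon_Nikodym_SigmaFinite.f_fin_num dom.
have pF : EFin \o (fine \o F) = F by apply/funext => x; rewrite /= fineK.
exists (fine \o F); split; first by rewrite pF; exact: Radon_Nikodym_SigmaFinite.f_integrable.
move=> A mA AI; rewrite -[(fun x => _)]/(EFin \o (fine \o F)) pF.
rewrite -(Radon_Nikodym_SigmaFinite.f_integral dom)//.
by rewrite /nu /= /mfrestr /mrestr setIidl.
Qed.

Lemma integrable_locally_integrable (R : realType) (p : R -> R) :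
  leb.-integrable setT (EFin \o p) -> locally_integrable [set: R] p.
Proof.
move=> ip; split; [|exact: openT|].
  by case/integrableP: ip => /measurable_EFinP.
move=> K _ cK; have mK := compact_measurable cK.
have : leb.-integrable K (EFin \o p) by apply: integrableS ip.
by case/integrableP.
Qed.

Section LipschitzDerivable.
Context {R : realType}.
Variables (f : R -> R) (L : R).
Hypotheses (L0 : 0 < L) (fL : forall x y, `|f x - f y| <= L * `|x - y|).

(** With this factor the nondecreasing functions [g] and [h] below add up to the identity. *)
Let c := (2 * L)^-1.
Let c0 : 0 < c. Proof. by rewrite invr_gt0 mulr_gt0. Qed.

Let fle x y : x <= y -> `|f y - f x| <= L * (y - x).
Proof. by move=> xy; rewrite (le_trans (fL _ _))// ger0_norm ?subr_ge0. Qed.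

Lemma lip_continuous : continuous f.
Proof.
move=> x; apply/cvgrPdist_le => e e0.
have : \forall y \near x, ball x (e / L) y by apply: nbhsx_ballx; rewrite divr_gt0.
apply: filterS => y /ltW xy.
by rewrite (le_trans (fL _ _))// mulrC -ler_pdivlMr.
Qed.

Let g (x : R) : R := c * (L * x + f x).
Let h (x : R) : R := c * (L * x - f x).

Let cg : continuous g.
Proof.
move=> x; apply: cvgM; first exact: cvg_cst.
apply: cvgD; last exact: lip_continuous.
by apply: cvgM; [exact: cvg_cst|exact: cvg_id].
Qed.

Let ch : continuous h.
Proof.
move=> x; apply: cvgM; first exact: cvg_cst.
apply: cvgB; last exact: lip_continuous.
by apply: cvgM; [exact: cvg_cst|exact: cvg_id].
Qed.

Let ndg : {homo g : x y / x <= y}.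
Proof.
move=> x y xy; rewrite /g; apply: ler_wpM2l; first exact: ltW.
by have := fle xy; rewrite ler_norml => /andP[]; lra.
Qed.

Let ndh : {homo h : x y / x <= y}.
Proof.
move=> x y xy; rewrite /h; apply: ler_wpM2l; first exact: ltW.
by have := fle xy; rewrite ler_norml => /andP[]; lra.
Qed.

Let gh x : g x + h x = x.
Proof. by rewrite /g /h /c; field; rewrite gt_eqF. Qed.

Let gmix := isCumulative.Build R _ R g ndg (right_continuousW cg).
Let hmix := isCumulative.Build R _ R h ndh (right_continuousW ch).
Let gC : cumulative R R := HB.pack g gmix.
Let hC : cumulative R R := HB.pack h hmix.

Let mug : {measure set (measurableTypeR R) -> \bar R} := lebesgue_stieltjes_measure gC.
Let muh : {measure set (measurableTypeR R) -> \bar R} := lebesgue_stieltjes_measure hC.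

Let mug_itv (a b : R) : a <= b -> (mug `]a, b]%classic = (g b - g a)%:E)%E.
Proof.
move=> ab; rewrite /mug /= /lebesgue_stieltjes_measure /measure_extension.
rewrite measurable_mu_extE/=; last exact: is_ocitv.
by rewrite wlength_itv_bnd.
Qed.

Let muh_itv (a b : R) : a <= b -> (muh `]a, b]%classic = (h b - h a)%:E)%E.
Proof.
move=> ab; rewrite /muh /= /lebesgue_stieltjes_measure /measure_extension.
rewrite measurable_mu_extE/=; last exact: is_ocitv.
by rewrite wlength_itv_bnd.
Qed.

(** As g + h is the identity, [mug] + [muh] agrees with Lebesgue measure on half-open intervals,
    hence everywhere. *)
Let mug_le (A : set R) : measurable A -> (mug A <= leb A)%E.
Proof.
move=> mA; have -> : leb A = measure_add mug muh A.
  apply: lebesgue_measure_unique => // _ [[u v] _ <-].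
  rewrite [RHS]measure_addE -[(u, v).1]/u -[(u, v).2]/v.
  have [uv|uv] := leP u v.
    rewrite mug_itv// muh_itv// lebesgue_measure_itv/= lte_fin.
    have := gh u; have := gh v => gv gu.
    case: ifPn => [_|]; rewrite -?EFinD; [congr EFin; lra|rewrite -leNgt => vu; congr EFin; lra].
  by rewrite set_itv_ge ?measure0 ?adde0// -leNgt bnd_simp ltW.
by rewrite measure_addE leeDl.
Qed.

(* L x + f and L x - f are nondecreasing and their Stieltjes measures add up to
   2 L times the Lebesgue measure, so each of them has a density. *)
Lemma lipschitz_density (N : R) : exists p : R -> R,
  [/\ leb.-integrable `](- N), N] (EFin \o p),
      {ae leb, forall x, - N < x < N -> derivable f x 1 /\ derive1 f x = p x} &
      forall a b : R, - N <= a -> a <= b -> b <= N ->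
        \int[leb]_(t in `]a, b]) p t = f b - f a].
Proof.
pose I : set R := `](- N), N]%classic.
have mI : measurable I by exact: measurable_itv.
have lI : (leb I < +oo)%E.
  by rewrite /I /= lebesgue_measure_itv/=; case: ifP => // _; rewrite -EFinD ltry.
have [p [ip pE]] := @dominated_density _ (measurableTypeR R) R mug leb I mI lI mug_le.
have locp := integrable_locally_integrable ip.
have ipI A : measurable A -> leb.-integrable A (EFin \o p).
  by move=> mA; apply: integrableS ip.
have leA (a b : R) : (leb `]a, b]%classic < +oo)%E.
  by rewrite /= lebesgue_measure_itv/=; case: ifP => // _; rewrite -EFinD ltry.
have icst A (k : R) : measurable A -> (leb A < +oo)%E -> leb.-integrable A (EFin \o cst k).
  move=> mA fA; apply: measurable_bounded_integrable => //.
  by exists `|k|; split => // M kM x _ /=; exact: ltW.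
have pint (a b : R) : - N <= a -> a <= b -> b <= N ->
    \int[leb]_(t in `]a, b]) p t = g b - g a.
  move=> Na ab bN; rewrite /Rintegral -pE; last 2 first.
  - exact: measurable_itv.
  - move=> t; rewrite /I/= !in_itv/= => /andP[t1 t2].
    by rewrite (le_lt_trans Na)// (le_trans t2).
  by rewrite mug_itv.
(* Here p is the density of g, and f = 2 L g - L x. *)
exists (fun t => 2 * L * p t - L); split.
- have mI' : @measurable _ (measurableTypeR R) `](- N), N]%classic by exact: measurable_itv.
  have := integrableB mI' (integrableZl mI' (2 * L) (ipI _ mI')) (icst _ L mI' (leA _ _)).
  by apply: eq_integrable.
- have ipS y : leb.-integrable [set` Interval (BRight (- N)) (BRight y)] (EFin \o p).
    exact: ipI (measurable_itv _).
  have := @FTC1 R p (BRight (- N)) ipS locp.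
  apply: filterS; first exact: (ae_filter_ringOfSetsType leb).
  move=> x H /andP[Nx xN].
  have [|D D'] := H; first by rewrite lte_fin.
  (* Lebesgue differentiation gives the derivative of the primitive of p almost everywhere; this
     identity transfers it to g. *)
  have E : \near x, \int[leb]_(t in `](- N), x]) p t = g x - g (- N).
    near=> y; have yN : - N < y by near: y; exact: lt_nbhsr.
    have yN2 : y < N by near: y; exact: lt_nbhsl.
    by apply: pint => //; exact: ltW.
  have Dg : is_derive x 1 g (p x).
    have D1 : is_derive x 1 (fun x => g x - g (- N)) (p x).
      apply: near_eq_is_derive E _; rewrite -D' derive1E; exact: derivableP.
    have -> : g = (fun x => (g x - g (- N)) + g (- N)) by apply/funext => t; rewrite subrK.
    rewrite -[p x]addr0; apply: is_deriveD.
  have Df : is_derive x 1 f (2 * L * p x - L).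
    have -> : f = (2 * L) \*: g - (L \*: id).
      apply/funext => t; transitivity (2 * L * g t - L * t) => //.
      by rewrite /g /c; field; rewrite gt_eqF.
    by apply: is_derive_eq; rewrite /GRing.scale/= mulr1.
  by have [? dE] := Df; split => //; rewrite derive1E.
- move=> a b Na ab bN.
  have mab : @measurable _ (measurableTypeR R) `]a, b]%classic by exact: measurable_itv.
  rewrite RintegralB//; last 2 first.
  - exact: (integrableZl mab (2 * L) (ipI _ mab)).
  - exact: icst.
  rewrite RintegralZl//; last exact: ipI.
  rewrite pint// Rintegral_cst//= lebesgue_measure_itv/= lte_fin.
  have E : f b - f a = 2 * L * (g b - g a) - L * (b - a).
    by rewrite /g /c; field; rewrite gt_eqF.
  rewrite E; congr (_ - L * _).
  have [ab'|] := ltP a b; first by [].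
  by move=> ba; rewrite /=; apply/esym/eqP; rewrite subr_eq0 eq_le ba ab.
Unshelve. all: by end_near. Qed.

End LipschitzDerivable.

Lemma bigcap_rat_measurable d (T : measurableType d) (P : set rat) (F : rat -> set T) :
  (forall q, measurable (F q)) -> measurable (\bigcap_(q in P) F q).
Proof.
move=> mF; rewrite -[X in measurable X]setCK setC_bigcap; apply: measurableC.
rewrite bigcup_mkcond; apply: bigcupT_measurable_rat => q.
by case: ifPn => // _; exact: measurableC.
Qed.

(** * Measurability of the derivative of a continuous function *)

Section MeasurableDerive.
Context {R : realType}.
Variable (f : R -> R).
Hypothesis cf : continuous f.

Let Q (h t : R) : R := h^-1 * (f (h + t) - f t).

Lemma derivable_quotP t : derivable f t 1 <-> cvg (Q h t @[h --> 0^']).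
Proof.
rewrite /derivable (_ : (fun h : R => h^-1 *: _) = (fun h => Q h t))//.
by apply/funext => h; rewrite /Q /GRing.scale/= mulr1.
Qed.

Lemma derive1_quotE t : derive1 f t = lim (Q h t @[h --> 0^']).
Proof. by []. Qed.

(** The default value of a divergent limit matters: being constant off the set of differentiability,
    [derive1 f] can be measurable and, for Lipschitz f, bounded on the whole line. *)
Lemma derive1_notin t : ~ derivable f t 1 -> derive1 f t = point.
Proof. by move=> nd; rewrite derive1_quotE; apply: dvgP => cQ; apply: nd; exact/derivable_quotP. Qed.

(** Cauchy's criterion for the difference quotient, with rational increments only. Each inner
    condition is closed in t and there are countably many, whence measurability; continuity of f
    makes rational increments sufficient. *)
Let D : set R := \bigcap_(k : nat) \bigcup_(m : nat)
  \bigcap_(p in [set p : rat | 0 < `|ratr p : R| < m.+1%:R^-1])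
  \bigcap_(q in [set q : rat | 0 < `|ratr q : R| < m.+1%:R^-1])
    [set t | `|Q (ratr p) t - Q (ratr q) t| <= k.+1%:R^-1].

Let cQ h : continuous (Q h).
Proof.
move=> t; apply: cvgM; first exact: cvg_cst.
apply: cvgB; last exact: cf.
apply: (@continuous_comp _ _ _ (fun t => h + t) f); last exact: cf.
by apply: cvgD; [exact: cvg_cst|exact: cvg_id].
Qed.

Let mQ h : measurable_fun setT (Q h).
Proof. exact: continuous_measurable_fun (@cQ h). Qed.

Let mD : measurable D.
Proof.
apply: bigcapT_measurable => k; apply: bigcupT_measurable => m.
apply: bigcap_rat_measurable => p.
apply: bigcap_rat_measurable => q.
have mN : measurable_fun setT (fun t => `|Q (ratr p) t - Q (ratr q) t|).
  by apply: measurableT_comp => //; exact: measurable_funB.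
rewrite (_ : [set t | _] = (fun t => `|Q (ratr p) t - Q (ratr q) t|) @^-1` `]-oo, k.+1%:R^-1]%classic).
  by rewrite -[X in measurable X]setTI; apply: mN => //; exact: measurable_itv.
by apply/seteqP; split => t /=; rewrite in_itv.
Qed.

Let cQt t (h : R) : h != 0 -> {for h, continuous (Q ^~ t)}.
Proof.
move=> h0; apply: cvgM; first exact: cvgV.
apply: cvgB; last exact: cvg_cst.
apply: (@continuous_comp _ _ _ (fun h => h + t) f); last exact: cf.
by apply: cvgD; [exact: cvg_id|exact: cvg_cst].
Qed.

Lemma rat_near (h : R) (P : set R) : nbhs h P -> exists q : rat, P (ratr q).
Proof.
move=> /nbhs_ballP[e /= e0 eP].
have lt1 : h - e < h + e by rewrite ltrD2l (lt_trans _ e0)// oppr_lt0.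
have [q] := rat_in_itvoo lt1; rewrite in_itv/= => /andP[q1 q2].
exists q; apply: eP; rewrite /ball/= distrC ltr_norml; apply/andP; split.
  by rewrite ltrBrDr addrC.
by rewrite ltrBlDr addrC.
Qed.

Let DP t : D t <-> derivable f t 1.
Proof.
split=> [Dt|/derivable_quotP].
- apply/derivable_quotP; apply/cauchy_cvgP/cauchy_exP => e /= e0.
  pose k := Num.bound (e / 3)^-1.
  have e3 : 0 < e / 3 by rewrite divr_gt0.
  have ke : k.+1%:R^-1 < e / 3.
    rewrite invf_plt ?posrE//; apply: (lt_le_trans (archi_boundP _)).
      by rewrite invr_ge0 ltW.
    by rewrite ler_nat.
  have [m _ Hm] := Dt k I.
  have m0 : 0 < m.+1%:R^-1 :> R by rewrite invr_gt0.
  (* The quotient is continuous in a nonzero increment, so a real increment can be replaced by a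
     rational one at the cost of e/3. *)
  have near_rat (h : R) : h != 0 -> `|h| < m.+1%:R^-1 -> exists q : rat,
      0 < `|ratr q : R| < m.+1%:R^-1 /\ `|Q h t - Q (ratr q) t| < e / 3.
    move=> h0 hm; apply: (@rat_near h (fun q => 0 < `|q| < m.+1%:R^-1 /\ `|Q h t - Q q t| < e / 3)).
    near=> q; split.
      apply/andP; split; last by near: q; exact: (cvgr_norm_lt h).
      by rewrite normr_gt0; near: q; exact: (cvgr_neq0 h).
    by near: q; have /cvgrPdist_lt := @cQt t h h0; exact.
  (* Any admissible increment will do as the center of the Cauchy ball. *)
  have [h0 [h0n h0m]] : exists h0 : R, h0 != 0 /\ `|h0| < m.+1%:R^-1.
    exists (m.+1%:R^-1 / 2); split; first by rewrite gt_eqF// divr_gt0.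
    by rewrite ger0_norm ?divr_ge0 ?ltW// ltr_pdivrMr// ltr_pMr// ltr1n.
  exists (Q h0 t).
  near=> h.
  have hn : h != 0 by near: h; exact: nbhs_dnbhs_neq.
  have hm : `|h| < m.+1%:R^-1 by near: h; exact: dnbhs0_lt.
  have [p [pm hp]] := near_rat _ hn hm; have [q [qm hq]] := near_rat _ h0n h0m.
  have := Hm p pm q qm; rewrite /= => hpq.
  rewrite /ball/=.
  have -> : Q h0 t - Q h t = (Q h0 t - Q (ratr q) t) - (Q (ratr p) t - Q (ratr q) t) - (Q h t - Q (ratr p) t) by ring.
  rewrite (le_lt_trans (ler_normB _ _))//.
  have eE : e = e / 3 + e / 3 + e / 3 by field.
  rewrite [ltRHS]eE; apply: ltrD => //; apply: (le_lt_trans (ler_normB _ _)).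
  by apply: ltrD => //; exact: (le_lt_trans hpq ke).
- move=> /cvg_ex[l Ql] k _.
  have k2 : 0 < k.+1%:R^-1 / 2 :> R by rewrite divr_gt0.
  have /cvgrPdist_le/(_ _ k2)[e /= e0 He] := Ql.
  pose m := Num.bound e^-1.
  have me : m.+1%:R^-1 < e.
    rewrite invf_plt ?posrE//; apply: (lt_le_trans (archi_boundP _)).
      by rewrite invr_ge0 ltW.
    by rewrite ler_nat.
  exists m => // p /andP[p0 pm] q /andP[q0 qm] /=.
  have Hp : `|l - Q (ratr p) t| <= k.+1%:R^-1 / 2.
    by apply: He; [rewrite /= sub0r normrN (lt_trans pm)|rewrite -normr_gt0].
  have Hq : `|l - Q (ratr q) t| <= k.+1%:R^-1 / 2.
    by apply: He; [rewrite /= sub0r normrN (lt_trans qm)|rewrite -normr_gt0].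
  have -> : Q (ratr p) t - Q (ratr q) t = (l - Q (ratr q) t) - (l - Q (ratr p) t) by ring.
  by rewrite (le_trans (ler_normB _ _))// [leRHS]splitr lerD.
Unshelve. all: by end_near. Qed.

Lemma measurable_derive1 : measurable_fun setT (derive1 f).
Proof.
pose u n (t : R) := if t \in D then Q (n.+1%:R^-1) t else point.
have mu n : measurable_fun setT (u n).
  apply: measurable_fun_ifT => //.
  apply: (@measurable_fun_bool _ _ _ _ true).
  rewrite setTI (_ : _ @^-1` _ = D)//.
  by apply/seteqP; split => s /=; [move=> /set_mem|move=> /mem_set].
apply: (@measurable_fun_cvg _ _ R setT u) => // t _.
have [Dt|nD] := pselect (D t); rewrite /u.
  rewrite mem_set//.
  have /DP/derivable_quotP cvQ := Dt.
  rewrite derive1_quotE.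
  apply: (@cvg_comp _ _ _ (fun n : nat => n.+1%:R^-1 : R) (fun h => Q h t) _ (0^')) => //.
  move=> P [e /= e0 eP]; near=> n; apply: eP; last by rewrite /= gt_eqF// invr_gt0.
  rewrite /= sub0r normrN ger0_norm ?invr_ge0//.
  by near: n; exact: (near_infty_natSinv_lt (PosNum e0)).
rewrite memNset// derive1_notin; first exact: cvg_cst.
by move=> /DP.
Unshelve. all: by end_near. Qed.

End MeasurableDerive.

Section LipschitzIntegral.
Context {R : realType}.
Implicit Types (f : R -> R) (L : R).

Lemma derive1_bounded f L : 0 < L -> (forall x y, `|f x - f y| <= L * `|x - y|) ->
  exists2 C : R, 0 <= C & forall t, `|derive1 f t| <= C.
Proof.
(* [point] is the value of [derive1 f] where f is not differentiable. *)
move=> L0 fL; exists (Num.max L `|point : R|); first by rewrite le_max normr_ge0 orbT.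
move=> t; have [dt|ndt] := pselect (derivable f t 1); last first.
  by rewrite derive1_notin// le_max lexx orbT.
rewrite le_max; apply/orP; left.
move: dt => /derivable_quotP; rewrite derive1_quotE => cv.
apply/ler_addgt0Pr => e e0.
move/cvgrPdist_le : cv => /(_ _ e0) H.
near (0:R)^' => h.
have h0 : h != 0 by near: h; exact: nbhs_dnbhs_neq.
have Hh : `|lim (h^-1 * (f (h + t) - f t) @[h --> 0^']) - h^-1 * (f (h + t) - f t)| <= e by near: h.
have Q : `|h^-1 * (f (h + t) - f t)| <= L.
  rewrite normrM normfV ler_pdivrMl ?normr_gt0// mulrC (le_trans (fL _ _))//.
  by rewrite addrK.
set l := lim _ in Hh *.
rewrite -[l](subrK (h^-1 * (f (h + t) - f t))) addrC (le_trans (ler_normD _ _))//.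
exact: lerD.
Unshelve. all: by end_near. Qed.

Lemma bounded_integrable_itv (f : R -> R) (C a b : R) b0 b1 : measurable_fun setT f ->
  (forall t, `|f t| <= C) ->
  leb.-integrable [set` Interval (BSide b0 a) (BSide b1 b)] (EFin \o f).
Proof.
move=> mf fC; apply: measurable_bounded_integrable => //.
- by rewrite /= lebesgue_measure_itv/=; case: ifP => // _; rewrite -EFinD ltry.
- exact: measurable_funTS.
exists C; split; first exact: num_real.
by move=> M CM x _ /=; rewrite (le_trans (fC x))// ltW.
Qed.

Lemma lipschitz_ae_derivable f L (T : R) : 0 < L -> (forall x y, `|f x - f y| <= L * `|x - y|) ->
  {ae leb, forall x : R, 0 < x <= T -> derivable f x 1}.
Proof.
move=> L0 fL; have [p [_ + _]] := lipschitz_density L0 fL (`|T| + 1).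
apply: filterS; first exact: (ae_filter_ringOfSetsType leb).
move=> x H /andP[x0 xT]; have [] // := H; apply/andP; split.
  by rewrite (le_lt_trans _ x0)// oppr_le0 addr_ge0.
by rewrite (le_lt_trans xT)// (le_lt_trans (ler_norm T))// ltrDl.
Qed.

Lemma lipschitz_FTC f L (T : R) : 0 < T -> 0 < L ->
  (forall x y, `|f x - f y| <= L * `|x - y|) ->
  \int[leb]_(t in `[0, T]) derive1 f t = f T - f 0.
Proof.
(* The margin 1 puts [0, T] inside the open interval on which the density is identified with the
   derivative. *)
move=> T0 L0 fL; have [p [ip aep pE]] := lipschitz_density L0 fL (T + 1).
have mf := measurable_derive1 (lip_continuous L0 fL).
have T1 : T <= T + 1 by rewrite lerDl.
have T10 : - (T + 1) <= 0 by rewrite oppr_le0 addr_ge0// ltW.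
rewrite -(pE 0 T T10 (ltW T0) T1).
have [C C0 dC] := derive1_bounded L0 fL.
rewrite -Rintegral_itv_obnd_cbnd; last exact: bounded_integrable_itv dC.
rewrite /Rintegral; congr fine; apply: ae_eq_integral.
- exact: measurable_itv.
- by apply/measurable_EFinP; exact: measurable_funTS.
- have ip0 : leb.-integrable `]0, T] (EFin \o p).
    apply: integrableS ip; [exact: measurable_itv|exact: measurable_itv|].
    move=> x /=; rewrite !in_itv/= => /andP[x0 xT].
    by rewrite (le_lt_trans T10 x0) (le_trans xT).
  by case/integrableP : ip0.
move: aep; apply: filterS; first exact: (ae_filter_ringOfSetsType leb).
move=> x H; rewrite /= in_itv/= => /andP[x0 xT].
have [|_ ->//] := H; rewrite (le_lt_trans T10 x0)/=.
by rewrite (le_lt_trans xT)// ltrDl.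
Qed.

(** The integrand is minus the derivative of t -> g(a - phi1 t) h(b - phi2 t) wherever phi1 and phi2
    are both differentiable, and this Lipschitz function has equal values at 0 and T. With g = h =
    [Th] it identifies the two formulas for the winding function. *)
Lemma closed_curve_kernel (phi1 phi2 : R -> R) (L T a b : R) (g h : R -> R) :
  0 < T -> 0 < L ->
  (forall x y, `|phi1 x - phi1 y| <= L * `|x - y|) ->
  (forall x y, `|phi2 x - phi2 y| <= L * `|x - y|) ->
  phi1 T = phi1 0 -> phi2 T = phi2 0 -> Cboo g -> Cboo h ->
  \int[leb]_(t in `[0, T]) (derive1 g (a - phi1 t) * h (b - phi2 t) * derive1 phi1 t +
     g (a - phi1 t) * derive1 h (b - phi2 t) * derive1 phi2 t) = 0.
Proof.
move=> T0 L0 lip1 lip2 per1 per2 Cg Ch.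
pose F t := g (a - phi1 t) * h (b - phi2 t).
have [Mg Mg0 gM] := Cboo_bounded Cg; have [Mh Mh0 hM] := Cboo_bounded Ch.
have [Lg Lg0 gL] := Cboo_lipschitz Cg; have [Lh Lh0 hL] := Cboo_lipschitz Ch.
pose K := Lg * L * Mh + Mg * (Lh * L) + 1.
have K0 : 0 < K by rewrite /K ltr_wpDl// addr_ge0// !mulr_ge0// ltW.
have lipF x y : `|F x - F y| <= K * `|x - y|.
  rewrite /F; set u := g (a - phi1 x); set v := h (b - phi2 x); set u' := g (a - phi1 y); set v' := h (b - phi2 y).
  have -> : u * v - u' * v' = (u - u') * v + u' * (v - v') by ring.
  have A1 : `|u - u'| <= Lg * (L * `|x - y|).
    rewrite (le_trans (gL _ _))// ler_wpM2l//.
    rewrite (_ : _ - _ = - (phi1 x - phi1 y)); last by ring.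
    by rewrite normrN.
  have A2 : `|v - v'| <= Lh * (L * `|x - y|).
    rewrite (le_trans (hL _ _))// ler_wpM2l//.
    rewrite (_ : _ - _ = - (phi2 x - phi2 y)); last by ring.
    by rewrite normrN.
  rewrite (le_trans (ler_normD _ _))// !normrM /K !mulrDl mul1r.
  rewrite ler_wpDr//; apply: lerD.
    rewrite (_ : _ * Mh * _ = Lg * (L * `|x - y|) * Mh); last by ring.
    by apply: ler_pM => //; exact: hM.
  rewrite (_ : Mg * _ * _ = Mg * (Lh * (L * `|x - y|))); last by ring.
  by apply: ler_pM => //; exact: gM.
have FTC := lipschitz_FTC T0 K0 lipF.
have F0 : F T - F 0 = 0 by rewrite /F per1 per2 subrr.
rewrite F0 in FTC.
have cphi1 := lip_continuous L0 lip1; have cphi2 := lip_continuous L0 lip2.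
have md1 := measurable_derive1 cphi1; have md2 := measurable_derive1 cphi2.
have mF := measurable_derive1 (lip_continuous K0 lipF).
have mk (u : R -> R) c (phi : R -> R) : continuous phi -> Cboo u -> measurable_fun setT (fun t => u (c - phi t)).
  move=> cphi Cu; apply: (measurableT_comp (Cboo_measurable Cu)).
  by apply: measurable_funB => //; exact: continuous_measurable_fun.
pose H t := derive1 g (a - phi1 t) * h (b - phi2 t) * derive1 phi1 t +
     g (a - phi1 t) * derive1 h (b - phi2 t) * derive1 phi2 t.
have mH : measurable_fun setT H.
  apply: measurable_funD; apply: measurable_funM => //; apply: measurable_funM; apply: mk => //;
    exact: Cboo_derive1.
have [C C0 dC] := derive1_bounded K0 lipF.
have [C1 C10 dC1] := derive1_bounded L0 lip1; have [C2 C20 dC2] := derive1_bounded L0 lip2.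
have [Ng Ng0 gN] := Cboo_bounded (Cboo_derive1 Cg); have [Nh Nh0 hN] := Cboo_bounded (Cboo_derive1 Ch).
have bH t : `|H t| <= Ng * Mh * C1 + Mg * Nh * C2.
  rewrite (le_trans (ler_normD _ _))// !normrM lerD// ler_pM// ?mulr_ge0//; exact: ler_pM.
have E : \int[leb]_(t in `[0, T]) H t = \int[leb]_(t in `[0, T]) (- derive1 F t).
  rewrite -!Rintegral_itv_obnd_cbnd; last 2 first.
  - by apply: (@bounded_integrable_itv _ C); [exact: measurableT_comp|move=> t; rewrite normrN].
  - exact: bounded_integrable_itv bH.
  rewrite /Rintegral; congr fine; apply: ae_eq_integral.
  - exact: measurable_itv.
  - by apply/measurable_EFinP; exact: measurable_funTS.
  - by apply/measurable_EFinP; apply: measurable_funTS; exact: measurableT_comp.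
  have A1 := lipschitz_ae_derivable T L0 lip1; have A2 := lipschitz_ae_derivable T L0 lip2.
  have : {ae leb, forall x : R, 0 < x <= T -> derivable phi1 x 1 /\ derivable phi2 x 1}.
    move: A1 A2; apply: filterS2; first exact: (ae_filter_ringOfSetsType leb).
    by move=> x H1 H2 xT; split; [exact: H1|exact: H2].
  apply: filterS; first exact: (ae_filter_ringOfSetsType leb).
  move=> t Ht; rewrite /= in_itv/= => tT; have [d1 d2] := Ht tT.
  congr EFin.
  have D (u : R -> R) c (phi : R -> R) : derivable phi t 1 -> Cboo u ->
      is_derive t 1 (fun t => u (c - phi t)) (- (derive1 u (c - phi t) * derive1 phi t)).
    move=> dphi Cu; rewrite -mulrN.
    apply: (@is_derive1_comp _ u (fun t => c - phi t)); first exact: Cboo_is_derive.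
    have Dp : is_derive t 1 phi (derive1 phi t) by rewrite derive1E; exact/derivableP.
    by rewrite -[- _]add0r; apply: is_deriveB.
  have DF := is_deriveM (D _ a _ d1 Cg) (D _ b _ d2 Ch).
  have := @derive_val _ _ _ _ _ _ _ DF.
  rewrite -derive1E => ->.
  by rewrite /H /GRing.scale/=; ring.
rewrite -[LHS]/(\int[leb]_(t in `[0, T]) H t) E.
have iF : leb.-integrable `[0, T] (EFin \o derive1 F) by exact: bounded_integrable_itv dC.
have := @RintegralZl _ _ _ leb `[0, T]%classic (derive1 F) (-1) (measurable_itv _) iF.
rewrite FTC mulr0 => Z; rewrite -[RHS]Z; apply: eq_Rintegral => t _; by rewrite mulN1r.
Qed.

End LipschitzIntegral.

(** * Test functions and products with Sobolev functions *)

Section TestFunctions.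
Context {R : realType}.
Local Notation lam2 := (@lebesgue_measure R \x @lebesgue_measure R)%E.
Implicit Types (f g psi zeta u v : R * R -> R) (O U : set (R * R)).

Lemma compact_sub_box (K : set (R * R)) : compact K -> exists2 N : R, 0 <= N & K `<=` box N.
Proof.
move=> /compact_bounded[M [_ HM]].
pose N : R := `|M| + 1; exists N; first by rewrite addr_ge0.
move=> x Kx; have MN : M < N by rewrite (le_lt_trans (ler_norm M))// ltrDl.
have := HM N MN x Kx; rewrite /= => xN.
have [x1 x2] : `|x.1| <= N /\ `|x.2| <= N.
  by move: xN; rewrite prod_normE ge_max => /andP[].
by split => /=; rewrite in_itv/= -ler_norml.
Qed.

Lemma compact_box (N : R) : compact (box N).
Proof. by apply: compact_setX; exact: segment_compact. Qed.

Lemma sqint_bounded_box f (M N : R) : measurable_fun setT f -> (forall x, `|f x| <= M) ->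
  (forall x, ~ box N x -> f x = 0) -> sqint lam2 f.
Proof.
move=> mf fM f0.
have mB := measurable_box N.
have [sB _] := sqint_indic mB (leb2_sub_box mB (@subset_refl _ _)).
apply: (@sqint_dominated _ _ _ lam2 _ _ (sqintZ M sB)) => // x.
have M0 : 0 <= M by apply: le_trans (fM x).
rewrite indicE; have [xB|xB] := pselect (box N x).
  by rewrite mem_set// mulr1 (ger0_norm M0).
by rewrite f0// normr0.
Qed.

Lemma integrable_sqint_box f (N : R) : sqint lam2 f ->
  (forall x, ~ box N x -> f x = 0) -> lam2.-integrable setT (EFin \o f).
Proof.
move=> sf f0; have mB := measurable_box N.
have [sB _] := sqint_indic mB (leb2_sub_box mB (@subset_refl _ _)).
have := @integrable_fctM _ _ _ lam2 _ _ sf sB.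
apply: eq_integrable => // x _ /=; congr EFin; rewrite indicE.
have [xB|xB] := pselect (box N x); first by rewrite mem_set// mulr1.
by rewrite f0// mul0r.
Qed.

Lemma smooth_measurable psi : smooth_on setT psi -> measurable_fun setT psi.
Proof.
by move=> sp; apply: continuous_measurable2 => x; exact: (smooth_on_continuous sp).
Qed.

Lemma test_bounded O psi : test_function O psi -> exists2 M : R, 0 <= M & forall x, `|psi x| <= M.
Proof.
move=> [sp [K [cK _ psi0]]].
have cp : {within K, continuous psi}.
  by apply: continuous_subspaceT => x; exact: (smooth_on_continuous sp).
have /compact_bounded[M [_ HM]] := continuous_compact cp cK.
exists (`|M| + 1); first by rewrite addr_ge0.
move=> x; have [Kx|Kx] := pselect (K x); last by rewrite psi0// normr0 addr_ge0.
apply: (HM (`|M| + 1)); last by exists x.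
by rewrite (le_lt_trans (ler_norm M))// ltrDl.
Qed.

Lemma test_support O psi : test_function O psi -> exists2 N : R, 0 <= N & forall x, ~ box N x -> psi x = 0.
Proof.
move=> [sp [K [cK _ psi0]]]; have [N N0 KN] := compact_sub_box cK.
by exists N => // x xN; apply: psi0 => /KN.
Qed.

Lemma test_sqint O psi : test_function O psi -> sqint lam2 psi.
Proof.
move=> tp; have [sp _] := tp; have [M _ pM] := test_bounded tp; have [N _ pN] := test_support tp.
exact: sqint_bounded_box (smooth_measurable sp) pM pN.
Qed.

Lemma partial_eq0 (i : 'I_2) f U : open U -> (forall x, U x -> f x = 0) ->
  forall x, U x -> partial i f x = 0.
Proof.
move=> oU f0 x Ux; have -> : partial i f x = partial i (cst 0) x.
  by apply: partial_near; near=> y; apply: f0; near: y; exact: open_nbhs_nbhs.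
by rewrite /partial derive_cst.
Unshelve. all: by end_near. Qed.

Lemma test_partial O psi i : test_function O psi -> test_function O (partial i psi).
Proof.
move=> [sp [K [cK KO psi0]]]; split; first exact: smooth_on_partial.
exists K; split => // x Kx; apply: (@partial_eq0 i psi (~` K)) => //.
by apply: closed_openC; apply: compact_closed => //; exact: norm_hausdorff.
Qed.

Lemma test_multi O psi k : test_function O psi -> test_function O (multi_deriv k psi).
Proof.
move=> tp; rewrite /multi_deriv; elim: k.1 => [|n IH] /=; last exact: test_partial.
by elim: k.2 => [//|n IH] /=; exact: test_partial.
Qed.

Lemma test_smoothM O zeta psi : test_function O zeta -> smooth_on setT psi ->
  test_function O (zeta * psi).
Proof.
move=> [sz [K [cK KO z0]]] sp; split; first by apply: smooth_onM => //; exact: openT.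
by exists K; split => // x Kx; rewrite fctE z0// mul0r.
Qed.

Lemma partialB i f g : smooth_on setT f -> smooth_on setT g ->
  partial i (f - g) = partial i f - partial i g.
Proof.
move=> sf sg; apply/funext => x; rewrite /partial deriveB//; exact: smooth_on_derivable.
Qed.

Lemma smooth_on_subf f g : smooth_on setT f -> smooth_on setT g -> smooth_on setT (f - g).
Proof. by move=> sf sg; exact: (smooth_onB openT sf sg). Qed.

Lemma iter_partialB i n f g : smooth_on setT f -> smooth_on setT g ->
  iter n (partial i) (f - g) = iter n (partial i) f - iter n (partial i) g.
Proof.
move=> sf sg; elim: n => //= n ->; rewrite partialB//; exact: smooth_on_iter.
Qed.

Lemma partialM i f g : smooth_on setT f -> smooth_on setT g ->
  partial i (f * g) = partial i f * g + f * partial i g.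
Proof.
move=> sf sg; apply/funext => x.
rewrite /partial deriveM; [|exact: smooth_on_derivable..].
rewrite [LHS]addrC; congr (_ + _); exact: mulrC.
Qed.

Lemma partialM_ibp i f g : smooth_on setT f -> smooth_on setT g ->
  f * partial i g = partial i (f * g) - partial i f * g.
Proof. by move=> sf sg; rewrite partialM// addrAC subrr add0r. Qed.

Lemma L2_onP O u : L2_on O u <-> sqint lam2 (u \_ O).
Proof. exact: sqintP. Qed.

Lemma int_on O u psi : \int[leb2]_(x in O) (u x * psi x) = \int[lam2]_x ((u \_ O) x * psi x).
Proof.
rewrite Rintegral_mkcond; apply: eq_Rintegral => x _; rewrite !patchE.
by case: ifP => // _; rewrite mul0r.
Qed.

End TestFunctions.

(** * Weak derivatives of a Sobolev function times a cutoff *)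

Section WeakProduct.
Context {R : realType}.
Local Notation lam2 := (@lebesgue_measure R \x @lebesgue_measure R)%E.
Variables (O U : set (R * R)) (s : nat) (u : R * R -> R).
Hypotheses (Hu : Hs O s u) (oU : open U).
Implicit Types (psi zeta v : R * R -> R).

Let uO := u \_ O.
Let su : sqint lam2 uO. Proof. by apply/L2_onP; case: Hu. Qed.

(** The distribution psi -> int u A(psi) has an L2 density vanishing on U. All smooth psi are
    allowed, not only test functions in O, so that mollifier kernels centered anywhere can be
    inserted; U will be an open set where the cutoff vanishes. *)
Definition represents (A : (R * R -> R) -> R * R -> R) : Prop :=
  exists v, [/\ sqint lam2 v, forall x, U x -> v x = 0 &
    forall psi, smooth_on setT psi -> \int[lam2]_x (uO x * A psi x) = \int[lam2]_x (v x * psi x)].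

Variable N : R.
Hypothesis UN : forall x, ~ box N x -> U x.

Lemma integrable_represents v psi : sqint lam2 v -> (forall x, U x -> v x = 0) ->
  smooth_on setT psi -> lam2.-integrable setT (EFin \o (fun x => v x * psi x)).
Proof.
move=> sv v0 sp; have mp := smooth_measurable sp.
have cp : {within box N, continuous psi}.
  by apply: continuous_subspaceT => x; exact: (smooth_on_continuous sp).
have /compact_bounded[M0 [_ HM]] := continuous_compact cp (@compact_box R N).
pose M : R := `|M0| + 1.
have pM x : box N x -> `|psi x| <= M.
  by move=> bx; apply: (HM M); [rewrite (le_lt_trans (ler_norm M0))// ltrDl|exists x].
have mB := measurable_box N.
have M0' : 0 <= M by rewrite addr_ge0.
have sp1 : sqint lam2 (fun x => psi x * \1_(box N) x).
  apply: (sqint_bounded_box (M := M) (N := N)).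
  - by apply: measurable_funM => //; exact: measurable_indic.
  - move=> x; rewrite indicE; have [xB|xB] := pselect (box N x).
      by rewrite mem_set// mulr1 pM.
    by rewrite memNset// mulr0 normr0.
  - by move=> x xB; rewrite indicE memNset// mulr0.
have := integrable_fctM sv sp1.
apply: eq_integrable => // x _ /=; congr EFin; rewrite indicE.
have [xB|xB] := pselect (box N x); first by rewrite mem_set// mulr1.
by rewrite v0 ?mul0r//; exact: UN.
Qed.

Lemma representsB A B : (forall psi, smooth_on setT psi -> test_function O (A psi)) ->
  (forall psi, smooth_on setT psi -> test_function O (B psi)) ->
  represents A -> represents B -> represents (fun psi => A psi - B psi).
Proof.
move=> tA tB [v [sv v0 hv]] [w [sw w0 hw]].
exists (fun x => v x - w x); split; first exact: sqintB.
  by move=> x Ux; rewrite v0// w0// subr0.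
move=> psi sp.
have -> : \int[lam2]_x ((v x - w x) * psi x) =
          \int[lam2]_x (v x * psi x) - \int[lam2]_x (w x * psi x).
  rewrite -RintegralB//; [|exact: integrable_represents..].
  by apply: eq_Rintegral => x _; rewrite mulrBl.
rewrite -hv// -hw// -RintegralB//.
- by apply: eq_Rintegral => x _; rewrite !fctE mulrBr.
- exact: (integrable_fctM su (test_sqint (tA _ sp))).
- exact: (integrable_fctM su (test_sqint (tB _ sp))).
Qed.

Lemma eq_represents A B : (forall psi, smooth_on setT psi -> A psi = B psi) ->
  represents A -> represents B.
Proof.
by move=> AB [v [sv v0 hv]]; exists v; split => // psi sp; rewrite -AB//; exact: hv.
Qed.

Lemma test_iter (V : set (R * R)) i n psi : test_function V psi -> test_function V (iter n (partial i) psi).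
Proof. by move=> tz; elim: n => //= n; exact: test_partial. Qed.

(* From zeta d_i X = d_i (zeta X) - (d_i zeta) X: derivatives are moved outside
   without ever commuting two partial derivatives. *)
Lemma represents_step i n zeta (X : (R * R -> R) -> R * R -> R) (D : (R * R -> R) -> R * R -> R) :
  (forall psi, smooth_on setT psi -> smooth_on setT (X psi)) ->
  (forall psi, test_function O psi -> test_function O (D psi)) ->
  (forall f g, smooth_on setT f -> smooth_on setT g -> D (f - g) = D f - D g) ->
  test_function O zeta ->
  represents (fun psi => D (iter n.+1 (partial i) (zeta * X psi))) ->
  represents (fun psi => D (iter n (partial i) (partial i zeta * X psi))) ->
  represents (fun psi => D (iter n (partial i) (zeta * partial i (X psi)))).
Proof.
move=> sX tD DB tz r1 r2; have [sz _] := tz.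
have tz' := test_partial i tz.
have [sz' _] := tz'.
apply: eq_represents (representsB _ _ r1 r2).
- move=> psi sp; rewrite partialM_ibp//; last exact: sX.
  have s1 : smooth_on setT (partial i (zeta * X psi)).
    by apply: smooth_on_partial; apply: smooth_onM openT _ _ => //; exact: sX.
  have s2 : smooth_on setT (partial i zeta * X psi).
    by apply: smooth_onM openT _ _ => //; exact: sX.
  by rewrite iter_partialB// DB ?iterSr//; exact: smooth_on_iter.
- by move=> psi sp; apply: tD; apply: test_iter; apply: test_smoothM => //; exact: sX.
- by move=> psi sp; apply: tD; apply: test_iter; apply: test_smoothM => //; exact: sX.
Qed.

(** Induction on the number l of derivatives still acting on psi: one of them moves outside the
    product or onto [zeta], and the total order never grows. When l = 0 the product is a test
    function, to which the weak derivative of order (i, j) applies. *)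
Lemma represents1 l : forall i j zeta, (i + j + l <= s)%N -> test_function O zeta ->
  (forall x, U x -> zeta x = 0) ->
  represents (fun psi => iter i (partial 0) (iter j (partial 1) (zeta * iter l (partial 1) psi))).
Proof.
elim: l => [|l IH] i j zeta ijs tz z0.
  have [_ Hw] := Hu; rewrite addn0 in ijs.
  have [v [/L2_onP sv wv]] := Hw (i, j) ijs.
  have [M M0 zM] := test_bounded tz; have [sz _] := tz.
  exists (fun x => (-1) ^+ (i + j) * (zeta x * (v \_ O) x)); split.
  - by apply: sqintZ; apply: sqintM sv (smooth_measurable sz) zM.
  - by move=> x Ux; rewrite z0// mul0r mulr0.
  - move=> psi sp; have tzp := test_smoothM tz sp.
    have E : \int[lam2]_x (uO x * multi_deriv (i, j) (zeta * psi) x) =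
      (-1) ^+ (i + j) * \int[lam2]_x ((v \_ O) x * (zeta * psi) x).
      by rewrite -(int_on O u) -(int_on O v); exact: (wv _ tzp).
    apply: (etrans E); clear E.
    rewrite -RintegralZl//; last exact: (integrable_fctM sv (test_sqint tzp)).
    apply: eq_Rintegral => x _; have -> : (zeta * psi) x = zeta x * psi x by [].
    by move: ((v \_ O) x) => w; ring.
apply: (@represents_step 1 j zeta (fun psi => iter l (partial 1) psi) (iter i (partial 0))) => //.
- by move=> psi; exact: smooth_on_iter.
- by move=> psi; exact: test_iter.
- by move=> f g; exact: iter_partialB.
- by apply: IH => //; rewrite -addnA addSnnS addnA.
- apply: IH => //; first by rewrite (leq_trans _ ijs)// leq_add2l.
  + exact: test_partial.
  + exact: partial_eq0.
Qed.

(** Derivatives in the first variable are outermost in [multi_deriv], so they are moved out first;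
    what is left is [represents1] with j = 0. *)
Lemma represents2 k : forall i l zeta, (i + k + l <= s)%N -> test_function O zeta ->
  (forall x, U x -> zeta x = 0) ->
  represents (fun psi => iter i (partial 0) (zeta * multi_deriv (k, l) psi)).
Proof.
elim: k => [|k IH] i l zeta ijs tz z0.
  by apply: (@represents1 l i 0) => //; rewrite !addn0 in ijs *.
apply: (@represents_step 0 i zeta (multi_deriv (k, l)) id) => //.
- by move=> psi; exact: smooth_on_multi.
- by apply: IH => //; move: ijs; rewrite addnS addSn.
- apply: IH => //; first by rewrite (leq_trans _ ijs)// leq_add2r leq_add2l.
  + exact: test_partial.
  + exact: partial_eq0.
Qed.

(** Equivalently, [zeta] times u, extended by 0, has distributional derivatives up to order s in L2
    of the whole plane; no Leibniz formula is written out. *)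
Lemma weak_product k zeta : (k.1 + k.2 <= s)%N -> test_function O zeta ->
  (forall x, U x -> zeta x = 0) ->
  represents (fun psi => zeta * multi_deriv k psi).
Proof. by case: k => k l ks tz z0; apply: (@represents2 k 0 l). Qed.

End WeakProduct.

(** * Mollification and weak derivatives *)

Section IntegrationByParts.
Context {R : realType}.
Local Notation lam2 := (@lebesgue_measure R \x @lebesgue_measure R)%E.
Implicit Types (f g psi zeta u v : R * R -> R) (O U : set (R * R)).

Lemma box_le (N M : R) : N <= M -> box N `<=` box M.
Proof.
move=> NM x [/=]; rewrite !in_itv/= => /andP[a1 a2] /andP[a3 a4].
by split => /=; rewrite in_itv/=; apply/andP; split; lra.
Qed.

Lemma pair_continuousl (b : R) : continuous (fun t : R => (t, b)).
Proof.
move=> t; apply/cvg_ballP => e e0; apply: filterS (nbhsx_ballx t e e0) => u tu.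
by split; [exact: tu|exact: ballxx].
Qed.

Lemma pair_continuousr (b : R) : continuous (fun t : R => (b, t)).
Proof.
move=> t; apply/cvg_ballP => e e0; apply: filterS (nbhsx_ballx t e e0) => u tu.
by split; [exact: ballxx|exact: tu].
Qed.

Lemma integral_derive_eq0 (f f' : R -> R) (N : R) : (forall x : R, is_derive x 1 f (f' x)) ->
  continuous f' -> (forall x : R, ~ x \in `[- N, N] -> f x = 0) ->
  (forall x : R, ~ x \in `[- N, N] -> f' x = 0) ->
  (\int[leb]_x (f' x)%:E = 0)%E.
Proof.
(* [M] is positive whatever the sign of N, and both endpoints -M and M lie where f vanishes. *)
move=> df cf' f0 f'0; pose M : R := `|N| + 1.
have NM : N < M by rewrite (le_lt_trans (ler_norm N))// ltrDl.
have M0 : 0 < M by rewrite (le_lt_trans (normr_ge0 N))// ltrDl.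
have cf : continuous f.
  by move=> x; apply/differentiable_continuous/derivable1_diffP; have [] := df x.
have -> : (\int[leb]_x (f' x)%:E = \int[leb]_(x in `[(- M)%R, M]) (f' x)%:E)%E.
  rewrite [RHS]integral_mkcond; apply: eq_integral => x _; rewrite patchE.
  case: ifPn => // xM; rewrite f'0// => xN; move: xM; rewrite notin_setE/=; apply.
  move: xN; rewrite !in_itv/= => /andP[x1 x2].
  by apply/andP; split; lra.
rewrite (@continuous_FTC2 _ f' f)//.
- rewrite !f0 ?subee// in_itv/=; move/andP => [a1 a2]; lra.
- by lra.
- exact: continuous_subspaceT.
- split; first by move=> x _; have [] := df x.
  + by apply: cvg_at_right_filter; exact: cf.
  + by apply: cvg_at_left_filter; exact: cf.
- by move=> x _; rewrite derive1E; have [_ ->] := df x.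
Qed.

Lemma smooth_slice0 f (b : R) : smooth_on setT f -> forall x : R, is_derive x 1 (fun t => f (t, b)) (partial 0 f (x, b)).
Proof.
move=> sf x; have := @is_derive0P _ f (x, b) (partial 0 f (x, b)); move=> [+ _]; apply.
by apply: derivableP; exact: smooth_on_derivable sf _.
Qed.

Lemma smooth_slice1 f (a : R) : smooth_on setT f -> forall x : R, is_derive x 1 (fun t => f (a, t)) (partial 1 f (a, x)).
Proof.
move=> sf x; have := @is_derive1P _ f (a, x) (partial 1 f (a, x)); move=> [+ _]; apply.
by apply: derivableP; exact: smooth_on_derivable sf _.
Qed.

Lemma test_integrable O psi : test_function O psi -> lam2.-integrable setT (EFin \o psi).
Proof.
move=> tp; have [N _ pN] := test_support tp; exact: integrable_sqint_box (test_sqint tp) pN.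
Qed.

Lemma integral_partial_eq0 (i : 'I_2) O psi : test_function O psi -> \int[lam2]_x partial i psi x = 0.
Proof.
move=> tp; have ip := test_integrable (test_partial i tp).
have [sp _] := tp; have [N _ pN] := test_support tp.
have [N' _ pN'] := test_support (test_partial i tp).
pose M := Num.max N N'.
have HN (x : R * R) : ~ box M x -> psi x = 0 /\ partial i psi x = 0.
  by move=> xM; split; [apply: pN|apply: pN'] => xN; apply: xM; apply: box_le xN;
    rewrite /M le_max lexx ?orbT.
have cs := fun x => smooth_on_continuous (smooth_on_partial i sp) (I : setT x).
rewrite /Rintegral.
have [i0|i1] : i = 0 \/ i = 1.
  by case: i {ip pN' cs HN M} => [[|[|//]] ?]; [left|right]; exact: val_inj.
- subst i; rewrite -(@integral21_prod_meas1 _ _ _ _ _ lebesgue_measure lebesgue_measure _ ip).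
  rewrite (eq_integral (cst 0%E)) ?integral0// => b _.
  apply: (@integral_derive_eq0 (fun t => psi (t, b)) (fun t => partial 0 psi (t, b)) M).
  + exact: smooth_slice0.
  + move=> t; apply: (@continuous_comp _ _ _ (fun t : R => (t, b)) (partial 0 psi)); last exact: cs.
    exact: pair_continuousl.
  + by move=> t tM; have [] := HN (t, b) => //; case.
  + by move=> t tM; have [] := HN (t, b) => //; case.
- subst i; rewrite -(@integral12_prod_meas1 _ _ _ _ _ lebesgue_measure lebesgue_measure _ ip).
  rewrite (eq_integral (cst 0%E)) ?integral0// => b _.
  apply: (@integral_derive_eq0 (fun t => psi (b, t)) (fun t => partial 1 psi (b, t)) M).
  + exact: smooth_slice1.
  + move=> t; apply: (@continuous_comp _ _ _ (fun t : R => (b, t)) (partial 1 psi)); last exact: cs.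
    exact: pair_continuousr.
  + by move=> t tM; have [] := HN (b, t) => //; case.
  + by move=> t tM; have [] := HN (b, t) => //; case.
Qed.

Lemma integral_by_parts i O f psi : smooth_on setT f -> test_function O psi ->
  \int[lam2]_x (f x * partial i psi x) = - \int[lam2]_x (partial i f x * psi x).
Proof.
move=> sf tp; have [sp _] := tp.
have tfp : test_function O (f * psi) by rewrite mulrC; exact: test_smoothM.
have t1 : test_function O (psi * partial i f) by apply: test_smoothM => //; exact: smooth_on_partial.
have t2 : test_function O (partial i psi * f) by apply: test_smoothM => //; exact: test_partial.
have := integral_partial_eq0 i tfp; rewrite partialM// => H.
apply/eqP; rewrite -addr_eq0 addrC -RintegralD//.
- by apply/eqP; rewrite -[RHS]H.
- have := test_integrable t1; apply: eq_integrable => // x _ /=.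
  by congr EFin; rewrite -[LHS]/(psi x * partial i f x) mulrC.
- have := test_integrable t2; apply: eq_integrable => // x _ /=.
  by congr EFin; rewrite -[LHS]/(partial i psi x * f x) mulrC.
Qed.

End IntegrationByParts.

(** * Derivatives of translated kernels and of mollifications *)

Section KernelDerivatives.
Context {R : realType}.
Local Notation lam2 := (@lebesgue_measure R \x @lebesgue_measure R)%E.
Local Notation D1 := (@derive1 R R).

Lemma derive1_parity (f : R -> R) (c : R) : Cboo f -> (forall x, f (- x) = c * f x) ->
  forall x, derive1 f (- x) = - c * derive1 f x.
Proof.
move=> Cf fc x.
have H1 : is_derive x 1 (fun t : R => f (0 + (-1) * t)) (derive1 f (0 + (-1) * x) * -1).
  by apply: is_derive_affine; exact: Cboo_derivable.
have H2 : is_derive x 1 (fun t : R => f (0 + (-1) * t)) (c * derive1 f x).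
  have -> : (fun t : R => f (0 + (-1) * t)) = (fun t => c * f t).
    by apply/funext => t; rewrite add0r mulN1r fc.
  have := @is_deriveZ _ _ _ f c x 1 _ (Cboo_is_derive Cf x).
  by [].
have E := etrans (esym (@derive_val _ _ _ _ _ _ _ H1)) (@derive_val _ _ _ _ _ _ _ H2).
by move: E; rewrite add0r mulN1r mulrN1 => E; rewrite mulNr -E opprK.
Qed.

Lemma derive1n_even (f : R -> R) k : Cboo f -> (forall x, f (- x) = f x) ->
  forall x, iter k D1 f (- x) = (-1) ^+ k * iter k D1 f x.
Proof.
move=> Cf fe; elim: k => [|k IH] x; first by rewrite /= mul1r fe.
rewrite /= (derive1_parity (c := (-1) ^+ k)) ?exprS ?mulN1r//.
exact: Cboo_derive1n.
Qed.

(** Viewing one translated product as [pint] against a Dirac mass makes the smoothness and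
    derivative formulas of [pint] available for it. *)
Lemma pint_dirac (a b : R) g h : Cboo g -> Cboo h ->
  pint (dirac tt) setT (cst a) (cst b) (cst 1) g h =
  fun y : R * R => g (y.1 - a) * h (y.2 - b).
Proof.
move=> Cg Ch; apply/funext => y; rewrite /pint /Rintegral integral_dirac//.
by rewrite diracT mul1e /= mulr1.
Qed.

Let i1 : (@dirac _ unit tt R).-integrable setT (EFin \o cst 1).
Proof.
by apply: finite_measure_integrable_cst.
Qed.

Lemma smooth_kernel (a b : R) g h : Cboo g -> Cboo h ->
  smooth_on setT (fun y : R * R => g (y.1 - a) * h (y.2 - b)).
Proof.
move=> Cg Ch; rewrite -pint_dirac//; apply: pint_smooth => //; exact: measurable_cst.
Qed.

Lemma multi_deriv_kernel k (a b : R) g h : Cboo g -> Cboo h ->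
  multi_deriv k (fun y : R * R => g (y.1 - a) * h (y.2 - b)) =
  fun y : R * R => iter k.1 D1 g (y.1 - a) * iter k.2 D1 h (y.2 - b).
Proof.
move=> Cg Ch; rewrite -pint_dirac// multi_deriv_pint//.
by rewrite pint_dirac//; exact: Cboo_derive1n.
Qed.

Section IBP.
Context d {Y : measurableType d} (mu : {measure set Y -> \bar R}).
Variables (D : set Y) (p1 p2 m : Y -> R).
Hypotheses (mD : measurable D) (mp1 : measurable_fun D p1)
  (mp2 : measurable_fun D p2) (im : mu.-integrable D (EFin \o m)).
Let F := pint mu D p1 p2 m.

Lemma pint_by_parts k O psi g h : Cboo g -> Cboo h -> test_function O psi ->
  \int[lam2]_x (F g h x * multi_deriv k psi x) =
  (-1) ^+ (k.1 + k.2) * \int[lam2]_x (F (iter k.1 D1 g) (iter k.2 D1 h) x * psi x).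
Proof.
case: k => a b /= + + tp; rewrite /multi_deriv/=.
have tb n : test_function O (iter n (partial 1) psi) by elim: n => //= n; exact: test_partial.
have ta n X : test_function O X -> test_function O (iter n (partial 0) X).
  by move=> tX; elim: n => //= n; exact: test_partial.
elim: a g => [|a IH] g Cg Ch.
  elim: b h Ch => [|b IH] h Ch; first by rewrite expr0 mul1r.
  apply: (etrans (integral_by_parts 1 (pint_smooth mD mp1 mp2 im Cg Ch) (tb b))).
  rewrite (partial_pint1 mD mp1 mp2 im)// (IH _ (Cboo_derive1 Ch)) -iterSr.
  by rewrite addnS exprS mulN1r mulNr.
apply: (etrans (integral_by_parts 0 (pint_smooth mD mp1 mp2 im Cg Ch) (ta a _ (tb b)))).
rewrite (partial_pint0 mD mp1 mp2 im)// (IH _ (Cboo_derive1 Cg))// -iterSr.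
by rewrite addSn exprS mulN1r mulNr.
Qed.

End IBP.

Section ConvDerivative.
Variables (e : R) (th Th : R -> R).
Hypothesis mth : mollifier e th Th.
Variables (k : nat * nat) (w V : R * R -> R).
Hypotheses (iw : lam2.-integrable setT (EFin \o w)).
Hypothesis wV : forall psi, smooth_on setT psi ->
  \int[lam2]_x (w x * multi_deriv k psi x) = \int[lam2]_x (V x * psi x).

(** The kernel centered at x is inserted into [wV]; the derivatives of the even function [th] have
    alternating parity, which produces the sign. *)
Lemma pint_conv x : pint lam2 setT fst snd w (iter k.1 D1 th) (iter k.2 D1 th) x =
  (-1) ^+ (k.1 + k.2) * mollify th V x.
Proof.
have Cth := moll_Cboo mth; have te := moll_even mth.
have -> : mollify th V x = \int[lam2]_y (V y * (th (y.1 - x.1) * th (y.2 - x.2))).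
  apply: eq_Rintegral => y _; rewrite mulrC; congr (_ * (_ * _)).
    by rewrite -te opprB.
  by rewrite -te opprB.
rewrite -(wV (smooth_kernel x.1 x.2 Cth Cth)) multi_deriv_kernel//.
have -> : \int[lam2]_y (w y * (iter k.1 D1 th (y.1 - x.1) * iter k.2 D1 th (y.2 - x.2))) =
  (-1) ^+ (k.1 + k.2) * pint lam2 setT fst snd w (iter k.1 D1 th) (iter k.2 D1 th) x.
  rewrite /pint -RintegralZl//; last first.
    by apply: integrable_kernel => //; exact: Cboo_derive1n.
  apply: eq_Rintegral => y _.
  rewrite -(opprB x.1) -(opprB x.2) !(derive1n_even _ Cth te) exprD.
  by move: (iter k.1 D1 th _) (iter k.2 D1 th _) => p q; ring.
by rewrite signrMK.
Qed.

Lemma conv_by_parts O psi : test_function O psi ->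
  \int[lam2]_x (mollify th w x * multi_deriv k psi x) = \int[lam2]_x (mollify th V x * psi x).
Proof.
move=> tp; have Cth := moll_Cboo mth.
pose F := pint lam2 setT fst snd w (iter k.1 D1 th) (iter k.2 D1 th).
have sF : smooth_on setT F.
  by apply: pint_smooth => //; exact: Cboo_derive1n.
apply: (@etrans _ _ ((-1) ^+ (k.1 + k.2) * \int[lam2]_x (F x * psi x))).
  by apply: (@pint_by_parts _ _ lam2 setT fst snd w _ _ _ _ k O psi th th Cth Cth tp).
rewrite -RintegralZl//; last first.
  have := test_integrable (test_smoothM tp sF).
  by apply: eq_integrable => // x _; congr EFin; exact: mulrC.
by apply: eq_Rintegral => x _; rewrite /F pint_conv mulrA signrMK.
Qed.

End ConvDerivative.

End KernelDerivatives.

Section MollifyProduct.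
Context {R : realType}.
Local Notation lam2 := (@lebesgue_measure R \x @lebesgue_measure R)%E.

Lemma eq_sqint d (T : measurableType d) (mu : {measure set T -> \bar R}) (f g : T -> R) :
  (forall x, f x = g x) -> sqint mu f -> sqint mu g.
Proof. by move=> /funext ->. Qed.

Lemma finite_lower_bound (s : nat) (d : nat * nat -> R) (delta : R) : 0 < delta ->
  (forall k, 0 < d k) ->
  exists2 e : R, 0 < e <= delta & forall k, (k.1 + k.2 <= s)%N -> e <= d k.
Proof.
move=> d0 dk.
have N : \forall e \near (0 : R)^'+, forall p : 'I_s.+1 * 'I_s.+1,
    e <= d (nat_of_ord p.1, nat_of_ord p.2).
  by apply: filter_forall => p; exact: nbhs_right_le.
near (0 : R)^'+ => e.
exists e; first by apply/andP; split; near: e; [exact: nbhs_right_gt|exact: nbhs_right_le].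
move=> [a b] /= ab.
have as' : (a < s.+1)%N by rewrite ltnS (leq_trans _ ab)// leq_addr.
have bs : (b < s.+1)%N by rewrite ltnS (leq_trans _ ab)// leq_addl.
have : forall p : 'I_s.+1 * 'I_s.+1, e <= d (nat_of_ord p.1, nat_of_ord p.2) by near: e.
by move=> /(_ (Ordinal as', Ordinal bs)).
Unshelve. all: by end_near. Qed.

Lemma mollify_eq0 (e : R) th Th (V : R * R -> R) (x : R * R) : mollifier e th Th ->
  (forall y, ball x e y -> V y = 0) -> mollify th V x = 0.
Proof.
move=> mth V0; rewrite /mollify /pint /Rintegral integral0_eq// => y _; congr EFin.
 have [y1|y1] := leP e `|x.1 - y.1|; first by rewrite (moll_supp mth y1) !mul0r.
have [y2|y2] := leP e `|x.2 - y.2|; first by rewrite (moll_supp mth y2) mulr0 mul0r.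
by rewrite V0 ?mulr0//; split.
Qed.

(** One radius has to serve the cut-off function and its finitely many derivatives simultaneously.
    The vanishing clause on [G] keeps the errors near the support of [zeta], so that they can later
    be summed locally. *)
Lemma mollify_product (O : set (R * R)) (s : nat) u zeta (eta delta : R) :
  Hs O s u -> test_function O zeta -> 0 < eta -> 0 < delta ->
  let w := fun x => (u \_ O) x * zeta x in
  exists e th Th, [/\ 0 < e <= delta, mollifier e th Th,
    sqint lam2 w /\ lam2.-integrable setT (EFin \o w),
    sqint lam2 (fun x => mollify th w x - w x) /\
      nrm2 lam2 (fun x => mollify th w x - w x) <= eta &
    forall k, (k.1 + k.2 <= s)%N -> exists G, [/\ sqint lam2 G, nrm2 lam2 G <= eta,
      forall x, ball x e `<=` interior [set y | zeta y = 0] -> G x = 0 &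
      forall psi, test_function O psi ->
        \int[lam2]_x ((mollify th w x - w x) * multi_deriv k psi x) =
        (-1) ^+ (k.1 + k.2) * \int[lam2]_x (G x * psi x)]].
Proof.
move=> Hu tz eta0 delta0 w.
(* The derivatives of [zeta] vanish along with it only on an open set, hence the interior. *)
pose U := interior [set y | zeta y = 0].
have oU : open U by exact: open_interior.
have zU x : U x -> zeta x = 0 by move=> /interior_subset.
have [N N0 zN] := test_support tz.
have UN x : ~ box N x -> U x.
  have oB : open (~` box N).
    by apply: closed_openC; apply: compact_closed; [exact: norm_hausdorff|exact: compact_box].
  by move=> xB; apply: filterS (open_nbhs_nbhs (conj oB xB)) => y /=; exact: zN.
have [M M0 zM] := test_bounded tz; have [sz _] := tz.
have su : sqint lam2 (u \_ O) by apply/L2_onP; case: Hu.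
have sw : sqint lam2 w.
  have := sqintM su (smooth_measurable sz) zM.
  by apply: eq_sqint => x; exact: mulrC.
have wN x : ~ box N x -> w x = 0 by move=> xN; rewrite /w zN// mulr0.
have iw := integrable_sqint_box sw wN.
have /choice[V HV] k : exists V, (k.1 + k.2 <= s)%N ->
   [/\ sqint lam2 V, forall x, U x -> V x = 0 & forall psi, smooth_on setT psi ->
    \int[lam2]_x (w x * multi_deriv k psi x) = \int[lam2]_x (V x * psi x)].
  have [ks|ks] := boolP (k.1 + k.2 <= s)%N; last by exists (cst 0).
  have [V [sV VU HV]] := weak_product Hu oU UN ks tz zU.
  exists V => _; split => // psi sp; rewrite -HV//.
  by apply: eq_Rintegral => x _; rewrite /w -mulrA.
have /choice[d Hd] k : exists d : R, 0 < d /\ ((k.1 + k.2 <= s)%N -> forall a b, `|a| <= d -> `|b| <= d ->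
    nrm2 lam2 (fun x => V k (x.1 + a, x.2 + b) - V k x) <= eta).
  have [ks|ks] := boolP (k.1 + k.2 <= s)%N; last by exists 1.
  have [sV _ _] := HV k ks; have [d d0 dH] := sqint_shift_continuous sV eta0.
  by exists d.
have [d' d'0 dH] := sqint_shift_continuous sw eta0.
have m0 : 0 < Num.min d' delta by rewrite lt_min d'0.
have [e /andP[e0 ed] ek] := @finite_lower_bound s d (Num.min d' delta) m0 (fun k => proj1 (Hd k)).
move: ed; rewrite le_min => /andP[ed' edelta].
have [th [Th mth]] := mollifier_exists e0.
have Cth := moll_Cboo mth.
have H0 := nrm2_conv mth (ltW eta0) sw iw (fun a b ha hb => dH a b (le_trans ha ed') (le_trans hb ed')).
exists e, th, Th; split => //; first by rewrite e0.
move=> k ks; have [sV VU Vp] := HV k ks; have [_ dk] := Hd k.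
have VN x : ~ box N x -> V k x = 0 by move=> xN; apply: VU; exact: UN.
have iV := integrable_sqint_box sV VN.
have [sG nG] := nrm2_conv mth (ltW eta0) sV iV
  (fun a b ha hb => dk ks a b (le_trans ha (ek k ks)) (le_trans hb (ek k ks))).
(* The sign converts the unsigned convention of [represents] into that of [weak_deriv_of]. *)
exists (fun x => (-1) ^+ (k.1 + k.2) * (mollify th (V k) x - V k x)); split.
- exact: sqintZ.
- by rewrite nrm2Z// -exprM mulnC exprM sqrrN !expr1n mul1r.
- move=> x xU; rewrite (mollify_eq0 mth); last by move=> y /xU /VU.
  by rewrite VU ?subrr ?mulr0//; apply: xU; exact: ballxx.
- move=> psi tp; have [sp _] := tp; have spsi := test_sqint tp.
  have smp := test_sqint (test_multi k tp).
  have sVpsi : sqint lam2 (mollify th (V k)).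
    by apply: eq_sqint (sqintD sG sV) => x; rewrite subrK.
  have smw : sqint lam2 (mollify th w).
    by apply: eq_sqint (sqintD H0.1 sw) => x; rewrite subrK.
  have -> : \int[lam2]_x ((mollify th w x - w x) * multi_deriv k psi x) =
    \int[lam2]_x (mollify th w x * multi_deriv k psi x) - \int[lam2]_x (w x * multi_deriv k psi x).
    rewrite -RintegralB//; [|exact: integrable_fctM..].
    by apply: eq_Rintegral => x _; rewrite mulrBl.
  rewrite (conv_by_parts mth iw Vp tp) Vp// -RintegralB//; [|exact: integrable_fctM..].
  rewrite -RintegralZl//; last first.
    by apply: (integrable_fctM _ spsi); exact: sqintZ.
  by apply: eq_Rintegral => x _; rewrite mulrA signrMK mulrBl.
Qed.

End MollifyProduct.

(** * Exhaustion by compact sets and uniqueness of weak derivatives *)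

Section Exhaustion.
Context {R : realType}.
Local Notation lam2 := (@lebesgue_measure R \x @lebesgue_measure R)%E.
Implicit Types (O : set (R * R)).

(** Points of the n-th box at distance at least 2^-n from the complement of O. Halving the margin at
    each step leaves 2^-(n+1) to move from one set into the next. *)
Definition exhaustion O (n : nat) : set (R * R) :=
  [set x | box n%:R x /\ ball x (2^-1 ^+ n : R) `<=` O].

Let rad_gt0 n : 0 < (2^-1 : R) ^+ n.
Proof. by rewrite exprn_gt0// invr_gt0. Qed.

Let rad_half n : (2^-1 : R) ^+ n = 2^-1 ^+ n.+1 + 2^-1 ^+ n.+1.
Proof. by rewrite exprS; field. Qed.

Lemma exhaustion_compact O n : compact (exhaustion O n).
Proof.
apply: (@subclosed_compact _ _ (box n%:R)); last by move=> x [].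
- rewrite (_ : exhaustion O n =
    box n%:R `&` ~` \bigcup_(y in ~` O) ball y (2^-1 ^+ n : R)).
    apply: closedI.
      by apply: compact_closed; [exact: norm_hausdorff|exact: compact_box].
    by apply: open_closedC; apply: bigcup_open => y _; exact: ball_open.
  apply/seteqP; split => x [xb H]; split => //.
    by move=> [y yO /ball_sym/H].
  move=> y xy; apply: contrapT => yO; apply: H; exists y => //; exact: ball_sym.
- exact: compact_box.
Qed.

Lemma exhaustion_sub O n : exhaustion O n `<=` O.
Proof. by move=> x [_]; apply; exact: ballxx. Qed.

Lemma exhaustion_step O n (x z : R * R) : exhaustion O n x -> ball x (2^-1 ^+ n.+1 : R) z ->
  exhaustion O n.+1 z.
Proof.
move=> [[/= xb1 xb2] xO] xz; split; last first.
  by move=> y zy; apply: xO; rewrite rad_half; exact: ball_triangle zy.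
have [z1 z2] := xz; have h1 : (2^-1 : R) ^+ n.+1 <= 1.
  by rewrite exprn_ile1 ?invr_ge0 ?ler0n// invf_le1 ?ler1n ?ltr0n.
move: xb1 xb2; rewrite !in_itv/= => /andP[a1 a2] /andP[a3 a4].
move: z1 z2; rewrite /ball/= !ltr_distl => /andP[b1 b2] /andP[b3 b4].
by split => /=; rewrite in_itv/= -natr1; apply/andP; split; lra.
Qed.

Lemma exhaustion_mono O m n : (m <= n)%N -> exhaustion O m `<=` exhaustion O n.
Proof.
move=> /subnK <-; elim: (n - m)%N => [//|k IH] x /IH xk.
by apply: (exhaustion_step xk); exact: ballxx.
Qed.

Lemma exhaustion_cover O x : open O -> O x -> exists n, exhaustion O n x.
Proof.
move=> oO Ox; have /nbhs_ballP[r /= r0 rO] := open_nbhs_nbhs (conj oO Ox).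
near \oo => n; exists n; split.
  have [B1 B2] : `|x.1| <= n%:R /\ `|x.2| <= n%:R.
    by split; near: n; exact: nbhs_infty_ger.
  by split => /=; rewrite in_itv/= -ler_norml.
apply: subset_trans rO; apply: le_ball.
have : `|(2^-1 : R) ^+ n| < r.
  near: n; have := @cvg_expr R 2^-1 _.
  rewrite ger0_norm ?invr_ge0// invf_lt1// ltr1n => /(_ erefl)/cvgr0Pnorm_lt; exact.
by rewrite ger0_norm ?exprn_ge0 ?invr_ge0// => /ltW.
Unshelve. all: by end_near. Qed.

Lemma integral_kernelE (e : R) th Th (x : R * R) : mollifier e th Th ->
  (\int[lam2]_y (th (x.1 - y.1) * th (x.2 - y.2))%:E = 1)%E.
Proof.
move=> mth; under eq_integral do rewrite EFinM.
have mt (a : R) : measurable_fun setT (fun t : R => (th (a - t))%:E).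
  by apply/measurable_EFinP; apply: (measurableT_comp (measurable_moll mth)); exact: measurable_funB.
rewrite (integral2_prod (mt x.1) (mt x.2)); last 2 first.
- by move=> t; rewrite lee_fin (moll_ge0 mth).
- by move=> t; rewrite lee_fin (moll_ge0 mth).
by rewrite !(integral_moll_shift mth) mule1.
Qed.

Lemma integral_kernel1 (e : R) th Th x : mollifier e th Th ->
  \int[lam2]_y (th (x.1 - y.1) * th (x.2 - y.2)) = 1.
Proof. by move=> mth; rewrite /Rintegral (integral_kernelE _ mth). Qed.

(** The indicator of the set of index n+1 is mollified at radius 2^-(n+2): around a point of the
    n-th set the kernel sees only the value 1, around a point outside the set of index n+2 only the
    value 0. *)
Lemma cutoff_exists O n : exists eta, [/\ test_function O eta,
  forall x, exhaustion O n x -> eta x = 1 & forall x, ~ exhaustion O n.+2 x -> eta x = 0].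
Proof.
have [th [Th mth]] := mollifier_exists (rad_gt0 n.+2).
have Cth := moll_Cboo mth.
pose K := exhaustion O n.+1.
have mK : measurable K.
  by apply: closed_measurable2; apply: compact_closed; [exact: norm_hausdorff|exact: exhaustion_compact].
have KB : K `<=` box n.+1%:R by move=> x [].
have [sK _] := sqint_indic mK (leb2_sub_box mK KB).
have iK : lam2.-integrable setT (EFin \o (\1_K : R * R -> R)).
  apply: (@integrable_sqint_box _ _ n.+1%:R sK) => x xB; rewrite indicE memNset//.
  by move/KB.
pose eta := mollify th (\1_K : R * R -> R).
have eta0 x : ~ exhaustion O n.+2 x -> eta x = 0.
  move=> xK; apply: (mollify_eq0 mth) => y xy; rewrite indicE memNset// => Ky.
  by apply: xK; apply: (exhaustion_step Ky); exact: ball_sym.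
exists eta; split => //.
- split; first exact: pint_smooth.
  exists (exhaustion O n.+2); split => //; first exact: exhaustion_compact.
  exact: exhaustion_sub.
- move=> x xK; rewrite -(integral_kernel1 x mth); apply: eq_Rintegral => y _.
  have [y1|y1] := leP (2^-1 ^+ n.+2) `|x.1 - y.1|; first by rewrite (moll_supp mth y1) !mul0r.
  have [y2|y2] := leP (2^-1 ^+ n.+2) `|x.2 - y.2|; first by rewrite (moll_supp mth y2) mulr0 mul0r.
  rewrite indicE mem_set ?mulr1//; apply: (exhaustion_step xK).
  apply: (@le_ball _ _ _ (2^-1 ^+ n.+2)); last by split.
  by rewrite (rad_half n.+1) lerDl ltW.
Qed.

(** A mollification of v times a cutoff is, at each point, the integral of v against a cutoff times
    a translated kernel, which is a test function; so it vanishes. Letting the radius shrink, v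
    times every cutoff of the exhaustion is 0 in L2. *)
Lemma weak_unique O v : open O -> L2_on O v ->
  (forall psi, test_function O psi -> \int[leb2]_(x in O) (v x * psi x) = 0) ->
  {ae lam2, forall x, (v \_ O) x = 0}.
Proof.
move=> oO Lv Hv.
(* Regarding v as an element of H^0 makes [mollify_product] applicable. *)
have Hs0 : Hs O 0 v.
  split => // -[[|//] [|//]] _; exists v; split => // psi _.
  by rewrite /= mul1r.
have /choice[eta Heta] n := cutoff_exists O n.
pose w n x := (v \_ O) x * eta n x.
have sw n : sqint lam2 (w n).
  have [tn _ _] := Heta n.
  by have [e [th [Th [_ _ [sw _] _ _]]]] := mollify_product Hs0 tn ltr01 ltr01.
have w0 n : nrm2 lam2 (w n) = 0.
  have [tn _ _] := Heta n.
  apply/eqP; rewrite eq_le nrm2_ge0 andbT; apply/ler_addgt0Pl => c c0; rewrite addr0.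
  have [e [th [Th [_ mth _ [_ +] _]]]] := mollify_product Hs0 tn c0 ltr01.
  have Cth := moll_Cboo mth; have te := moll_even mth.
  have E x : mollify th (w n) x = 0.
    have := Hv _ (test_smoothM tn (smooth_kernel x.1 x.2 Cth Cth)); rewrite int_on => <-.
    apply: eq_Rintegral => y _.
    rewrite -(opprB y.1) -(opprB y.2) !te mulrC /w.
    by rewrite -[LHS]mulrA.
  apply: le_trans; rewrite le_eqVlt; apply/orP; left; apply/eqP.
  by apply: eq_Rintegral => x _; rewrite -/(w n x) -/(w n) E sub0r sqrrN.
have H : {ae lam2, forall x, forall n, w n x = 0}.
  by apply/ae_foralln => n; exact: nrm2_eq0_ae.
apply: (@filterS _ _ (ae_filter_ringOfSetsType lam2) _ _ _ H) => x wx; have [Ox|Ox] := pselect (O x); last first.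
  by rewrite patchE memNset.
have [n xn] := exhaustion_cover oO Ox; have [_ eta1 _] := Heta n.
by have := wx n; rewrite /w eta1// mulr1.
Qed.

End Exhaustion.

(** * Density of smooth functions *)

Section Glue.
Context {R : realType}.
Local Notation lam2 := (@lebesgue_measure R \x @lebesgue_measure R)%E.
Variable O : set (R * R).
Hypothesis oO : open O.

(** An arbitrary index, not the least one; [lfsumE] shows that the choice is immaterial. *)
Let level (x : R * R) : nat := xget 0%N [set m | exhaustion O m x].

(* A locally finite infinite sum: on the m-th set of the exhaustion the terms of
   index at least m + 3 are meant to vanish.  Junk value off [O]. *)
Definition lfsum (F : nat -> R * R -> R) (x : R * R) : R :=
  \sum_(j < (level x).+3) F j x.

Section Locally.
Variable F : nat -> R * R -> R.
Hypothesis F0 : forall j m x, exhaustion O m x -> (m.+3 <= j)%N -> F j x = 0.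

Lemma lfsumE m n x : exhaustion O m x -> (m.+3 <= n)%N -> lfsum F x = \sum_(j < n) F j x.
Proof.
have H m1 m2 : exhaustion O m1 x -> (m1.+3 <= m2)%N ->
    \sum_(j < m2) F j x = \sum_(j < m1.+3) F j x.
  move=> xm1 m12; rewrite (big_ord_widen m2 (fun j => F j x) m12) [RHS]big_mkcond/=.
  by apply: eq_bigr => j _; case: ltnP => // /(F0 xm1).
move=> xm mn; have xl : exhaustion O (level x) x by apply: (@xgetPex _ 0%N [set m | exhaustion O m x]); exists m.
rewrite /lfsum -(H _ (maxn (level x).+3 m.+3) xl) ?leq_maxl//.
by rewrite (H _ _ xm) ?leq_maxr// (H _ _ xm).
Qed.

Lemma lfsum_cvg x : O x -> (\sum_(j < n) F j x) @[n --> \oo] --> lfsum F x.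
Proof.
move=> Ox; have [m xm] := exhaustion_cover oO Ox.
apply: cvg_near_cst; near=> n; rewrite (lfsumE xm (n := n))//.
by near: n; exact: nbhs_infty_ge.
Unshelve. all: by end_near. Qed.

Lemma measurable_lfsum : (forall j, measurable_fun setT (F j)) ->
  measurable_fun setT (lfsum F \_ O).
Proof.
move=> mF; have mO : measurable O by exact: open_measurable2.
apply: (@measurable_fun_cvg _ _ _ _ (fun n => (fun x => \sum_(j < n) F j x) \_ O)).
  move=> n; apply/(measurable_restrictT _ mO); apply: measurable_funTS.
  exact: measurable_sum.
move=> x _; rewrite patchE; have [Ox|Ox] := pselect (O x).
  rewrite mem_set//; have := lfsum_cvg Ox.
  by apply: cvg_trans; apply: near_eq_cvg; near=> n; rewrite patchE mem_set.
rewrite memNset//; apply: cvg_near_cst; near=> n; by rewrite patchE memNset.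
Unshelve. all: by end_near. Qed.

(** Cauchy-Schwarz with weights 2^-(j+1), whose sum is at most 1, so that the bound does not depend
    on the number of terms. *)
Lemma sqr_sum_le n (a : nat -> R) :
  (\sum_(j < n) a j) ^+ 2 <= \sum_(j < n) 2 ^+ j.+1 * a j ^+ 2.
Proof.
elim: n a => [|n IH] a; first by rewrite !big_ord0 expr0n.
rewrite !big_ord_recl/=.
have := IH (fun j => a j.+1).
set A := \sum_(j < n) a j.+1; set B := \sum_(j < n) _ => AB.
have -> : \sum_(i < n) 2 ^+ (bump 0 i).+1 * a (bump 0 i) ^+ 2 = 2 * B.
  by rewrite mulr_sumr; apply: eq_bigr => j _; rewrite mulrA -exprS.
by rewrite expr1; have := sqr_ge0 (a 0%N - A); nra.
Qed.

(** The decay 4^-(j+1) absorbs the weights 2^(j+1) of [sqr_sum_le] and leaves a geometric series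
    with sum at most [eta]. A bound uniform in the number of terms is needed, as that number is
    unbounded over O. *)
Lemma lfsum_sqint (eta : R) : 0 <= eta -> (forall j, sqint lam2 (F j)) ->
  (forall j, nrm2 lam2 (F j) <= eta * 4^-1 ^+ j.+1) ->
  sqint lam2 (lfsum F \_ O) /\ nrm2 lam2 (lfsum F \_ O) <= eta.
Proof.
move=> eta0 sF nF; apply: (@sqint_le _ _ _ lam2).
  by apply: measurable_lfsum => j; case: (sF j).
pose f j x : \bar R := (2 ^+ j.+1 * F j x ^+ 2)%:E.
have f0 j x : (0 <= f j x)%E by rewrite lee_fin; apply: mulr_ge0; [exact: exprn_ge0|exact: sqr_ge0].
have mf j : measurable_fun setT (f j).
  apply/measurable_EFinP; apply: measurable_funM => //; apply: measurable_funX.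
  by case: (sF j).
apply: (@le_trans _ _ (\int[lam2]_x (\sum_(0 <= j <oo) f j x))%E).
  apply: ge0_le_integral => //.
  - by move=> x _; rewrite lee_fin sqr_ge0.
  - apply/measurable_EFinP; apply: measurable_funX.
    by apply: measurable_lfsum => j; case: (sF j).
  - have := @ge0_emeasurable_sum _ _ R setT f xpredT; apply => //.
  move=> x _; rewrite patchE; case: ifPn => xO; last first.
    by rewrite expr0n/=; apply: nneseries_ge0.
  apply: (@le_trans _ _ (\sum_(0 <= j < (level x).+3) f j x)%E); last first.
    by apply: nneseries_lim_ge.
  by rewrite big_mkord /f sumEFin lee_fin /lfsum; exact: (@sqr_sum_le _ (F^~ x)).
rewrite integral_nneseries//.
apply: lime_le.
  by apply: is_cvg_nneseries => n _ _; exact: integral_ge0.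
near=> n.
have E j : (\int[lam2]_x f j x = (2 ^+ j.+1 * nrm2 lam2 (F j))%:E)%E.
  rewrite /f; under eq_integral do rewrite EFinM.
  rewrite ge0_integralZl//.
  - by rewrite (nrm2E (sF j)).
  - by apply/measurable_EFinP; apply: measurable_funX; case: (sF j).
  - by move=> x _; rewrite lee_fin sqr_ge0.
apply: (@le_trans _ _ ((\sum_(0 <= j < n) 2 ^+ j.+1 * nrm2 lam2 (F j))%:E)).
  by rewrite -sumEFin le_eqVlt; apply/orP; left; apply/eqP; apply: eq_bigr => j _; exact: E.
rewrite lee_fin big_mkord.
apply: (@le_trans _ _ (\sum_(j < n) eta * 2^-1 ^+ j.+1)).
  apply: ler_sum => j _; apply: (le_trans (ler_wpM2l _ (nF j))); first exact: exprn_ge0.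
  rewrite mulrCA -exprMn; rewrite (_ : 2 * 4^-1 = 2^-1 :> R)//; by field.
rewrite -mulr_sumr ler_piMr//.
have -> : \sum_(i < n) (2^-1 : R) ^+ i.+1 = 1 - 2^-1 ^+ n.
  elim: (n) => [|p IH]; first by rewrite big_ord0 expr0 subrr.
  by rewrite big_ord_recr/= IH [in LHS]exprS [in RHS]exprS; field.
by rewrite gerBl exprn_ge0// invr_ge0.
Unshelve. all: by end_near. Qed.

End Locally.
End Glue.

Section MeyersSerrin.
Context {R : realType}.
Local Notation lam2 := (@lebesgue_measure R \x @lebesgue_measure R)%E.
Variables (O : set (R * R)) (s : nat) (u : R * R -> R).
Hypotheses (oO : open O) (Hu : Hs O s u).

Let h (n : nat) : R := 2^-1 ^+ n.

Let h_le m n : (m <= n)%N -> h n <= h m.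
Proof.
move=> mn; rewrite /h ler_wiXn2l// ?invr_ge0// invf_le1 ?ler1n ?ltr0n//.
Qed.

Let h_gt0 n : 0 < h n. Proof. by rewrite exprn_gt0// invr_gt0. Qed.

Lemma multi_deriv_eq0 k (f : R * R -> R) (U : set (R * R)) : open U ->
  (forall x, U x -> f x = 0) -> forall x, U x -> multi_deriv k f x = 0.
Proof.
move=> oU f0; have it i n g : (forall x, U x -> g x = 0) ->
    forall x, U x -> iter n (partial i) g x = 0.
  by move=> g0; elim: n => [//|n IH] x Ux /=; exact: (partial_eq0 i oU IH).
by apply: (it); exact: it.
Qed.

Lemma Rintegral_sum n (F : nat -> R * R -> R) :
  (forall j, lam2.-integrable setT (EFin \o F j)) ->
  \int[lam2]_x (\sum_(j < n) F j x) = \sum_(j < n) \int[lam2]_x F j x.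
Proof.
move=> iF; have iS m : lam2.-integrable setT (EFin \o (fun x => \sum_(j < m) F j x)).
  elim: m => [|m IH].
    by apply: (eq_integrable _ (cst 0%E)) (integrable0 _ _) => // x _; rewrite /= big_ord0.
  by apply: eq_integrable (integrableD measurableT IH (iF m)) => // x _; rewrite /= big_ord_recr.
elim: n => [|n IH].
  rewrite big_ord0 /Rintegral integral0_eq// => x _; by rewrite big_ord0.
rewrite big_ord_recr/= -IH -RintegralD//.
by apply: eq_Rintegral => x _; rewrite big_ord_recr.
Qed.

Lemma exhaustion_ball m n (x y : R * R) (e : R) : exhaustion O m x -> (m < n)%N -> e <= h n ->
  ball x e y -> exhaustion O m.+1 y.
Proof.
move=> xm mn en xy; apply: (exhaustion_step xm); apply: le_ball xy.
exact: (le_trans en (h_le mn)).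
Qed.

(** Differences of consecutive cutoffs: the partial sums telescope to a cutoff, and on the m-th set
    two cutoffs of index at least m are both 1, so their difference vanishes. *)
Lemma partition_exists : exists zeta : nat -> R * R -> R,
  [/\ forall j, test_function O (zeta j),
      forall j m x, exhaustion O m x -> (m < j)%N -> zeta j x = 0 &
      forall n m x, exhaustion O m x -> (m < n)%N -> \sum_(j < n) zeta j x = 1].
Proof.
have /choice[eta Heta] n := cutoff_exists O n.
pose zeta j := if j is i.+1 then eta i.+1 - eta i else eta 0%N.
have eta1 n m x : exhaustion O m x -> (m <= n)%N -> eta n x = 1.
  by move=> xm mn; have [_ + _] := Heta n; apply; exact: exhaustion_mono xm.
have zs n x : \sum_(j < n.+1) zeta j x = eta n x.
  elim: n => [|n IH]; first by rewrite big_ord1.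
  by rewrite big_ord_recr/= IH addrC subrK.
exists zeta; split.
- case=> [|j]; first by have [] := Heta 0%N.
  have [[s1 _] _ z1] := Heta j.+1; have [[s2 _] _ z2] := Heta j.
  split; first exact: smooth_on_subf.
  exists (exhaustion O j.+3); split; [exact: exhaustion_compact|exact: exhaustion_sub|].
  move=> x xK; rewrite -[LHS]/(eta j.+1 x - eta j x) z1// z2 ?subrr// => xj.
  by apply: xK; exact: exhaustion_mono xj.
- case=> [//|j] m x xm mj; rewrite -[LHS]/(eta j.+1 x - eta j x).
  by rewrite !(eta1 _ m)// ?subrr// ltnW.
- by case=> [//|n] m x xm mn; rewrite zs (eta1 _ m).
Qed.

Lemma compact_sub_exhaustion K : compact K -> K `<=` O -> exists m, K `<=` exhaustion O m.
Proof.
move=> cK KO; have [N N0 KN] := compact_sub_box cK.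
have [e e0 Ke] := compact_margin cK oO KO.
near \oo => n; exists n => x Kx; split.
  by apply: (@box_le _ N); [near: n; exact: nbhs_infty_ger|exact: KN].
have he : h n <= e.
  have : `|h n| < e.
    near: n; have := @cvg_expr R 2^-1 _.
    by rewrite ger0_norm ?invr_ge0// invf_lt1// ltr1n => /(_ erefl)/cvgr0Pnorm_lt; exact.
  by rewrite (ger0_norm (ltW (h_gt0 n))) => /ltW.
by move=> y /(le_ball he); exact: Ke.
Unshelve. all: by end_near. Qed.

(** Each piece [zeta j] u is mollified at a radius of at most 2^-j, with squared errors at most
    [eta] 4^-(j+1) in all orders, and the results are summed. Near any point of O only finitely many
    pieces contribute, so the sum is smooth even though nothing is known near the boundary. *)
Theorem meyers_serrin (eta : R) : 0 < eta -> exists beta, [/\ smooth_on O beta,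
  L2_on O (fun x => beta x - u x) &
  forall k, (k.1 + k.2 <= s)%N -> exists V, [/\ L2_on O V,
    weak_deriv_of O k (fun x => beta x - u x) V & nrm2 lam2 (V \_ O) <= eta]].
Proof.
move=> eta0; have [zeta [tz z0 z1]] := partition_exists.
pose w j := (fun x => (u \_ O) x * zeta j x) : R * R -> R.
pose c j : R := eta * 4^-1 ^+ j.+1.
have c0 j : 0 < c j by rewrite mulr_gt0// exprn_gt0// invr_gt0.
(* The offset [m.+3] counts two steps in the exhaustion, one for the mollification radius and one
   for the neighborhood on which [zeta j] must vanish, followed by a strict inequality of
   indices. *)
have /choice[b Hb] j : exists b, [/\ smooth_on setT b,
  forall m x, exhaustion O m x -> (m.+3 <= j)%N -> b x = 0,
  sqint lam2 (fun x => b x - w j x) /\ nrm2 lam2 (fun x => b x - w j x) <= c j &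
  forall k, (k.1 + k.2 <= s)%N -> exists G, [/\ sqint lam2 G, nrm2 lam2 G <= c j,
    forall m x, exhaustion O m x -> (m.+3 <= j)%N -> G x = 0 &
    forall psi, test_function O psi ->
        \int[lam2]_x ((b x - w j x) * multi_deriv k psi x) =
        (-1) ^+ (k.1 + k.2) * \int[lam2]_x (G x * psi x)]].
  have [e [th [Th [/andP[e0 ej] mth [sw iw] [sb nb] HG]]]] :=
    mollify_product Hu (tz j) (c0 j) (h_gt0 j).
  exists (mollify th (w j)); split => //.
  - apply: pint_smooth => //; exact: (moll_Cboo mth).
  - move=> m x xm mj; apply: (mollify_eq0 mth) => y xy.
    rewrite /w (z0 j m.+1) ?mulr0//; last exact: ltnW.
    by apply: (exhaustion_ball xm _ ej xy); exact: ltnW (ltnW mj).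
  - move=> k ks; have [G [sG nG G0 HkG]] := HG k ks; exists G; split => //.
    move=> m x xm mj; apply: G0 => y xy.
    have ym : exhaustion O m.+1 y by apply: (exhaustion_ball xm _ ej xy); exact: ltnW (ltnW mj).
    apply/nbhs_ballP; exists (h j) => //= z yz.
    by apply: (z0 j m.+2) => //; apply: (exhaustion_ball ym _ (lexx _) yz); exact: ltnW.
have b0 j m x : exhaustion O m x -> (m.+3 <= j)%N -> b j x = 0.
  by have [_ + _ _] := Hb j; apply.
pose F j x := b j x - w j x.
have F0 j m x : exhaustion O m x -> (m.+3 <= j)%N -> F j x = 0.
  move=> xm mj; rewrite /F (b0 j m)// /w (z0 j m) ?mulr0 ?subrr//.
  exact: ltnW (ltnW mj).
pose beta := lfsum O b.
have betaE x : O x -> beta x - u x = lfsum O F x.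
  move=> Ox; have [m xm] := exhaustion_cover oO Ox.
  rewrite /beta !(lfsumE _ xm (leqnn _))// /F sumrB; congr (_ - _).
  rewrite /w -mulr_sumr (z1 _ m) ?mulr1//; last exact: ltnW.
  by rewrite patchE mem_set.
have betaO : (fun x => beta x - u x) \_ O = lfsum O F \_ O.
  by apply/funext => x; rewrite !patchE; case: ifPn => // /set_mem /betaE.
have sF j : sqint lam2 (F j) by have [_ _ []] := Hb j.
have nF j : nrm2 lam2 (F j) <= c j by have [_ _ []] := Hb j.
exists beta; split.
- move=> n; apply: Cn_on_local => x Ox; have [m xm] := exhaustion_cover oO Ox.
  exists (ball x (h m.+1)); split; [exact: ball_open|exact: ballxx|].
  exists (fun x => \sum_(j < m.+4) b j x).
    move=> y xy; apply: (@lfsumE _ _ _ b0 m.+1) => //.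
    exact: exhaustion_step xy.
  have sS p : smooth_on setT (fun x => \sum_(j < p) b j x).
    elim: p => [|p IH].
      rewrite (_ : (fun x => _) = cst 0); first exact: smooth_on_cst.
      by apply/funext => y; rewrite big_ord0.
    rewrite (_ : (fun x => _) = (fun x => \sum_(j < p) b j x) + b p).
      by apply: smooth_onD => //; [exact: openT|have [] := Hb p].
    by apply/funext => y; rewrite big_ord_recr.
  exact: Cn_onS (@subsetT _ _) (sS _ n).
- apply/L2_onP; rewrite betaO.
  by have [] := lfsum_sqint oO F0 (ltW eta0) sF nF.
- move=> k ks.
  have /choice[G HG] j : exists G, [/\ sqint lam2 G, nrm2 lam2 G <= c j,
    forall m x, exhaustion O m x -> (m.+3 <= j)%N -> G x = 0 &
    forall psi, test_function O psi ->
        \int[lam2]_x (F j x * multi_deriv k psi x) =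
        (-1) ^+ (k.1 + k.2) * \int[lam2]_x (G x * psi x)].
    by have [_ _ _ /(_ k ks)] := Hb j.
  have G0 j m x : exhaustion O m x -> (m.+3 <= j)%N -> G j x = 0.
    by have [_ _ + _] := HG j; apply.
  have sG j : sqint lam2 (G j) by have [] := HG j.
  have nG j : nrm2 lam2 (G j) <= c j by have [] := HG j.
  have [sV nV] := lfsum_sqint oO G0 (ltW eta0) sG nG.
  exists (lfsum O G); split => //; first by apply/L2_onP.
  move=> psi tp; rewrite (int_on O (fun x => beta x - u x)) (int_on O (lfsum O G)) betaO.
  have tkp := test_multi k tp.
  have [_ [K [cK KO p0]]] := tp; have [m Km] := compact_sub_exhaustion cK KO.
  (* On the support of a test function the sum has a fixed finite number of terms, so it can be
     integrated term by term. *)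
  have loc (H : nat -> R * R -> R) X : (forall j m x, exhaustion O m x -> (m.+3 <= j)%N -> H j x = 0) ->
      (forall j, sqint lam2 (H j)) -> test_function O X -> (forall x, ~ K x -> X x = 0) ->
      \int[lam2]_x ((lfsum O H \_ O) x * X x) = \sum_(j < m.+3) \int[lam2]_x (H j x * X x).
    move=> H0 sH tX X0.
    transitivity (\int[lam2]_x (\sum_(j < m.+3) (H j x * X x))).
      apply: eq_Rintegral => x _; have [Kx|Kx] := pselect (K x); last first.
        by rewrite X0// mulr0 big1// => j _; rewrite mulr0.
      rewrite patchE mem_set; last exact: KO.
      by rewrite (lfsumE H0 (Km _ Kx) (leqnn _)) mulr_suml.
    rewrite (Rintegral_sum _ (F := fun j x => H j x * X x))//.
    by move=> j; apply: integrable_fctM => //; exact: test_sqint tX.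
  have tz0 x : ~ K x -> multi_deriv k psi x = 0.
    apply: (@multi_deriv_eq0 k psi (~` K)) => //.
    by apply: closed_openC; apply: compact_closed => //; exact: norm_hausdorff.
  rewrite (loc F)// (loc G)// mulr_sumr; apply: eq_bigr => j _.
  by have [_ _ _] := HG j; apply.
Qed.

End MeyersSerrin.

(** * The trace inequality *)

Section CurveKernel.
Context {R : realType}.
Local Notation lam2 := (@lebesgue_measure R \x @lebesgue_measure R)%E.
Variables (p q m : R -> R) (L T : R).
Hypotheses (cp : continuous p) (cq : continuous q) (mm : measurable_fun setT m)
  (mL : forall t, `|m t| <= L) (T0 : 0 < T).
Let D : set R := `[0, T]%classic.

Let L0 : 0 <= L. Proof. exact: le_trans (normr_ge0 _) (mL 0). Qed.
Let mp : measurable_fun setT p. Proof. exact: continuous_measurable_fun. Qed.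
Let mq : measurable_fun setT q. Proof. exact: continuous_measurable_fun. Qed.
Let mD : measurable D. Proof. exact: measurable_itv. Qed.
Let im : leb.-integrable D (EFin \o m). Proof. exact: bounded_integrable_itv mm mL. Qed.

(** Smearing the curve and testing with c amounts to smearing c and integrating along the curve.
    Fubini applies because the kernel and m are bounded and the parameter interval is finite. *)
Lemma fubini_pint (c : R * R -> R) g h : lam2.-integrable setT (EFin \o c) -> Cboo g -> Cboo h ->
  \int[lam2]_x (c x * pint leb D p q m g h x) =
  \int[leb]_(t in D) (m t * \int[lam2]_x (c x * (g (x.1 - p t) * h (x.2 - q t)))).
Proof.
move=> ic Cg Ch; have [Mg Mg0 gM] := Cboo_bounded Cg; have [Mh Mh0 hM] := Cboo_bounded Ch.
have mc : measurable_fun setT c by case/integrableP : ic => /measurable_EFinP.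
have mg := Cboo_measurable Cg; have mh := Cboo_measurable Ch.
pose mT := m \_ D.
have mmT : measurable_fun setT mT.
  by apply/(measurable_restrictT _ mD); exact: measurable_funTS.
have mTL t : `|mT t| <= L * \1_D t.
  rewrite /mT patchE indicE; case: ifPn => tD; first by rewrite mulr1.
  by rewrite normr0 mulr0.
pose f (z : (R * R) * R) : \bar R :=
  (c z.1 * (g (z.1.1 - p z.2) * h (z.1.2 - q z.2)) * mT z.2)%:E.
have mf : measurable_fun setT f.
  apply/measurable_EFinP; apply: measurable_funM; last first.
    exact: (measurableT_comp mmT measurable_snd).
  apply: measurable_funM; first exact: (measurableT_comp mc measurable_fst).
  apply: measurable_funM.
    apply: (measurableT_comp mg); apply: measurable_funB.
      exact: (measurableT_comp measurable_fst measurable_fst).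
    exact: (measurableT_comp mp measurable_snd).
  apply: (measurableT_comp mh); apply: measurable_funB.
    exact: (measurableT_comp measurable_snd measurable_fst).
  exact: (measurableT_comp mq measurable_snd).
have M0 : 0 <= Mg * Mh * L by rewrite !mulr_ge0.
have lebD : leb D = T%:E.
  by rewrite /D /= lebesgue_measure_itv/= lte_fin T0 sube0.
have intf : (leb2sf \x @lebesgue_measure R)%E.-integrable setT f.
  apply/(@integrable12ltyP _ _ _ _ _ leb2sf lebesgue_measure) => //.
  apply: (@le_lt_trans _ _ (\int[lam2]_x (`|c x| * (Mg * Mh * L * T))%:E)%E); last first.
    have ic' : lam2.-integrable setT (EFin \o (fun x => (Mg * Mh * L * T) * c x)).
      exact: (integrableZl measurableT _ ic).
    have /integrableP[_] := ic'; congr (_ < _)%E; apply: eq_integral => x _ /=.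
    by rewrite normrM mulrC (ger0_norm (x := Mg * Mh * L * T))// mulr_ge0// ltW.
  apply: ge0_le_integral => //.
  - by move=> x _; exact: integral_ge0.
  - apply: (@measurable_integral_F _ _ _ _ R lebesgue_measure (fun x t => `|f (x, t)|%E)) => //.
    apply: measurableT_comp => //.
  - by apply/measurable_EFinP; apply: measurable_funM => //; exact: measurableT_comp.
  move=> x _.
  apply: (@le_trans _ _ (\int[leb]_t ((`|c x| * (Mg * Mh * L))%:E * (\1_D t)%:E))%E).
    apply: ge0_le_integral => //.
    - apply: measurableT_comp => //.
      by apply: (measurableT_comp mf); exact: measurable_pair1.
    - by apply/measurable_EFinP; apply: measurable_funM => //; exact: measurable_indic.
    move=> t _; rewrite -EFinM lee_fin /f/= !normrM -!mulrA ler_wpM2l// !mulrA.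
    rewrite -(mulrA (Mg * Mh)); apply: ler_pM => //; exact: ler_pM.
  rewrite ge0_integralZl//.
  - rewrite integral_indic// setIT [X in (_ * X)%E](_ : _ = T%:E); last exact: lebD.
    by rewrite -EFinM !mulrA.
  - by apply/measurable_EFinP; exact: measurable_indic.
  - by rewrite lee_fin mulr_ge0.
have F := @Fubini _ _ _ _ _ leb2sf lebesgue_measure _ intf.
rewrite /Rintegral; congr fine.
transitivity (\int[leb2sf]_x \int[@lebesgue_measure R]_y f (x, y))%E.
  apply: eq_integral => x _.
  have ik : leb.-integrable D (EFin \o (fun t => g (x.1 - p t) * h (x.2 - q t) * m t)).
    by apply: integrable_kernel => //; exact: measurable_funTS.
  rewrite EFinM /pint /Rintegral fineK; last exact: integrable_fin_num ik.
  rewrite -integralZl// integral_mkcond; apply: eq_integral => t _.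
  rewrite /f /mT /= !patchE; case: ifPn => _; last by rewrite mulr0.
  by rewrite -EFinM !mulrA.
rewrite F [RHS]integral_mkcond; apply: eq_integral => t _.
have ick : lam2.-integrable setT (EFin \o (fun x => c x * (g (x.1 - p t) * h (x.2 - q t)))).
  apply: (@le_integrable _ _ _ lam2 _ measurableT _ (EFin \o (fun x => (Mg * Mh) * c x))).
  - apply/measurable_EFinP; apply: measurable_funM => //; apply: measurable_funM.
      by apply: (measurableT_comp mg); apply: measurable_funB.
    by apply: (measurableT_comp mh); apply: measurable_funB.
  - move=> x _; rewrite lee_fin !normrM mulrC ler_wpM2r// ler_pM//.
    + exact: (le_trans (gM _) (ler_norm _)).
    + exact: (le_trans (hM _) (ler_norm _)).
  - exact: (integrableZl measurableT _ ic).
rewrite patchE; case: ifPn => tD.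
  rewrite EFinM fineK; last exact: integrable_fin_num ick.
  rewrite -integralZl//; apply: eq_integral => x _.
  by rewrite /f /mT patchE tD /= mulrC EFinM.
by apply: integral0_eq => x _; rewrite /f /mT patchE (negbTE tD) mulr0.
Qed.

End CurveKernel.

(** * L2 bound on the mollified winding function *)

Section WindingBound.
Context {R : realType}.
Local Notation lam2 := (@lebesgue_measure R \x @lebesgue_measure R)%E.
Variables (e : R) (th Th : R -> R) (L T : R).
Hypotheses (mth : mollifier e th Th) (T0 : 0 < T) (L0 : 0 <= L).
Let D : set R := `[0, T]%classic.
Let mD : measurable D. Proof. exact: measurable_itv. Qed.

(** L times the mollified occupation density: the time, weighted by [th], that p spends near a. Its
    total mass L T does not depend on the mollifier. *)
Definition occupation (p : R -> R) (a : R) : \bar R :=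
  (\int[@lebesgue_measure R]_t (L * th (a - p t) * \1_D t)%:E)%E.

Let occ_ge0 p a t : (0 <= (L * th (a - p t) * \1_D t)%:E)%E.
Proof. by rewrite lee_fin !mulr_ge0// (moll_ge0 mth). Qed.

Lemma occupation_ge0 p a : (0 <= occupation p a)%E.
Proof. exact: integral_ge0. Qed.

Let mocc (p : R -> R) : measurable_fun setT p ->
  measurable_fun setT (fun z : R * R => (L * th (z.1 - p z.2) * \1_D z.2)%:E).
Proof.
move=> mp; apply/measurable_EFinP; apply: measurable_funM.
  apply: measurable_funM => //; apply: (measurableT_comp (measurable_moll mth)).
  by apply: measurable_funB => //; exact: (measurableT_comp mp measurable_snd).
apply: (measurableT_comp (f := \1_D : R -> R)) => //; exact: measurable_indic.
Qed.

Lemma measurable_occupation (p : R -> R) : measurable_fun setT p -> measurable_fun setT (occupation p).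
Proof.
move=> mp; exact: (@measurable_integral_F _ _ (measurableTypeR R) (measurableTypeR R) R lebesgue_measure
  (fun a t => (L * th (a - p t) * \1_D t)%:E) (mocc mp) (occ_ge0 p)).
Qed.

Lemma integral_occupation (p : R -> R) : measurable_fun setT p ->
  (\int[leb]_a occupation p a = (L * T)%:E)%E.
Proof.
move=> mp; rewrite /occupation.
rewrite (@fubini_tonelli _ _ _ _ _ lebesgue_measure lebesgue_measure _ (mocc mp))//=.
transitivity (\int[@lebesgue_measure R]_t (L%:E * (\1_D t)%:E))%E.
  apply: eq_integral => t _.
  transitivity (\int[@lebesgue_measure R]_a ((L * \1_D t)%:E * (th (p t - a))%:E))%E.
    by apply: eq_integral => a _; rewrite -EFinM -(moll_even mth (p t - a)) opprB mulrAC.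
  rewrite ge0_integralZl//.
  - by rewrite (integral_moll_shift mth) mule1 EFinM.
  - apply/measurable_EFinP; apply: (measurableT_comp (measurable_moll mth)).
    exact: measurable_funB.
  - by move=> a _; rewrite lee_fin (moll_ge0 mth).
  - by rewrite lee_fin mulr_ge0.
rewrite ge0_integralZl//.
- rewrite integral_indic// setIT [X in (_ * X)%E](_ : _ = T%:E) ?EFinM//.
  by rewrite /D /= lebesgue_measure_itv/= lte_fin T0 sube0.
- by apply/measurable_EFinP; exact: measurable_indic.
Qed.

Lemma occupation_sqint (p q : R -> R) (w : R * R -> R) : measurable_fun setT p -> measurable_fun setT q ->
  measurable_fun setT w ->
  (forall x, (`|w x|%:E <= occupation p x.1)%E) -> (forall x, (`|w x|%:E <= occupation q x.2)%E) ->
  sqint lam2 w /\ nrm2 lam2 w <= (L * T) ^+ 2.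
Proof.
move=> mp mq mw w1 w2; apply: (@sqint_le _ _ _ lam2) => //.
have mA := measurable_occupation mp; have mB := measurable_occupation mq.
apply: (@le_trans _ _ (\int[lam2]_x (occupation p x.1 * occupation q x.2))%E).
  apply: ge0_le_integral => //.
  - by move=> x _; rewrite lee_fin sqr_ge0.
  - by apply/measurable_EFinP; exact: measurable_funX.
  - apply: emeasurable_funM; first exact: (measurableT_comp mA measurable_fst).
    exact: (measurableT_comp mB measurable_snd).
  move=> x _; rewrite -(real_normK (num_real _)) expr2 EFinM.
  by apply: lee_pmul; rewrite ?lee_fin.
rewrite (integral2_prod mA mB)//; try by move=> x; exact: occupation_ge0.
by rewrite !integral_occupation// -EFinM -expr2.
Qed.

Variables (p q m : R -> R).
Hypotheses (mp : measurable_fun setT p) (mq : measurable_fun setT q) (mm : measurable_fun setT m)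
  (mL : forall t, `|m t| <= L).

Lemma pint_le_integral g h (k : R -> R) x : Cboo g -> Cboo h -> (forall t, 0 <= k t) -> measurable_fun setT k ->
  (forall t, `|g (x.1 - p t) * h (x.2 - q t)| <= k t) ->
  (`|pint leb D p q m g h x|%:E <= \int[@lebesgue_measure R]_t (L * k t * \1_D t)%:E)%E.
Proof.
move=> Cg Ch k0 mk ghk.
have im : (@lebesgue_measure R).-integrable D (EFin \o m) by exact: bounded_integrable_itv mm mL.
have ik : leb.-integrable D (EFin \o (fun t => g (x.1 - p t) * h (x.2 - q t) * m t)).
  by apply: integrable_kernel => //; exact: measurable_funTS.
have -> : `|pint leb D p q m g h x|%:E = `|\int[@lebesgue_measure R]_(t in D) (g (x.1 - p t) * h (x.2 - q t) * m t)%:E|%E.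
  have fI : (\int[@lebesgue_measure R]_(t in D) (g (x.1 - p t) * h (x.2 - q t) * m t)%:E)%E \is a fin_num.
    exact: integrable_fin_num ik.
  by rewrite /pint /Rintegral -[in RHS](fineK fI).
have mi : measurable_fun D (EFin \o (fun t => g (x.1 - p t) * h (x.2 - q t) * m t)) by case/integrableP : ik.
pose ker t := (g (x.1 - p t) * h (x.2 - q t) * m t)%:E.
apply: (@le_trans _ _ (\int[@lebesgue_measure R]_(t in D) `|ker t|)%E); first exact: le_abse_integral.
rewrite integral_mkcond; apply: ge0_le_integral => //.
- by move=> t _; rewrite patchE; case: ifP.
- by apply/(measurable_restrictT _ mD); exact: measurableT_comp.
- apply/measurable_EFinP; apply: measurable_funM; first exact: measurable_funM.
  exact: measurable_indic.
move=> t _; rewrite patchE indicE; case: ifP => _ /=; last by rewrite mulr0.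
by rewrite lee_fin mulr1 normrM mulrC ler_pM.
Qed.

Lemma pint_occupation1 x : (`|pint leb D p q m th Th x|%:E <= occupation p x.1)%E.
Proof.
apply: pint_le_integral.
- exact: moll_Cboo mth.
- exact: moll_prim_Cboo mth.
- by move=> t; exact: (moll_ge0 mth).
- apply: (measurableT_comp (measurable_moll mth)); exact: measurable_funB.
- move=> t; rewrite normrM !ger0_norm ?(moll_ge0 mth) ?(moll_prim_ge0 mth)//.
  by rewrite ler_piMr ?(moll_ge0 mth) ?(moll_prim_le1 mth).
Qed.

Lemma pint_occupation2 x : (`|pint leb D p q m Th th x|%:E <= occupation q x.2)%E.
Proof.
apply: pint_le_integral.
- exact: moll_prim_Cboo mth.
- exact: moll_Cboo mth.
- by move=> t; exact: (moll_ge0 mth).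
- apply: (measurableT_comp (measurable_moll mth)); exact: measurable_funB.
- move=> t; rewrite normrM !ger0_norm ?(moll_ge0 mth) ?(moll_prim_ge0 mth)//.
  by rewrite ler_piMl ?(moll_ge0 mth) ?(moll_prim_le1 mth).
Qed.

End WindingBound.

Section UniformApproximation.
Context {R : realType}.
Local Notation lam2 := (@lebesgue_measure R \x @lebesgue_measure R)%E.

Lemma compact_uniform_continuity (K : set (R * R)) (F : R * R -> R) (d : R) :
  compact K -> (forall x, K x -> {for x, continuous F}) -> 0 < d ->
  exists2 e : R, 0 < e & forall x y, K x -> ball x e y -> `|F y - F x| <= d.
Proof.
move=> /compact_near_coveringP cK cF d0.
have d2 : 0 < d / 2 by rewrite divr_gt0.
have H : \forall e \near (0 : R)^'+, K `<=` (fun x => forall y, ball x e y -> `|F y - F x| <= d).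
  apply: cK => x Kx; have /cvgrPdist_le/(_ _ d2)/nbhs_ballP[r /= r0 rF] := cF x Kx.
  have r2 : 0 < r / 2 by rewrite divr_gt0.
  exists (ball x (r / 2), [set e | 0 < e < r / 2]) => /=.
    split; first exact: nbhsx_ballx.
    by near=> e => /=; apply/andP; split; near: e; [exact: nbhs_right_gt|exact: nbhs_right_lt].
  move=> [x' e] /= [xx' /andP[e0 er]] y x'y.
  have rr : r / 2 <= r by lra.
  have H1 := rF x' (le_ball rr xx').
  have xy : ball x r y.
    by rewrite (splitr r); apply: ball_triangle xx' _; exact: le_ball (ltW er) _ x'y.
  have H2 := rF y xy.
  rewrite distrC (le_trans (ler_distD (F x) _ _))// (splitr d) lerD//.
  by rewrite distrC.
near (0 : R)^'+ => e; exists e => //.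
move=> x y Kx; have : K `<=` (fun x => forall y, ball x e y -> `|F y - F x| <= d) by near: e.
by move=> /(_ x Kx y).
Unshelve. all: by end_near. Qed.

(** An average against a probability density carried by the ball of radius e stays within d of a. *)
Lemma mollify_near (e : R) th Th (c : R * R -> R) (x : R * R) (a d : R) : mollifier e th Th ->
  lam2.-integrable setT (EFin \o c) -> (forall y, ball x e y -> `|c y - a| <= d) ->
  `|mollify th c x - a| <= d.
Proof.
move=> mth ic ca; have Cth := moll_Cboo mth.
pose K (y : R * R) := th (x.1 - y.1) * th (x.2 - y.2).
have K0 y : 0 <= K y by rewrite mulr_ge0 ?(moll_ge0 mth).
have K1 : \int[lam2]_y K y = 1 := integral_kernel1 x mth.
have mK : measurable_fun setT K.
  by apply: measurable_funM; apply: (measurableT_comp (measurable_moll mth)); exact: measurable_funB.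
have iK : lam2.-integrable setT (EFin \o K).
  apply/integrableP; split; first exact/measurable_EFinP.
  have -> : (\int[lam2]_y `|(EFin \o K) y| = 1)%E.
    rewrite -(integral_kernelE x mth); apply: eq_integral => y _.
    by rewrite /= ger0_norm.
  exact: ltry.
have ik : lam2.-integrable setT (EFin \o (fun y => K y * c y)).
  by apply: integrable_kernel.
have dE (b : R) : b = \int[lam2]_y (b * K y) by rewrite RintegralZl// K1 mulr1.
have ib b : lam2.-integrable setT (EFin \o (fun y => b * K y)) by exact: (integrableZl measurableT b iK).
have H y : K y * (a - d) <= K y * c y <= K y * (a + d).
  have [y1|y1] := leP e `|x.1 - y.1|; first by rewrite /K (moll_supp mth y1) !mul0r lexx.
  have [y2|y2] := leP e `|x.2 - y.2|; first by rewrite /K (moll_supp mth y2) mulr0 !mul0r lexx.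
  have := ca y (conj y1 y2); rewrite ler_distl => /andP[h1 h2].
  by rewrite !ler_wpM2l.
rewrite ler_distl; apply/andP; split.
  by rewrite (dE (a - d)); apply: le_Rintegral => // y _; rewrite mulrC; have /andP[] := H y.
by rewrite (dE (a + d)); apply: le_Rintegral => // y _; rewrite (mulrC (a + d)); have /andP[] := H y.
Qed.

End UniformApproximation.

(** * Bound on the curve integral by first-order weak derivatives *)

Section TraceBound.
Context {R : realType}.
Local Notation lam2 := (@lebesgue_measure R \x @lebesgue_measure R)%E.
Variable O : set (R * R).
Hypothesis oO : open O.

Local Notation l2norm f := (Num.sqrt (nrm2 lam2 (f \_ O))).

(** Testing the weak derivative of a with chi w moves the derivative off w, up to a term where it
    falls on chi. Both resulting integrals contain w undifferentiated and are bounded by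
    Cauchy-Schwarz. *)
Lemma cutoff_ibp_bound (k : nat * nat) (i : 'I_2) (chi w a d : R * R -> R) (M W : R) :
  @multi_deriv R k = partial i -> (k.1 + k.2)%N = 1%N ->
  test_function O chi -> (forall x, `|chi x| <= M) -> (forall x, `|partial i chi x| <= M) ->
  smooth_on setT w -> sqint lam2 w -> nrm2 lam2 w <= W ^+ 2 -> 0 <= W ->
  L2_on O a -> L2_on O d -> weak_deriv_of O k a d ->
  `|\int[lam2]_x (((a \_ O) x * chi x) * partial i w x)| <= M * W * (l2norm a + l2norm d).
Proof.
move=> kE k1 tchi chiM dchiM sw w2 wW W0 /L2_onP a2 /L2_onP d2 wd.
have [schi _] := tchi.
have tcw := test_smoothM tchi sw.
have tdc := test_partial i tchi; have [sdc _] := tdc.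
have tdcw := test_smoothM tdc sw.
have M0 : 0 <= M by exact: le_trans (normr_ge0 _) (chiM 0).
have bound (f X : R * R -> R) : smooth_on setT X -> (forall x, `|X x| <= M) -> sqint lam2 (f \_ O) ->
    `|\int[lam2]_x ((f \_ O) x * (X x * w x))| <= M * W * l2norm f.
  move=> sX XM f2; have sXw := sqintM w2 (smooth_measurable sX) XM.
  apply: (le_trans (cauchy_schwarz f2 sXw)).
  rewrite mulrC ler_wpM2r ?sqrtr_ge0//.
  have -> : M * W = Num.sqrt ((M * W) ^+ 2) by rewrite sqrtr_sqr ger0_norm// mulr_ge0.
  rewrite ler_sqrt ?sqr_ge0//.
  apply: (@le_trans _ _ (nrm2 lam2 (fun x => M * w x))).
    apply: le_nrm2 => //; first exact: sqintZ.
    by move=> x; rewrite !normrM (ger0_norm M0) ler_wpM2r.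
  by rewrite nrm2Z// exprMn ler_wpM2l// sqr_ge0.
have E : \int[lam2]_x (((a \_ O) x * chi x) * partial i w x) =
   \int[lam2]_x ((a \_ O) x * multi_deriv k (chi * w) x) - \int[lam2]_x ((a \_ O) x * (partial i chi x * w x)).
  rewrite -RintegralB//.
  - apply: eq_Rintegral => x _; rewrite kE partialM//.
    rewrite -[X in _ = _ * X - _]/(partial i chi x * w x + chi x * partial i w x).
    by move: ((a \_ O) x) => z; ring.
  - exact: (integrable_fctM a2 (test_sqint (test_multi k tcw))).
  - exact: (integrable_fctM a2 (test_sqint tdcw)).
rewrite E; have := wd _ tcw; rewrite (int_on O a) (int_on O d) k1 expr1 mulN1r => ->.
rewrite (le_trans (ler_normB _ _))// normrN addrC mulrDr lerD//.
- exact: bound.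
- exact: bound.
Qed.

Section Curve.
Variables (p q : R -> R) (L T : R).
Hypotheses (T0 : 0 < T) (L0 : 0 < L)
  (lp : forall x y, `|p x - p y| <= L * `|x - y|)
  (lq : forall x y, `|q x - q y| <= L * `|x - y|)
  (pT : p T = p 0) (qT : q T = q 0) (pqO : forall t, O (p t, q t)).
Let D : set R := `[0, T]%classic.
Let mD : measurable D. Proof. exact: measurable_itv. Qed.
Let cp : continuous p. Proof. exact: lip_continuous L0 lp. Qed.
Let cq : continuous q. Proof. exact: lip_continuous L0 lq. Qed.
Let mp : measurable_fun setT p. Proof. exact: continuous_measurable_fun. Qed.
Let mq : measurable_fun setT q. Proof. exact: continuous_measurable_fun. Qed.

Let cpq : continuous (fun t => (p t, q t)).
Proof.
move=> t; apply/cvg_ballP => e e0.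
have H1 : nbhs t [set u | ball (p t) e (p u)] by exact: cp (nbhsx_ballx (p t) e e0).
have H2 : nbhs t [set u | ball (q t) e (q u)] by exact: cq (nbhsx_ballx (q t) e e0).
by apply: filterS (filterI H1 H2) => u [pu qu]; split.
Qed.

Lemma partialN i (f : R * R -> R) x : derivable f x (basis_vec i) ->
  partial i (fun y => - f y) x = - partial i f x.
Proof. by move=> df; rewrite /partial -deriveN. Qed.

Let image_compact : compact ((fun t => (p t, q t)) @` D).
Proof.
apply: continuous_compact; last exact: segment_compact.
by apply: continuous_subspaceT.
Qed.

Lemma curve_form_integrable (a : R * R -> R) (m : R -> R) (C : R) :
  (forall x, O x -> {for x, continuous a}) -> measurable_fun setT m -> (forall t, `|m t| <= C) ->
  (@lebesgue_measure R).-integrable D (EFin \o (fun t => a (p t, q t) * m t)).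
Proof.
move=> ca mm mC.
have c1 : continuous (fun t => a (p t, q t)).
  by move=> t; apply: (@continuous_comp _ _ _ (fun t => (p t, q t)) a); [exact: cpq|exact: ca].
have i1 : (@lebesgue_measure R).-integrable D (EFin \o (fun t => a (p t, q t))).
  by apply: continuous_compact_integrable; [exact: segment_compact|exact: continuous_subspaceT].
apply: (@le_integrable _ _ _ (@lebesgue_measure R) D mD _ (EFin \o (fun t => C * a (p t, q t)))).
- apply/measurable_EFinP; apply: measurable_funTS; apply: measurable_funM => //.
  exact: continuous_measurable_fun.
- move=> t _; rewrite lee_fin !normrM mulrC ler_wpM2r//.
  exact: le_trans (mC t) (ler_norm _).
- have := @integrableZl _ _ R (@lebesgue_measure R) D mD C (EFin \o (fun t => a (p t, q t))) i1.
  by apply: eq_integrable.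
Qed.

(** Each coefficient needs only the weak derivative transverse to its own differential, because a0
    is paired with the x2-derivative of the winding function and a1 with its x1-derivative. *)
Theorem trace_bound : exists2 C : R, 0 <= C & forall a0 a1 d0 d1 : R * R -> R,
  (forall x, O x -> {for x, continuous a0}) -> (forall x, O x -> {for x, continuous a1}) ->
  L2_on O a0 -> L2_on O a1 -> L2_on O d0 -> L2_on O d1 ->
  weak_deriv_of O (0, 1)%N a0 d0 -> weak_deriv_of O (1, 0)%N a1 d1 ->
  `|\int[@lebesgue_measure R]_(t in D) (a0 (p t, q t) * derive1 p t + a1 (p t, q t) * derive1 q t)| <=
  C * (l2norm a0 + l2norm d0 + (l2norm a1 + l2norm d1)).
Proof.
pose K := (fun t => (p t, q t)) @` D.
have cK : compact K := image_compact.
have KO : K `<=` O by move=> _ [t _ <-].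
have Kpq t : D t -> K (p t, q t) by move=> Dt; exists t.
have [m Km] := compact_sub_exhaustion oO cK KO.
(* With index [m.+1] instead of m, chi equals 1 on a whole neighborhood of the curve, so
   mollification close to the curve does not see it. *)
have [chi [tchi chi1 _]] := cutoff_exists O m.+1.
have [schi _] := tchi.
have [M1 M10 chiM1] := test_bounded tchi.
have [M2 M20 chiM2] := test_bounded (test_partial 0 tchi).
have [M3 M30 chiM3] := test_bounded (test_partial 1 tchi).
pose M := M1 + M2 + M3.
have chiM x : `|chi x| <= M by rewrite (le_trans (chiM1 x))// /M -addrA lerDl addr_ge0.
have chi0M x : `|partial 0 chi x| <= M by rewrite (le_trans (chiM2 x))// /M addrAC lerDr addr_ge0.
have chi1M x : `|partial 1 chi x| <= M by rewrite (le_trans (chiM3 x))// /M lerDr addr_ge0.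
have M0 : 0 <= M by rewrite !addr_ge0.
have [B1 B10 pB1] := derive1_bounded L0 lp; have [B2 B20 qB2] := derive1_bounded L0 lq.
pose B := B1 + B2; have B0 : 0 <= B by rewrite addr_ge0.
have pB t : `|derive1 p t| <= B by rewrite (le_trans (pB1 t))// lerDl.
have qB t : `|derive1 q t| <= B by rewrite (le_trans (qB2 t))// lerDr.
have mP := measurable_derive1 cp; have mQ := measurable_derive1 cq.
(* [M] bounds chi and its first derivatives, and [B * T] will bound the L2 norm of the winding
   function; neither depends on the mollification radius. *)
exists (M * (B * T)); first by rewrite !mulr_ge0// ltW.
move=> a0 a1 d0 d1 ca0 ca1 La0 La1 Ld0 Ld1 wd0 wd1.
have BT0 : 0 <= B * T by rewrite mulr_ge0// ltW.
set I := Rintegral _ _ _; set S := (X in _ <= _ * X).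
(* d is the pointwise error of mollifying a coefficient on the curve; integrated against a
   derivative bounded by [B], for two coefficients, it costs 2 B d T. *)
suff H (d : R) : 0 < d -> `|I| <= M * (B * T) * S + 2 * B * d * T.
  apply/ler_addgt0Pr => e e0; pose d := e / (2 * B * T + 1).
  have den : 0 < 2 * B * T + 1 by rewrite ltr_wpDl// -mulrA mulr_ge0.
  apply: (le_trans (H d _)); first by rewrite divr_gt0.
  rewrite lerD2l (_ : 2 * B * d * T = (2 * B * T) * d); last by ring.
  by rewrite /d mulrCA ler_piMr ?(ltW e0)// ler_pdivrMr// mul1r lerDl.
move=> dd0.
have sl x : K x -> {for x, continuous a0} by move=> /KO; exact: ca0.
have sl1 x : K x -> {for x, continuous a1} by move=> /KO; exact: ca1.
have [e0 e00 he0] := compact_uniform_continuity cK sl dd0.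
have [e1 e10 he1] := compact_uniform_continuity cK sl1 dd0.
(* [e0] and [e1] ensure closeness of the mollified coefficients on the curve; the last term keeps
   the e-neighborhood of the curve where chi is 1. *)
pose e := Num.min (Num.min e0 e1) (2^-1 ^+ m.+1).
have egt0 : 0 < e by rewrite !lt_min e00 e10/= exprn_gt0// invr_gt0.
have ee0 : e <= e0 by rewrite /e !ge_min lexx.
have ee1 : e <= e1 by rewrite /e !ge_min lexx orbT.
have em : e <= 2^-1 ^+ m.+1 by rewrite /e ge_min lexx orbT.
have [th [Th mth]] := mollifier_exists egt0.
have Cth := moll_Cboo mth; have CTh := moll_prim_Cboo mth; have te := moll_even mth.
have dTh := moll_primE mth.
pose P := derive1 p; pose Q := derive1 q.
have imP : (@lebesgue_measure R).-integrable D (EFin \o P) by exact: bounded_integrable_itv mP pB.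
have imQ : (@lebesgue_measure R).-integrable D (EFin \o Q) by exact: bounded_integrable_itv mQ qB.
have mpD : measurable_fun D p by exact: measurable_funTS.
have mqD : measurable_fun D q by exact: measurable_funTS.
pose w := pint (@lebesgue_measure R) D p q P th Th.
pose w' := pint (@lebesgue_measure R) D p q Q Th th.
(* Here closedness of the curve enters: one function is a potential for both components of the
   current. *)
have wE x : w x = - w' x.
  apply/eqP; rewrite -addr_eq0 /w /w' /pint -RintegralD//.
  - have := closed_curve_kernel x.1 x.2 T0 L0 lp lq pT qT CTh CTh; rewrite dTh => E.
    by apply/eqP; exact: E.
  - by apply: integrable_kernel.
  - by apply: integrable_kernel.
have wEf : w = (fun x => - w' x) by apply/funext.
have sw : smooth_on setT w by exact: pint_smooth.
have sw' : smooth_on setT w' by exact: pint_smooth.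
have [sqw nw] : sqint lam2 w /\ nrm2 lam2 w <= (B * T) ^+ 2.
  apply: (occupation_sqint (p := p) (q := q) mth T0 B0 mp mq (smooth_measurable sw)) => x.
    exact: (pint_occupation1 T mth mp mq mP pB).
  rewrite wE normrN; exact: (pint_occupation2 T mth mp mq mQ qB).
have p1w : partial 1 w = pint (@lebesgue_measure R) D p q P th th.
  by rewrite /w partial_pint1// dTh.
have p0w x : partial 0 w x = - pint (@lebesgue_measure R) D p q Q th th x.
  rewrite wEf partialN; last exact: (smooth_on_derivable sw').
  by rewrite /w' partial_pint0// dTh.
pose c0 x := (a0 \_ O) x * chi x; pose c1 x := (a1 \_ O) x * chi x.
have [N N0 chiN] := test_support tchi.
have ic (a : R * R -> R) : L2_on O a -> lam2.-integrable setT (EFin \o (fun x => (a \_ O) x * chi x)).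
  by move=> /L2_onP a2; exact: (integrable_fctM a2 (test_sqint tchi)).
have ic0 := ic _ La0; have ic1 := ic _ La1.
have near_curve (a : R * R -> R) t y : D t -> ball (p t, q t) e y -> (a \_ O) y * chi y = a y.
  move=> Dt yt; have yK : exhaustion O m.+1 y.
    by apply: (exhaustion_step (Km _ (Kpq t Dt))); exact: le_ball em _ yt.
  by rewrite chi1// mulr1 patchE mem_set//; exact: exhaustion_sub yK.
have moll0 t : D t -> `|mollify th c0 (p t, q t) - a0 (p t, q t)| <= d.
  move=> Dt; apply: (mollify_near mth ic0) => y yt; rewrite /c0 (near_curve a0 t)//.
  by apply: he0; [exact: Kpq|exact: le_ball ee0 _ yt].
have moll1 t : D t -> `|mollify th c1 (p t, q t) - a1 (p t, q t)| <= d.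
  move=> Dt; apply: (mollify_near mth ic1) => y yt; rewrite /c1 (near_curve a1 t)//.
  by apply: he1; [exact: Kpq|exact: le_ball ee1 _ yt].
have fub (c : R * R -> R) (f : R -> R) : lam2.-integrable setT (EFin \o c) -> measurable_fun setT f ->
    (forall t, `|f t| <= B) ->
    \int[lam2]_x (c x * pint (@lebesgue_measure R) D p q f th th x) =
    \int[@lebesgue_measure R]_(t in D) (mollify th c (p t, q t) * f t).
  move=> icc mf fB; rewrite (fubini_pint cp cq mf fB T0 icc Cth Cth).
  apply: eq_Rintegral => t _; rewrite mulrC; congr (_ * _).
  apply: eq_Rintegral => x _; rewrite mulrC /=; congr (_ * _ * _).
    by rewrite -te opprB.
  by rewrite -te opprB.
have H0 := cutoff_ibp_bound (k := (0, 1)%N) (i := 1) erefl erefl tchi chiM chi1M sw sqw nw BT0 La0 Ld0 wd0.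
have H1 := cutoff_ibp_bound (k := (1, 0)%N) (i := 0) erefl erefl tchi chiM chi0M sw sqw nw BT0 La1 Ld1 wd1.
have E0 : \int[lam2]_x ((a0 \_ O) x * chi x * partial 1 w x) =
    \int[@lebesgue_measure R]_(t in D) (mollify th c0 (p t, q t) * P t).
  by rewrite -(fub c0 P ic0 mP pB); apply: eq_Rintegral => x _; rewrite p1w.
have E1 : \int[lam2]_x ((a1 \_ O) x * chi x * partial 0 w x) =
    - \int[@lebesgue_measure R]_(t in D) (mollify th c1 (p t, q t) * Q t).
  have sQ : smooth_on setT (pint (@lebesgue_measure R) D p q Q th th) by exact: pint_smooth.
  have mul x : c1 x * pint (@lebesgue_measure R) D p q Q th th x = (a1 \_ O) x * (chi * pint (@lebesgue_measure R) D p q Q th th) x.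
    by rewrite mulrA.
  have iQ : lam2.-integrable setT (EFin \o (fun x => c1 x * pint (@lebesgue_measure R) D p q Q th th x)).
    have := integrable_fctM (proj1 (L2_onP _ _) La1) (test_sqint (test_smoothM tchi sQ)).
    by apply: eq_integrable => // x _; rewrite /= mul.
  rewrite -(fub c1 Q ic1 mQ qB) -mulN1r -RintegralZl//.
  by apply: eq_Rintegral => x _; rewrite p0w mulrN mulN1r.
have cmoll c : lam2.-integrable setT (EFin \o c) -> forall x, O x -> {for x, continuous (mollify th c)}.
  by move=> icc x _; apply: pint_continuous.
have iM0 := curve_form_integrable (cmoll _ ic0) mP pB.
have iM1 := curve_form_integrable (cmoll _ ic1) mQ qB.
have iA0 := curve_form_integrable ca0 mP pB.
have iA1 := curve_form_integrable ca1 mQ qB.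
pose J0 := \int[@lebesgue_measure R]_(t in D) (mollify th c0 (p t, q t) * P t).
pose J1 := \int[@lebesgue_measure R]_(t in D) (mollify th c1 (p t, q t) * Q t).
have J0b : `|J0| <= M * (B * T) * (l2norm a0 + l2norm d0) by rewrite /J0 -E0.
have J1b : `|J1| <= M * (B * T) * (l2norm a1 + l2norm d1).
  by have := H1; rewrite E1 normrN.
have diff (a f : R -> R) (b : R -> R) : (@lebesgue_measure R).-integrable D (EFin \o (fun t => a t * f t)) ->
   (@lebesgue_measure R).-integrable D (EFin \o (fun t => b t * f t)) -> (forall t, `|f t| <= B) ->
   (forall t, D t -> `|b t - a t| <= d) ->
   `|\int[@lebesgue_measure R]_(t in D) (a t * f t) - \int[@lebesgue_measure R]_(t in D) (b t * f t)| <= B * d * T.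
  move=> ia ib fB ba; rewrite -RintegralB//.
  have iab : (@lebesgue_measure R).-integrable D (EFin \o (fun t => a t * f t - b t * f t)).
    by have := @integrableB _ _ R (@lebesgue_measure R) D mD _ _ ia ib; apply: eq_integrable.
  apply: (@le_trans _ _ (\int[@lebesgue_measure R]_(t in D) `|a t * f t - b t * f t|)).
    exact: le_normr_Rintegral.
  have lebD : (@lebesgue_measure R) D = T%:E.
    by rewrite /D /= lebesgue_measure_itv/= lte_fin T0 sube0.
  apply: (@le_trans _ _ (\int[@lebesgue_measure R]_(t in D) (B * d))).
    apply: le_Rintegral => //.
    - by have := integrable_abse iab; apply: eq_integrable.
    - by apply: bounded_integrable_itv => //.
    move=> t Dt; rewrite -mulrBl normrM mulrC ler_pM// distrC; exact: ba.
  by rewrite Rintegral_cst// [X in fine X](_ : _ = T%:E)//; exact: lebD.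
pose X := \int[@lebesgue_measure R]_(t in D) (a0 (p t, q t) * P t).
pose Y := \int[@lebesgue_measure R]_(t in D) (a1 (p t, q t) * Q t).
have -> : I = X + Y by rewrite /X /Y -RintegralD.
have D0 : `|X - J0| <= B * d * T := diff _ _ _ iA0 iM0 pB moll0.
have D1 : `|Y - J1| <= B * d * T := diff _ _ _ iA1 iM1 qB moll1.
have X1 : `|X| <= `|J0| + B * d * T.
  by rewrite addrC -lerBlDr (le_trans _ D0)// lerB_dist.
have Y1 : `|Y| <= `|J1| + B * d * T.
  by rewrite addrC -lerBlDr (le_trans _ D1)// lerB_dist.
rewrite (le_trans (ler_normD _ _))//.
have -> : 2 * B * d * T = B * d * T + B * d * T by ring.
rewrite /S mulrDr addrACA; apply: lerD; [apply: (le_trans X1)|apply: (le_trans Y1)]; exact: lerD.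
Qed.

End Curve.
End TraceBound.

(** * The Sobolev norm of forms *)

Section HsNorm.
Context {R : realType}.
Local Notation lam2 := (@lebesgue_measure R \x @lebesgue_measure R)%E.
Variables (O : set (R * R)) (s : nat) (sigma : R).
Hypotheses (oO : open O) (sigma0 : 0 < sigma).
Implicit Types (u v : R * R -> R) (k : nat * nat).

Let patch_lin (a b : R) u v x : ((fun x => a * u x + b * v x) \_ O) x = a * (u \_ O) x + b * (v \_ O) x.
Proof. by rewrite !patchE; case: ifP => // _; rewrite !mulr0 addr0. Qed.

Lemma L2_on_lin (a b : R) u v : L2_on O u -> L2_on O v -> L2_on O (fun x => a * u x + b * v x).
Proof.
move=> /L2_onP u2 /L2_onP v2; apply/L2_onP.
by apply: eq_sqint (sqintD (sqintZ a u2) (sqintZ b v2)) => x; rewrite patch_lin.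
Qed.

Lemma integral_lin (a b : R) u v psi : L2_on O u -> L2_on O v -> test_function O psi ->
  \int[leb2]_(x in O) ((a * u x + b * v x) * psi x) =
  a * \int[leb2]_(x in O) (u x * psi x) + b * \int[leb2]_(x in O) (v x * psi x).
Proof.
move=> /L2_onP u2 /L2_onP v2 tp; have p2 := test_sqint tp.
rewrite (int_on O (fun x => a * u x + b * v x)) (int_on O u) (int_on O v).
have iu := integrable_fctM u2 p2; have iv := integrable_fctM v2 p2.
rewrite -RintegralZl// -RintegralZl// -RintegralD//.
- by apply: eq_Rintegral => x _; rewrite patch_lin mulrDl !mulrA.
- exact: (integrableZl measurableT a iu).
- exact: (integrableZl measurableT b iv).
Qed.

Lemma weak_deriv_lin (a b : R) k u u' v v' : L2_on O u -> L2_on O v -> L2_on O u' -> L2_on O v' ->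
  weak_deriv_of O k u u' -> weak_deriv_of O k v v' ->
  weak_deriv_of O k (fun x => a * u x + b * v x) (fun x => a * u' x + b * v' x).
Proof.
move=> u2 v2 u'2 v'2 wu wv psi tp.
rewrite integral_lin//; last exact: test_multi.
by rewrite (wu _ tp) (wv _ tp) integral_lin//; ring.
Qed.

Lemma Hs_lin (a b : R) u v : Hs O s u -> Hs O s v -> Hs O s (fun x => a * u x + b * v x).
Proof.
move=> [u2 Hu] [v2 Hv]; split; first exact: L2_on_lin.
move=> k ks; have [u' [u'2 wu]] := Hu k ks; have [v' [v'2 wv]] := Hv k ks.
exists (fun x => a * u' x + b * v' x); split; first exact: L2_on_lin.
exact: weak_deriv_lin.
Qed.

Lemma weak_derivP k u : Hs O s u -> (k.1 + k.2 <= s)%N ->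
  L2_on O (weak_deriv O k u) /\ weak_deriv_of O k u (weak_deriv O k u).
Proof.
move=> [_ Hu] ks; have [v Hv] := Hu k ks.
by apply: (@xgetPex _ (fun=> 0) [set v | L2_on O v /\ weak_deriv_of O k u v]); exists v.
Qed.

(** [weak_deriv] is an arbitrary choice, so a norm involving it can be computed from a known weak
    derivative only through uniqueness almost everywhere. *)
Lemma nrm2_weak_deriv k u v : Hs O s u -> (k.1 + k.2 <= s)%N -> L2_on O v -> weak_deriv_of O k u v ->
  nrm2 lam2 (weak_deriv O k u \_ O) = nrm2 lam2 (v \_ O).
Proof.
move=> Hu ks v2 wv; have [d2 wd] := weak_derivP Hu ks.
set d := weak_deriv O k u in d2 wd *.
have H : {ae lam2, forall x, ((fun x => 1 * d x + (-1) * v x) \_ O) x = 0}.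
  apply: weak_unique => //; first exact: L2_on_lin.
  move=> psi tp; rewrite integral_lin//.
  have := wd _ tp; rewrite (wv _ tp) => /(can_inj (signrMK _)) ->.
  by rewrite mul1r mulN1r subrr.
rewrite /nrm2 /Rintegral; congr fine; apply: ae_eq_integral => //.
- by apply/measurable_EFinP; apply: measurable_funX; have /L2_onP[] := d2.
- by apply/measurable_EFinP; apply: measurable_funX; have /L2_onP[] := v2.
apply: (@filterS _ _ (ae_filter_ringOfSetsType lam2) _ _ _ H) => x + _.
by rewrite patch_lin mul1r mulN1r => /eqP; rewrite subr_eq0 => /eqP ->.
Qed.

Definition Hs_weight k : R := sigma ^+ (2 * (k.1 + k.2)) * multinom2 s k.

Lemma Hs_weight_gt0 k : 0 < Hs_weight k.
Proof.
by rewrite /Hs_weight mulr_gt0 ?exprn_gt0// /multinom2 divr_gt0// ltr0n ?muln_gt0 ?fact_gt0.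
Qed.

(** The squared norm with [f k i] in the place of D^k alpha_i; leaving the family arbitrary lets
    inequalities be proved term by term. *)
Definition Hs_energy (f : nat * nat -> form1) : R :=
  \sum_(i < 2) \sum_(k1 < s.+1) \sum_(k2 < s.+1 | (k1 + k2 <= s)%N)
    Hs_weight (nat_of_ord k1, nat_of_ord k2) *
    nrm2 lam2 (f (nat_of_ord k1, nat_of_ord k2) i \_ O).

(** Integrability and value are carried together, so the lemma can be applied to itself through the
    three nested sums of the inner product. *)
Lemma has_integral_sum (D : set (R * R)) (I : Type) (r : seq I) (P : pred I) (F : I -> R * R -> R) (c : I -> R) :
  measurable D ->
  (forall i, P i -> lam2.-integrable D (EFin \o F i) /\ \int[lam2]_(x in D) F i x = c i) ->
  lam2.-integrable D (EFin \o (fun x => \sum_(i <- r | P i) F i x)) /\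
  \int[lam2]_(x in D) (\sum_(i <- r | P i) F i x) = \sum_(i <- r | P i) c i.
Proof.
move=> mD HF; elim: r => [|i r [IH1 IH2]].
  split; first by apply: (eq_integrable _ (cst 0%E)) (integrable0 _ _) => // x _; rewrite /= big_nil.
  by rewrite big_nil /Rintegral integral0_eq// => x _; rewrite big_nil.
rewrite [in X in _ /\ X]big_cons; case: ifPn => Pi; last first.
  split.
    by apply: eq_integrable IH1 => // x _; rewrite /= big_cons (negbTE Pi).
  by rewrite -IH2; apply: eq_Rintegral => x _; rewrite big_cons (negbTE Pi).
have [F1 F2] := HF i Pi; split.
  have := @integrableD _ _ _ lam2 D mD _ _ F1 IH1.
  by apply: eq_integrable => // x _; rewrite /= big_cons Pi.
rewrite -F2 -IH2 -RintegralD//.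
by apply: eq_Rintegral => x _; rewrite big_cons Pi.
Qed.

Lemma Hs_inner_energy (alpha : form1) : Hs_form O s alpha ->
  Hs_inner sigma O s alpha alpha = Hs_energy (fun k i => weak_deriv O k (alpha i)).
Proof.
move=> Ha; have mO : measurable O by exact: open_measurable2.
rewrite /Hs_inner /Hs_energy.
apply: (proj2 (has_integral_sum _ mO _)) => i _.
apply: (has_integral_sum _ mO) => k1 _.
apply: (has_integral_sum _ mO) => k2 ks.
have [/L2_onP d2 _] := weak_derivP (Ha i) (k := (nat_of_ord k1, nat_of_ord k2)) ks.
set d := weak_deriv O _ _ in d2 *; have [_ i2] := d2.
have id : lam2.-integrable O (EFin \o (fun x => d x * d x)).
  have i3 : lam2.-integrable O (EFin \o (fun x => (d \_ O) x ^+ 2)) by apply: integrableS i2.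
  by apply: eq_integrable i3 => // x xO; rewrite /= patchE xO.
split; first by have := @integrableZl _ _ _ lam2 O mO (Hs_weight (nat_of_ord k1, nat_of_ord k2)) _ id; apply: eq_integrable.
rewrite RintegralZl// /nrm2 /Hs_weight; congr (_ * _).
rewrite Rintegral_mkcond; apply: eq_Rintegral => x _; rewrite !patchE expr2.
by case: ifP => // _; rewrite mulr0.
Qed.

Lemma Hs_energy_le (f g h : nat * nat -> form1) (a b : R) :
  (forall k i, (k.1 + k.2 <= s)%N ->
    nrm2 lam2 (f k i \_ O) <= a * nrm2 lam2 (g k i \_ O) + b * nrm2 lam2 (h k i \_ O)) ->
  Hs_energy f <= a * Hs_energy g + b * Hs_energy h.
Proof.
move=> H; rewrite /Hs_energy !mulr_sumr -big_split/=; apply: ler_sum => i _.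
rewrite !mulr_sumr -big_split/=; apply: ler_sum => k1 _.
rewrite !mulr_sumr -big_split/=; apply: ler_sum => k2 ks.
have := H (nat_of_ord k1, nat_of_ord k2) i ks.
have := Hs_weight_gt0 (nat_of_ord k1, nat_of_ord k2).
set c := Hs_weight _; set x := nrm2 _ _; set y := nrm2 _ _; set z := nrm2 _ _.
by move=> c0 xyz; rewrite [X in _ <= X + _]mulrCA [X in _ <= _ + X]mulrCA -mulrDr ler_pM2l.
Qed.

Lemma Hs_energy_ge0 f : 0 <= Hs_energy f.
Proof.
rewrite /Hs_energy; apply: sumr_ge0 => i _; apply: sumr_ge0 => k1 _; apply: sumr_ge0 => k2 _.
by rewrite mulr_ge0 ?nrm2_ge0// ltW// Hs_weight_gt0.
Qed.

Lemma Hs_energy_term f k i : (k.1 + k.2 <= s)%N ->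
  Hs_weight k * nrm2 lam2 (f k i \_ O) <= Hs_energy f.
Proof.
case: k => a b /= ks.
have as' : (a < s.+1)%N by rewrite ltnS (leq_trans _ ks)// leq_addr.
have bs : (b < s.+1)%N by rewrite ltnS (leq_trans _ ks)// leq_addl.
have t0 (k1 k2 : nat) (j : 'I_2) : 0 <= Hs_weight (k1, k2) * nrm2 lam2 (f (k1, k2) j \_ O).
  by rewrite mulr_ge0 ?nrm2_ge0// ltW// Hs_weight_gt0.
rewrite /Hs_energy (bigD1 i)//= (bigD1 (Ordinal as'))//= (bigD1 (Ordinal bs))//=.
rewrite -!addrA lerDl !addr_ge0//.
- by apply: sumr_ge0.
- by apply: sumr_ge0 => k1 _; apply: sumr_ge0.
- by apply: sumr_ge0 => j _; apply: sumr_ge0 => k1 _; apply: sumr_ge0.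
Qed.

Local Notation N := (Hs_norm sigma O s).

Lemma Hs_norm_sqr alpha : Hs_form O s alpha ->
  N alpha ^+ 2 = Hs_energy (fun k i => weak_deriv O k (alpha i)).
Proof. by move=> Ha; rewrite /Hs_norm sqr_sqrtr Hs_inner_energy// Hs_energy_ge0. Qed.

Lemma Hs_norm_ge0 alpha : 0 <= N alpha.
Proof. exact: sqrtr_ge0. Qed.

Lemma Hs_form_lin (a b : R) alpha beta : Hs_form O s alpha -> Hs_form O s beta ->
  Hs_form O s (form_lin a b alpha beta).
Proof. by move=> Ha Hb i; exact: Hs_lin. Qed.

Lemma sqr_bound (a b x y z X Y Z : R) : x ^+ 2 = X -> y ^+ 2 = Y -> z ^+ 2 = Z ->
  0 <= x -> 0 <= y -> 0 <= z -> X <= (2 * a ^+ 2) * Y + (2 * b ^+ 2) * Z ->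
  x <= 2 * (`|a| * y + `|b| * z).
Proof.
move=> <- <- <- x0 y0 z0 E.
rewrite -(@ler_pXn2r _ 2)// ?nnegrE ?mulr_ge0 ?addr_ge0 ?mulr_ge0//.
apply: (le_trans E); rewrite -(real_normK (num_real a)) -(real_normK (num_real b)).
have := mulr_ge0 (mulr_ge0 (normr_ge0 a) y0) (mulr_ge0 (normr_ge0 b) z0).
have := sqr_ge0 (`|a| * y); have := sqr_ge0 (`|b| * z).
move: (`|a|) (`|b|) => p q; nra.
Qed.

(** The factor 2 in place of the sharp triangle inequality comes from [nrm2D]; it is harmless for an
    extension by continuity. *)
Lemma Hs_norm_lin (a b : R) alpha beta : Hs_form O s alpha -> Hs_form O s beta ->
  N (form_lin a b alpha beta) <= 2 * (`|a| * N alpha + `|b| * N beta).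
Proof.
move=> Ha Hb; have Hab := Hs_form_lin a b Ha Hb.
apply: (sqr_bound (Hs_norm_sqr Hab) (Hs_norm_sqr Ha) (Hs_norm_sqr Hb));
  [exact: Hs_norm_ge0..|].
apply: Hs_energy_le => k i ks.
have [da wa] := weak_derivP (Ha i) ks; have [db wb] := weak_derivP (Hb i) ks.
set d1 := weak_deriv O k (alpha i) in da wa *; set d2 := weak_deriv O k (beta i) in db wb *.
rewrite (nrm2_weak_deriv (v := fun x => a * d1 x + b * d2 x) (Hab i) ks); last 2 first.
- exact: L2_on_lin.
- by apply: weak_deriv_lin => //; [case: (Ha i)|case: (Hb i)].
have /L2_onP da2 := da; have /L2_onP db2 := db.
rewrite -[X in _ <= X + _]mulrA -[X in _ <= _ + X]mulrA -(nrm2Z a da2) -(nrm2Z b db2).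
apply: le_trans (nrm2D (sqintZ a da2) (sqintZ b db2)).
rewrite le_eqVlt; apply/orP; left; apply/eqP.
by apply: eq_Rintegral => x _; rewrite patch_lin.
Qed.

End HsNorm.

(** * Extension by continuity *)

Section ContinuousExtension.
Context {R : realType}.
Variables (X : Type) (lin : R -> R -> X -> X -> X) (H S : X -> Prop) (N p : X -> R) (C : R).
Hypotheses (N_ge0 : forall x, 0 <= N x) (C_ge0 : 0 <= C)
  (H_lin : forall a b x y, H x -> H y -> H (lin a b x y))
  (S_lin : forall a b x y, S x -> S y -> S (lin a b x y))
  (N_lin : forall a b x y, H x -> H y -> N (lin a b x y) <= 2 * (`|a| * N x + `|b| * N y))
  (p_lin : forall a b x y, S x -> S y -> p (lin a b x y) = a * p x + b * p y)
  (p_bound : forall x, S x -> H x -> `|p x| <= C * N x)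
  (dense : forall x (e : R), H x -> 0 < e -> exists y, [/\ S y, H y & N (lin 1 (-1) y x) < e])
  (lin_subsub : forall x y z, lin 1 (-1) (lin 1 (-1) y x) (lin 1 (-1) z x) = lin 1 (-1) y z)
  (lin_sublin : forall a b x y x' y', lin 1 (-1) (lin a b x' y') (lin a b x y) =
     lin a b (lin 1 (-1) x' x) (lin 1 (-1) y' y))
  (lin_subid : forall x, lin 1 (-1) x x = lin 0 0 x x)
  (lin_subK : forall x y, lin 1 1 (lin 1 (-1) y x) x = y).

Let near_set x (e : R) : set X := [set y | [/\ S y, H y & N (lin 1 (-1) y x) < e]].
Let F x : set_system X := filter_from [set e : R | 0 < e] (near_set x).

Let F_proper x : H x -> ProperFilter (F x).
Proof.
move=> Hx; apply: filter_from_proper; last first.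
  by move=> e e0; have [y Hy] := dense Hx e0; exists y.
apply: filter_from_filter; first by exists 1 => /=.
move=> e1 e2 /= e10 e20; exists (Num.min e1 e2) => /=; first by rewrite lt_min e10.
by move=> y [Sy Hy]; rewrite lt_min => /andP[N1 N2].
Qed.

Let p_near x (d : R) y z : H x -> near_set x d y -> near_set x d z -> `|p z - p y| <= 4 * C * d.
Proof.
move=> Hx [Sy Hy Ny] [Sz Hz Nz].
have -> : p z - p y = p (lin 1 (-1) z y) by rewrite p_lin// mul1r mulN1r.
apply: (le_trans (p_bound (S_lin _ _ Sz Sy) (H_lin _ _ Hz Hy))).
(* z - y is written as (z - x) - (y - x): two errors below d, with the quasi-triangle constant 2,
   make 4 d. *)
have := N_lin 1 (-1) (H_lin 1 (-1) Hz Hx) (H_lin 1 (-1) Hy Hx).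
rewrite lin_subsub normrN normr1 !mul1r => NN.
by rewrite mulrAC (mulrC _ C) ler_wpM2l//; lra.
Qed.

Let p_cvg x : H x -> cvg (p @ F x).
Proof.
move=> Hx; have PF := F_proper Hx.
apply: cauchy_cvg; apply: cauchy_exP => e e0.
have C4 : 0 < 4 * C + 1 by rewrite ltr_wpDl// mulr_ge0.
pose d := e / (4 * C + 1); have d0 : 0 < d by rewrite divr_gt0.
have [y [Sy Hy Ny]] := dense Hx d0.
have ny : near_set x d y by split.
exists (p y); exists d => // z nz /=.
rewrite /ball/= distrC (le_lt_trans (p_near Hx ny nz))//.
by rewrite /d mulrA ltr_pdivrMr// mulrDr mulr1 (mulrC e) ltrDl.
Qed.

Definition extension x : R := lim (p @ F x).

Lemma extension_near x d y : H x -> near_set x d y -> `|extension x - p y| <= 4 * C * d.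
Proof.
move=> Hx ny; have PF := F_proper Hx; have cx := p_cvg Hx.
have d0 : 0 < d by have [_ _] := ny; apply: le_lt_trans.
apply/ler_addgt0Pl => e e0.
have /cvgrPdist_le/(_ _ e0) N1 : p @ F x --> extension x by exact: cx.
have N2 : F x (near_set x d) by exists d.
have [z [z1 z2]] := filter_ex (filterI N1 N2).
have := p_near Hx ny z2; move: z1 => /=.
have := ler_distD (p z) (extension x) (p y); lra.
Qed.

(** The usual extension of a bounded linear map from a dense subspace, for a carrier with no
    structure except [lin] and a size N obeying only a quasi-triangle inequality. Every claim passes
    to x from nearby elements of S by [extension_near]. *)
Lemma extension_spec :
  [/\ forall x, H x -> ProperFilter (F x) /\ cvg (p @ F x),
      forall x, H x -> S x -> extension x = p x,
      forall a b x y, H x -> H y -> extension (lin a b x y) = a * extension x + b * extension y &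
      exists C', forall x, H x -> `|extension x| <= C' * N x].
Proof.
have small (r K : R) : 0 <= K -> (forall d : R, 0 < d -> `|r| <= K * d) -> r = 0.
  move=> K0 h; apply/normr0_eq0/eqP; rewrite eq_le normr_ge0 andbT.
  apply/ler_addgt0Pr => e e0; rewrite add0r.
  have K1 : 0 < K + 1 by rewrite ltr_wpDl.
  apply: (le_trans (h (e / (K + 1)) _)); first by rewrite divr_gt0.
  by rewrite mulrCA ler_piMr ?(ltW e0)// ler_pdivrMr// mul1r lerDl.
split.
- by move=> x Hx; split; [exact: F_proper|exact: p_cvg].
- move=> x Hx Sx; apply/eqP; rewrite -subr_eq0; apply/eqP.
  apply: (small _ (4 * C)); first by rewrite mulr_ge0.
  move=> d d0; apply: extension_near => //; split => //.
  (* Writing x - x as 0 x + 0 x shows that its size is 0 without naming a zero element. *)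
  rewrite lin_subid (le_lt_trans (N_lin _ _ Hx Hx))// normr0 !mul0r addr0 mulr0//.
- move=> a b x y Hx Hy; apply/eqP; rewrite -subr_eq0; apply/eqP.
  apply: (small _ (4 * C * (2 * (`|a| + `|b|) + 1) + (`|a| + `|b|) * (4 * C))).
    by rewrite addr_ge0// ?mulr_ge0 ?addr_ge0 ?mulr_ge0 ?addr_ge0.
  move=> d d0; have [x' [Sx' Hx' Nx']] := dense Hx d0; have [y' [Sy' Hy' Ny']] := dense Hy d0.
  have nx : near_set x d x' by split.
  have ny : near_set y d y' by split.
  (* The summand 1 keeps the inequality strict when a = b = 0. *)
  have nxy : near_set (lin a b x y) ((2 * (`|a| + `|b|) + 1) * d) (lin a b x' y').
    split; [exact: S_lin|exact: H_lin|].
    rewrite lin_sublin (le_lt_trans (N_lin _ _ (H_lin _ _ Hx' Hx) (H_lin _ _ Hy' Hy)))//.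
    have a0 := normr_ge0 a; have b0 := normr_ge0 b.
    have h1 := ler_wpM2l a0 (ltW Nx'); have h2 := ler_wpM2l b0 (ltW Ny').
    by move: h1 h2; set u := `|a| * _; set v := `|b| * _; lra.
  have E1 := extension_near (H_lin a b Hx Hy) nxy; rewrite p_lin// in E1.
  have E2 := ler_wpM2l (normr_ge0 a) (extension_near Hx nx).
  have E3 := ler_wpM2l (normr_ge0 b) (extension_near Hy ny).
  rewrite -normrM in E2; rewrite -normrM in E3.
  move: E1 E2 E3; set r := extension _; set s := extension x; set t := extension y.
  move=> E1 E2 E3.
  have -> : r - (a * s + b * t) = (r - (a * p x' + b * p y')) - (a * (s - p x') + b * (t - p y')) by ring.
  rewrite (le_trans (ler_normB _ _))// (le_trans (lerD E1 (ler_normD _ _)))//.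
  have := lerD E2 E3; lra.
(* For y within d of x, |p y| <= C N(y) <= 2 C (d + N(x)); with the error 4 C d of the extension,
   the excess over 2 C N(x) is 6 C d. *)
- exists (2 * C) => x Hx; apply/ler_addgt0Pr => e e0.
  pose d := e / (6 * C + 1); have C6 : 0 < 6 * C + 1 by rewrite ltr_wpDl// mulr_ge0.
  have d0 : 0 < d by rewrite divr_gt0.
  have [y [Sy Hy Ny]] := dense Hx d0.
  have ny : near_set x d y by split.
  have E1 := extension_near Hx ny; have E2 := p_bound Sy Hy.
  have := N_lin 1 1 (H_lin 1 (-1) Hy Hx) Hx; rewrite lin_subK normr1 !mul1r => NN.
  have : C * N y <= C * (2 * (d + N x)) by rewrite ler_wpM2l//; lra.
  have de : 6 * C * d <= e.
    by rewrite /d mulrCA ler_piMr ?(ltW e0)// ler_pdivrMr// mul1r lerDl.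
  have := ler_distD (p y) (extension x) 0; rewrite !subr0; lra.
Qed.

End ContinuousExtension.

(** * Density of smooth forms *)

Section FormDensity.
Context {R : realType}.
Local Notation lam2 := (@lebesgue_measure R \x @lebesgue_measure R)%E.
Variables (O : set (R * R)) (s : nat) (sigma : R).
Hypotheses (oO : open O) (sigma0 : 0 < sigma).

Lemma sqr_lt (x X e : R) : x ^+ 2 = X -> 0 <= x -> 0 < e -> X < e ^+ 2 -> x < e.
Proof. by move=> <- x0 e0; rewrite ltr_pXn2r ?nnegrE ?(ltW e0). Qed.

Lemma sqrt_weight_le (n w x X : R) : x ^+ 2 = X -> 0 <= x -> 0 < w -> w * n <= X ->
  Num.sqrt n <= Num.sqrt w^-1 * x.
Proof.
move=> <- x0 w0 wn; have -> : x = Num.sqrt (x ^+ 2) by rewrite sqrtr_sqr ger0_norm.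
rewrite -sqrtrM ?invr_ge0 ?(ltW w0)// ler_sqrt; last by rewrite mulr_ge0 ?sqr_ge0// invr_ge0 ltW.
by rewrite ler_pdivlMl// sqrtr_sqr ger0_norm.
Qed.

Lemma form_dense (alpha : form1) (e : R) : Hs_form O s alpha -> 0 < e ->
  exists beta, [/\ smooth_form O beta, Hs_form O s beta &
    Hs_norm sigma O s (form_lin 1 (-1) beta alpha) < e].
Proof.
move=> Ha e0.
pose W : R := \sum_(i < 2) \sum_(k1 < s.+1) \sum_(k2 < s.+1 | (k1 + k2 <= s)%N)
    Hs_weight s sigma (nat_of_ord k1, nat_of_ord k2).
have W0 : 0 <= W.
  apply: sumr_ge0 => i _; apply: sumr_ge0 => k1 _; apply: sumr_ge0 => k2 _.
  by rewrite ltW// Hs_weight_gt0.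
have W1 : 0 < W + 1 by rewrite ltr_wpDl.
(* Every squared derivative error is at most [eta] and the weights add up to [W], so the squared
   norm is at most [W * eta], which is less than e^2. *)
pose eta := e ^+ 2 / (W + 1).
have eta0 : 0 < eta by rewrite divr_gt0// exprn_gt0.
have /choice[beta Hb] i := meyers_serrin oO (Ha i) eta0.
have gE i : form_lin 1 (-1) beta alpha i = (fun x => beta i x - alpha i x).
  by apply/funext => x; rewrite /form_lin mul1r mulN1r.
have Hg i : Hs O s (fun x => beta i x - alpha i x).
  have [_ b2 bk] := Hb i; split => // k ks; have [V [V2 wV _]] := bk k ks.
  by exists V.
have Hgamma : Hs_form O s (form_lin 1 (-1) beta alpha) by move=> i; rewrite gE; exact: Hg.
exists beta; split.
- by move=> i; have [] := Hb i.
- move=> i; rewrite (_ : beta i = (fun x => 1 * (beta i x - alpha i x) + 1 * alpha i x)).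
    exact: Hs_lin.
  by apply/funext => x; rewrite !mul1r subrK.
apply: (sqr_lt (Hs_norm_sqr oO sigma0 Hgamma)) => //; first exact: Hs_norm_ge0.
apply: (@le_lt_trans _ _ (W * eta)).
  rewrite /W /Hs_energy mulr_suml; apply: ler_sum => i _.
  rewrite mulr_suml; apply: ler_sum => k1 _; rewrite mulr_suml; apply: ler_sum => k2 ks.
  rewrite ler_pM2l ?Hs_weight_gt0//.
  have [_ _ /(_ (nat_of_ord k1, nat_of_ord k2) ks)[V [V2 wV nV]]] := Hb i.
  rewrite (nrm2_weak_deriv oO (k := (nat_of_ord k1, nat_of_ord k2)) (v := V) (Hgamma i) ks)// gE.
  exact: wV.
by rewrite /eta mulrCA gtr_pMr ?exprn_gt0// ltr_pdivrMr// mul1r ltrDl.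
Qed.

End FormDensity.

(** * Linearity and boundedness of the pullback integral on smooth forms *)

Section Pullback.
Context {R : realType}.
Local Notation lam2 := (@lebesgue_measure R \x @lebesgue_measure R)%E.
Variables (O : set (R * R)) (phi : R -> R * R) (s : nat) (sigma : R).
Hypotheses (oO : open O) (sigma0 : 0 < sigma) (s1 : (1 <= s)%N) (hphi : lipschitz_immersion O phi).

Let p t := (phi t).1.
Let q t := (phi t).2.

Lemma lipschitz_bound (f : R -> R) : lipschitz f ->
  exists2 L : R, 0 < L & forall x y, `|f x - f y| <= L * `|x - y|.
Proof.
move=> lf; near (pinfty_nbhs R) => L; exists L; first by near: L; exact: nbhs_pinfty_gt.
move=> x y.
have : L.-lipschitz f by near: L.
by move=> /(_ (x, y)); apply.
Unshelve. all: by end_near. Qed.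

Let lip2 : exists2 L : R, 0 < L & (forall x y, `|p x - p y| <= L * `|x - y|) /\
  (forall x y, `|q x - q y| <= L * `|x - y|).
Proof.
have [_ _ /lipschitz_bound[L1 L10 h1] /lipschitz_bound[L2 L20 h2] _] := hphi.
exists (L1 + L2); first by rewrite addr_gt0.
split => x y; [apply: (le_trans (h1 x y))|apply: (le_trans (h2 x y))];
  by rewrite ler_wpM2r// ?lerDl ?lerDr ltW.
Qed.

Let pqE t : (p t, q t) = phi t. Proof. by rewrite /p /q -surjective_pairing. Qed.
Let pqO t : O (p t, q t). Proof. by rewrite pqE; case: hphi. Qed.
Let T0 : (0 : R) < 2 * pi. Proof. by rewrite mulr_gt0// pi_gt0. Qed.

Let per t : p (t + 2 * pi) = p t /\ q (t + 2 * pi) = q t.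
Proof. by case: hphi => h _ _ _ _; rewrite /p /q h. Qed.

Lemma pullback_lin a b (alpha beta : form1) : smooth_form O alpha -> smooth_form O beta ->
  pullback_integral phi (form_lin a b alpha beta) =
  a * pullback_integral phi alpha + b * pullback_integral phi beta.
Proof.
move=> sa sb; have [L L0 [lp lq]] := lip2.
have [B1 _ pB] := derive1_bounded L0 lp; have [B2 _ qB] := derive1_bounded L0 lq.
have mP := measurable_derive1 (lip_continuous L0 lp).
have mQ := measurable_derive1 (lip_continuous L0 lq).
pose D : set R := `[0, 2 * pi]%classic.
have I (g : form1) : smooth_form O g -> (@lebesgue_measure R).-integrable D
   (EFin \o (fun t => g 0 (p t, q t) * derive1 p t + g 1 (p t, q t) * derive1 q t)).
  move=> sg.
  have i0 := curve_form_integrable (2 * pi) L0 lp lq pqO (smooth_on_continuous (sg 0)) mP pB.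
  have i1 := curve_form_integrable (2 * pi) L0 lp lq pqO (smooth_on_continuous (sg 1)) mQ qB.
  have mD : measurable D by exact: measurable_itv.
  by have := @integrableD _ _ R (@lebesgue_measure R) D mD _ _ i0 i1; apply: eq_integrable.
have PE (g : form1) : pullback_integral phi g =
    \int[@lebesgue_measure R]_(t in D) (g 0 (p t, q t) * derive1 p t + g 1 (p t, q t) * derive1 q t).
  by apply: eq_Rintegral => t _; rewrite pqE.
rewrite !PE; have ia := I _ sa; have ib := I _ sb.
have mD : measurable D by exact: measurable_itv.
rewrite -!RintegralZl// -RintegralD//.
- by apply: eq_Rintegral => t _; rewrite /form_lin; ring.
- by have := @integrableZl _ _ R (@lebesgue_measure R) D mD a _ ia; apply: eq_integrable.
- by have := @integrableZl _ _ R (@lebesgue_measure R) D mD b _ ib; apply: eq_integrable.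
Qed.

Lemma pullback_bound : exists2 C : R, 0 <= C & forall alpha : form1,
  smooth_form O alpha -> Hs_form O s alpha ->
  `|pullback_integral phi alpha| <= C * Hs_norm sigma O s alpha.
Proof.
have [L L0 [lp lq]] := lip2.
have pT : p (2 * pi) = p 0 by have [+ _] := per 0; rewrite add0r.
have qT : q (2 * pi) = q 0 by have [_ +] := per 0; rewrite add0r.
have [C C0 HC] := trace_bound oO T0 L0 lp lq pT qT pqO.
(* The weight of order k is one term of the squared norm, so [c k] times the H^s norm bounds the L2
   norm of that derivative. *)
pose c k : R := Num.sqrt (Hs_weight s sigma k)^-1.
exists (C * (c (0, 0)%N + c (0, 1)%N + (c (0, 0)%N + c (1, 0)%N))).
  by rewrite mulr_ge0// !addr_ge0// sqrtr_ge0.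
move=> alpha sa Ha.
have k0 : ((0, 0)%N.1 + (0, 0)%N.2 <= s)%N by [].
have k1 : ((0, 1)%N.1 + (0, 1)%N.2 <= s)%N by [].
have k2 : ((1, 0)%N.1 + (1, 0)%N.2 <= s)%N by [].
have term k i v : (k.1 + k.2 <= s)%N -> L2_on O v -> weak_deriv_of O k (alpha i) v ->
    Num.sqrt (nrm2 lam2 (v \_ O)) <= c k * Hs_norm sigma O s alpha.
  move=> ks v2 wv.
  apply: (sqrt_weight_le (Hs_norm_sqr oO sigma0 Ha) (Hs_norm_ge0 _ _ _ _) (Hs_weight_gt0 s sigma0 k)).
  rewrite -(nrm2_weak_deriv oO (Ha i) ks v2 wv).
  exact: (@Hs_energy_term R O s sigma sigma0 (fun k i => weak_deriv O k (alpha i)) k i ks).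
have La i : L2_on O (alpha i) by case: (Ha i).
have w0 i : weak_deriv_of O (0, 0)%N (alpha i) (alpha i) by move=> psi _; rewrite /= mul1r.
have [d02 wd0] := weak_derivP (Ha 0) k1; have [d12 wd1] := weak_derivP (Ha 1) k2.
have := HC _ _ _ _ (smooth_on_continuous (sa 0)) (smooth_on_continuous (sa 1)) (La 0) (La 1) d02 d12 wd0 wd1.
have -> : pullback_integral phi alpha = \int[@lebesgue_measure R]_(t in `[0, 2 * pi]%classic)
    (alpha 0 (p t, q t) * derive1 p t + alpha 1 (p t, q t) * derive1 q t).
  by apply: eq_Rintegral => t _; rewrite pqE.
move=> /le_trans; apply; rewrite -(mulrA C); apply: (ler_wpM2l C0).
have t1 := term _ _ _ k0 (La 0) (w0 0); have t2 := term _ _ _ k1 d02 wd0.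
have t3 := term _ _ _ k0 (La 1) (w0 1); have t4 := term _ _ _ k2 d12 wd1.
rewrite !mulrDl; exact: (lerD (lerD t1 t2) (lerD t3 t4)).
Qed.

End Pullback.

Unset Implicit Arguments.

Theorem proposition2 (R : realType) (sigma : R) (Omega : set (R * R)) (s : nat)
    (phi : R -> R * R) (hsigma : 0 < sigma) (hOmega : domain Omega)
    (hs : (1 <= s)%N) (hphi : lipschitz_immersion Omega phi) :
  [/\ (* [phi] is well defined on H^s and extends the integral on smooth forms *)
      forall alpha : form1, Hs_form Omega s alpha ->
        ProperFilter (smooth_nbhs sigma Omega s alpha) /\
        cvg (pullback_integral phi @ smooth_nbhs sigma Omega s alpha),
      forall alpha : form1, Hs_form Omega s alpha -> smooth_form Omega alpha ->
        curve_functional sigma Omega s phi alpha = pullback_integral phi alpha,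
      (* [phi] is linear *)
      forall (a b : R) (alpha beta : form1),
        Hs_form Omega s alpha -> Hs_form Omega s beta ->
        curve_functional sigma Omega s phi (form_lin a b alpha beta) =
        a * curve_functional sigma Omega s phi alpha +
        b * curve_functional sigma Omega s phi beta
    & (* [phi] is bounded *)
      exists C : R, forall alpha : form1, Hs_form Omega s alpha ->
        `|curve_functional sigma Omega s phi alpha| <=
        C * Hs_norm sigma Omega s alpha].
Proof.
have [oO _ _] := hOmega.
have [C C0 pC] := pullback_bound oO hsigma hs hphi.
(* [smooth_nbhs] and [curve_functional] are the filter and the limit of the abstract extension for
   these data, so its four conclusions are the four clauses. *)
apply: (@extension_spec R form1 form_lin (Hs_form Omega s) (smooth_form Omega)
  (Hs_norm sigma Omega s) (pullback_integral phi) C) => //.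
- by move=> alpha; exact: Hs_norm_ge0.
- by move=> a b alpha beta; exact: Hs_form_lin.
- move=> a b alpha beta sa sb i.
  exact: (smooth_onD oO (smooth_onZ a oO (sa i)) (smooth_onZ b oO (sb i))).
- by move=> a b alpha beta; exact: Hs_norm_lin.
- by move=> a b alpha beta; exact: (pullback_lin hphi).
- by move=> alpha e; exact: form_dense.
- by move=> x y z; apply/funext => i; apply/funext => t; rewrite /form_lin; ring.
- by move=> a b x y x' y'; apply/funext => i; apply/funext => t; rewrite /form_lin; ring.
- by move=> x; apply/funext => i; apply/funext => t; rewrite /form_lin; ring.
- by move=> x y; apply/funext => i; apply/funext => t; rewrite /form_lin; ring.
Qed.
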